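(* Let $X = X_1 \times \cdots \times X_N$ be a direct product of finite-dimensional Euclidean spaces, let $H : X \to \mathbb{R}$ be smooth and convex at infinity, and let $\mu(dx) = Z^{-1} \exp(-H(x))\,dx$ be a probability measure on $X$. Assume that: (i) for each $1 \le i \le N$ there is $\varrho_i > 0$ such that the conditional measures $\mu(dx_i \mid \bar x_i)$ satisfy the Poincaré inequality with constant $\varrho_i$ uniformly in $\bar x_i$, i.e. for every $\bar x_i$ and every smooth function $h : X_i \to \mathbb{R}$, $$\int \Big(h - \int h \, d\mu(\cdot \mid \bar x_i)\Big)^2 d\mu(\cdot\mid \bar x_i) \le \frac{1}{\varrho_i} \int |\nabla h|^2 \, d\mu(\cdot \mid \bar x_i);$$ (ii) the numbers $\kappa_{ij} = \kappa_{ji}$, $1 \le i \ne j \le N$, satisfy $|\nabla_i \nabla_j H(x)| \le \kappa_{ij} < \infty$ for all $x \in X$, where $|\cdot|$ denotes the operator norm of a bilinear form; (iii) the symmetric $N\times N$ matrix $A = (A_{ij})$ with $A_{ii} = \varrho_i$ and $A_{ij} = -\kappa_{ij}$ for $i \ne j$ is positive definite. Let $f : X \to \mathbb{R}$ be a smooth function in $L^2(\mu)$ and let $\varphi \in H^1(\mu)$ be a solution of $$-\nabla \cdot (\mu \nabla \varphi) = \Big(f - \int f \, d\mu\Big)\mu,$$ in the sense that for all $\zeta \in H^1(\mu)$, $$\int \nabla \zeta \cdot \nabla \varphi \, d\mu = \int \zeta \Big(f - \int f\,d\mu\Big) d\mu .$$ Then for all $i \in \{1,\dots,N\}$, $$\left(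 \int |\nabla_i \varphi|^2 \, d\mu \right)^{1/2} \le \sum_{j=1}^N (A^{-1})_{ij} \left( \int |\nabla_j f|^2 \, d\mu \right)^{1/2}.$$
   Context: For $x = (x_1,\dots,x_N) \in X_1\times\cdots\times X_N$, $\bar x_i$ denotes the collection of all coordinates $x_j$ with $j \ne i$, and $\mu(dx_i \mid \bar x_i)$ is the conditional probability measure on $X_i$ given $\bar x_i$, i.e. the probability measure on $X_i$ with Lebesgue density proportional to $x_i \mapsto \exp(-H(x))$ with $\bar x_i$ fixed. $\nabla_i$ denotes the gradient with respect to $x_i \in X_i$, and $\nabla_i\nabla_j H(x)$ is the corresponding mixed second derivative, viewed as a bilinear form on $X_i \times X_j$. Norms and gradients are derived from the Euclidean structure. In the elliptic equation $\mu$ also denotes the Lebesgue density of the measure $\mu$. $H^1(\mu)$ is the space of functions in $L^2(\mu)$ whose weak gradient is in $L^2(\mu)$. $H$ is called convex at infinity if it is a bounded perturbation of a convex function, i.e. $H = H_c + b$ with $H_c$ convex and $b$ bounded. Right-hand sides of inequalities are understood in $[0,\infty]$ with the convention $0\cdot\infty = 0$. *)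

(* Defs.v *)
From HB Require Import structures.
From mathcomp Require Import all_boot all_order all_algebra.
From mathcomp Require Import all_classical all_reals all_analysis.

Set Implicit Arguments.
Unset Strict Implicit.
Unset Printing Implicit Defensive.

Import Order.TTheory GRing.Theory Num.Theory.
Import numFieldNormedType.Exports.

Local Open Scope classical_set_scope.
Local Open Scope ring_scope.

(* X_i is R^(n i), represented by 'rV[R]_(n i); the product of the X_i is
   'rV[R]_(\sum_i n i), and the component in X_i of x is [submxrow x i].
   The norm [`|x|] of the library on row vectors is the sup norm: it only
   provides the topology, all lengths below are Euclidean ([enorm]). *)

(* The sigma-algebra generated by the coordinates, i.e. the Borel one. *)
Section measurable_rV.
Context {R : realType} {n : nat}.

Let coords : 'I_n -> 'rV[R]_n -> R := fun j x => x ord0 j.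

Let rV_set0 : g_sigma_preimage coords set0.
Proof. exact: sigma_algebra0. Qed.

Let rV_setC A : g_sigma_preimage coords A -> g_sigma_preimage coords (~` A).
Proof. exact: sigma_algebraC. Qed.

Let rV_bigcup (F : _^nat) : (forall i, g_sigma_preimage coords (F i)) ->
  g_sigma_preimage coords (\bigcup_i (F i)).
Proof. exact: sigma_algebra_bigcup. Qed.

HB.instance Definition _ := @isMeasurable.Build
  (measure_tuple_display default_measure_display)
  'rV[R]_n (g_sigma_preimage coords) rV_set0 rV_setC rV_bigcup.

Lemma measurable_coord (j : 'I_n) :
  measurable_fun [set: 'rV[R]_n] (fun x => x ord0 j : R).
Proof.
move=> _ Y mY; rewrite setTI; apply: sub_sigma_algebra => /=.
rewrite -bigcup_seq/=; exists j => /=; first by rewrite mem_index_enum.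
by exists Y => //; rewrite setTI.
Qed.

Lemma measurable_fun_rV d (T : measurableType d) (f : T -> 'rV[R]_n) :
  (forall j, measurable_fun [set: T] (fun t => f t ord0 j : R)) ->
  measurable_fun [set: T] f.
Proof.
move=> mf.
suff : g_sigma_preimage (fun j => coords j \o f) `<=` measurable.
  rewrite g_sigma_preimage_comp => mC _ A mA.
  by apply: mC; exists A.
apply: smallest_sub; first exact: sigma_algebra_measurable.
rewrite -bigcup_seq; apply: bigcup_sub => j _ A [B mB <-].
exact: mf.
Qed.

End measurable_rV.

(* Lebesgue measure on R^(m.+1) is the image of the product of Lebesgue
   measure on R and Lebesgue measure on R^m under (t, x) |-> (t, x_0, ...). *)
Section consr.
Context {R : realType} {m : nat}.
Variable lambda : {sigma_finite_measure set 'rV[R]_m -> \bar R}.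

Definition consr (p : measurableTypeR R * 'rV[R]_m) : 'rV[R]_m.+1 :=
  row_mx (p.1)%:M p.2.

Lemma measurable_consr : measurable_fun setT consr.
Proof.
apply: measurable_fun_rV => j.
case: (@split_ordP 1 m j) => k ->.
  rewrite (_ : (fun _ => _) = fst); first exact: measurable_fst.
  apply/funext => p.
  rewrite (row_mxEl (p.1)%:M p.2 ord0 k : consr p ord0 _ = _) mxE. by rewrite !ord1.
rewrite (_ : (fun _ => _) = (fun x : 'rV[R]_m => x ord0 k) \o snd).
  exact: (measurableT_comp (measurable_coord k) measurable_snd).
apply/funext => p.
by rewrite (row_mxEr (p.1)%:M p.2 ord0 k : consr p ord0 _ = _).
Qed.

Definition lebesgue_consr : set 'rV[R]_m.+1 -> \bar R :=
  pushforward (@lebesgue_measure R \x lambda)%E consr.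

Let lebesgue_consr0 : lebesgue_consr set0 = 0%E.
Proof. by rewrite /lebesgue_consr /pushforward preimage_set0 measure0. Qed.

Let lebesgue_consr_ge0 A : (0 <= lebesgue_consr A)%E.
Proof. apply: measure_ge0; exact: measurable_consr. Qed.

Let lebesgue_consr_sigma_additive : semi_sigma_additive lebesgue_consr.
Proof. apply: measure_semi_sigma_additive; exact: measurable_consr. Qed.

HB.instance Definition _ := isMeasure.Build _ _ _ lebesgue_consr
  lebesgue_consr0 lebesgue_consr_ge0 lebesgue_consr_sigma_additive.

Let lebesgue_consr_sigma_finite : sigma_finite setT lebesgue_consr.
Proof.
have /sigma_finiteP[F [UF ndF Foo]] := sigma_finiteT (@lebesgue_measure R).
have /sigma_finiteP[G [UG ndG Goo]] := sigma_finiteT lambda.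
pose split (x : 'rV[R]_m.+1) : measurableTypeR R * 'rV[R]_m :=
  (@lsubmx _ 1 1 m x ord0 ord0, @rsubmx _ 1 1 m x).
have msplit : measurable_fun setT split.
  apply: measurable_fun_pair => /=.
    rewrite (_ : (fun _ => _) = fun x : 'rV[R]_m.+1 => x ord0 (@lshift 1 m ord0)).
      exact: measurable_coord.
    by apply/funext => x; rewrite mxE.
  apply: measurable_fun_rV => j.
  rewrite (_ : (fun _ => _) = fun x : 'rV[R]_m.+1 => x ord0 (rshift 1 j)).
    exact: measurable_coord.
  by apply/funext => x; rewrite mxE.
have consrK : cancel consr split.
  by case=> t x; rewrite /split/= row_mxKl row_mxKr !mxE.
exists (fun k => split @^-1` (F k `*` G k)).
  apply/esym/seteqP; split => // x _.
  have [[a _ Fa] [b _ Gb]] : (\bigcup_k F k) (split x).1 /\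
      (\bigcup_k G k) (split x).2 by rewrite -UF -UG.
  exists (maxn a b) => //; split.
  - by move: Fa; exact/subsetPset/ndF/leq_maxl.
  - by move: Gb; exact/subsetPset/ndG/leq_maxr.
move=> k; have [mFk Fk] := Foo k; have [mGk Gk] := Goo k.
have mFG : measurable (F k `*` G k) by exact: measurableX.
split; first by rewrite -[X in measurable X]setTI; exact: msplit.
rewrite /lebesgue_consr /pushforward -comp_preimage.
rewrite (_ : split \o consr = id); last exact/funext.
by rewrite preimage_id product_measure1E// lte_mul_pinfty// ge0_fin_numE.
Qed.

HB.instance Definition _ := Measure_isSigmaFinite.Build _ _ _ lebesgue_consr
  lebesgue_consr_sigma_finite.

End consr.

Fixpoint lebesgue_rV (R : realType) (n : nat) :
    {sigma_finite_measure set 'rV[R]_n -> \bar R} :=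
  if n is m.+1 then lebesgue_consr (lebesgue_rV R m) else \d_(0 : 'rV[R]_0).
Arguments lebesgue_rV {R} n.

Section euclidean.
Context {R : realType}.

Definition dotv n (u v : 'rV[R]_n) : R := \sum_(k < n) u ord0 k * v ord0 k.

Definition enorm n (u : 'rV[R]_n) : R := Num.sqrt (dotv u u).

(* The bilinear form (u, v) |-> u *m B *m v^T on R^p x R^q. *)
Definition bilin_norm p q (B : 'M[R]_(p, q)) : \bar R :=
  ereal_sup [set `|(u *m B *m v^T) ord0 ord0|%:E |
    u in [set u : 'rV[R]_p | enorm u <= 1] &
    v in [set v : 'rV[R]_q | enorm v <= 1]].

Definition posdefmx n (A : 'M[R]_n) : Prop :=
  A^T = A /\ forall v : 'rV[R]_n, v != 0 -> 0 < (v *m A *m v^T) ord0 ord0.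

End euclidean.

Section calculus.
Context {R : realType} {n : nat}.
Implicit Types (f g : 'rV[R]_n -> R).

Definition partial f (k : 'I_n) : 'rV[R]_n -> R := 'D_(delta_mx ord0 k) f.

Definition gradient f (x : 'rV[R]_n) : 'rV[R]_n := \row_k partial f k x.

Definition hessian f (x : 'rV[R]_n) : 'M[R]_n :=
  \matrix_(k, l) partial (partial f l) k x.

Fixpoint Ck (k : nat) f : Prop :=
  if k is k'.+1 then
    (forall x, differentiable f x) /\ (forall j, Ck k' (partial f j))
  else continuous f.

Definition smooth f : Prop := forall k, Ck k f.

Definition convex_at_infinity f : Prop :=
  exists fc b : 'rV[R]_n -> R,
    [/\ convex_function (E := 'rV[R]_n) setT fc,
        exists M : R, forall x, `|b x| <= M &
        forall x, f x = fc x + b x].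

Definition test_function f : Prop :=
  smooth f /\ compact (closure [set x | f x != 0]).

(* g is the distributional gradient of f.  Only meaningful for f and g locally
   integrable with respect to Lebesgue measure. *)
Definition weak_gradient f (g : 'rV[R]_n -> 'rV[R]_n) : Prop :=
  forall psi, test_function psi -> forall k,
    \int[lebesgue_rV n]_x (f x * partial psi k x) =
    - \int[lebesgue_rV n]_x (g x ord0 k * psi x).

End calculus.

Section measures.
Context {R : realType} {n : nat}.

(* P is the probability measure Z^-1 exp(-H) dx. *)
Definition gibbs (H : 'rV[R]_n -> R) (P : probability 'rV[R]_n R) : Prop :=
  exists Z : R, forall A, measurable A ->
    P A = (\int[lebesgue_rV n]_(x in A) (Z^-1 * expR (- H x))%:E)%E.

(* The right-hand side is in [0, +oo].  The test functions h are restricted to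
   the integrable ones, for which the mean in the left-hand side exists. *)
Definition poincare (rho : R) (P : probability 'rV[R]_n R) : Prop :=
  forall h : 'rV[R]_n -> R, smooth h -> P.-integrable setT (EFin \o h) ->
    (\int[P]_x ((h x - \int[P]_y h y)%R ^+ 2)%:E <=
     (rho^-1)%:E * \int[P]_x (enorm (gradient h x) ^+ 2)%:E)%E.

(* H^1(P): an element is a function u of L^2(P) together with its weak gradient
   du, which is in L^2(P).  When P has a density that is locally bounded away
   from 0, u and du are locally Lebesgue integrable, so that [weak_gradient]
   makes sense and determines du almost everywhere. *)
Definition sobolev1 (P : probability 'rV[R]_n R)
    (u : 'rV[R]_n -> R) (du : 'rV[R]_n -> 'rV[R]_n) : Prop :=
  [/\ u \in Lfun P 2%:E,
      forall k, (fun x => du x ord0 k) \in Lfun P 2%:E &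
      weak_gradient u du].

(* -div (P grad phi) = (f - \int f dP) P, in the weak sense. *)
Definition weak_poisson (P : probability 'rV[R]_n R) (f : 'rV[R]_n -> R)
    (dphi : 'rV[R]_n -> 'rV[R]_n) : Prop :=
  forall zeta dzeta, sobolev1 P zeta dzeta ->
    \int[P]_x dotv (dzeta x) (dphi x) =
    \int[P]_x (zeta x * (f x - \int[P]_y f y)).

End measures.

Section blocks.
Context {R : realType} {N : nat} {n : 'I_N -> nat}.
Local Notation X := 'rV[R]_(\sum_i n i).

(* x with its component in X_i replaced by y *)
Definition set_block (x : X) (i : 'I_N) (y : 'rV[R]_(n i)) : X :=
  \mxrow_j eqtype.dfwith (fun j => submxrow x j) y j.

(* nu is the conditional measure mu(dx_i | xbar_i), where xbar_i is given by
   the components of x other than the i-th one. *)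
Definition conditional (H : X -> R) (i : 'I_N) (x : X)
    (nu : probability 'rV[R]_(n i) R) : Prop :=
  gibbs (fun y => H (set_block x y)) nu.

Definition coupling_mx (rho : 'I_N -> R) (kappa : 'I_N -> 'I_N -> R) : 'M[R]_N :=
  \matrix_(i, j) if i == j then rho i else - kappa i j.

End blocks.

(* Main.v *)
(* The solution phi is mollified to u = convol phi k, which is smooth and satisfies
   - lap u = f - m + r; the residual r is a sum of commutators between the
   mollification and multiplication by smooth functions, hence small in L^2 on
   compact sets.  For a block i let g be the part of lap u along X_i, and eta a
   cutoff.  Two inequalities are combined.
   - Bochner: integrating by parts twice, the integral of (eta g)^2 is at most that
     of eta^2 (grad_i u . grad_i f - sum_(j != i) grad_i grad_j H (grad_i u, grad_j u))
     up to errors from r and grad eta.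
   - The Poincare inequality on the fibres of X_i in its dual form: the integral of
     |grad_i u|^2 is at most rho_i^-1 times that of g^2.
   When the cutoff is removed and the mollification refined, the energies converge
   to a_i^2 = \int |grad_i phi|^2, because the weak equation tested with eta u, and
   with phi itself, gives the matching lower bound on the total energy.  This yields
   rho_i a_i <= |grad_i f| + sum_(j != i) kappa_ij a_j whenever |grad_i f| is finite,
   that is, (A a)_i <= |grad_i f|, and the inverse of A is entrywise nonnegative
   since A is positive definite with nonpositive off-diagonal entries. *)

(* The Bochner computation takes three derivatives, while the solution has a single weak one; this
   is why it is carried out on the smooth [u]. Mollification bounds energies from above only, by
   Jensen, whereas the Poincare side needs a lower bound for the energy of one block. The weak
   equation bounds the total energy from below, and subtracting the upper bounds for the other
   coordinates leaves the bound for the block. The fibre inequality is applied to the compactly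
   supported h = zeta u, where zeta is 1 on the support of eta. The energy of h then stands opposite
   to twice the energy of eta grad u; both are close to a_i^2, so one copy survives. The two
   inequalities are joined by Young's inequality with a parameter t, which turns errors of size d
   into d / t. The choice d = t^2 makes every error O(t). The limit is quadratic in the a_j, and
   division by a_i makes it linear. Constants depending on the dimension occur throughout, because
   sums over coordinates are estimated term by term. They multiply error terms only and disappear in
   the limit. *)
Require Import Defs.
From HB Require Import structures.
From mathcomp Require Import all_boot all_order all_algebra.
From mathcomp Require Import all_classical all_reals all_analysis.
From mathcomp Require Import measurable_realfun.
From mathcomp Require Import ring lra.

Set Implicit Arguments.
Unset Strict Implicit.
Unset Printing Implicit Defensive.

Import Order.TTheory GRing.Theory Num.Theory.
Import numFieldNormedType.Exports.

Local Open Scope classical_set_scope.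
Local Open Scope ring_scope.

(** * Measurability and Lebesgue measure on row vectors *)

Section measurability.
Context {R : realType} {n : nat}.
Implicit Types (U : set 'rV[R]_n).

Lemma measurable_box (B : 'I_n -> set R) : (forall j, measurable (B j)) ->
  measurable [set x : 'rV[R]_n | forall j, B j (x ord0 j)].
Proof.
move=> mB; rewrite (_ : [set _ | _] = \bigcap_(j in [set: 'I_n])
    ((fun x : 'rV[R]_n => x ord0 j : R) @^-1` B j)).
  apply: fin_bigcap_measurable; first exact: finite_finset.
  by move=> j _; rewrite -[X in measurable X]setTI; exact: measurable_coord.
by apply/seteqP; split => x /= xB j; [move=> _|]; exact: xB.
Qed.

Lemma measurable_cube (c : 'rV[R]_n) (r : R) :
  measurable [set x : 'rV[R]_n | forall j, `|x ord0 j - c ord0 j| < r].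
Proof.
apply: (measurable_box (B := fun j => [set t : R | `|t - c ord0 j| < r])) => j.
rewrite (_ : [set _ | _] = `]c ord0 j - r, c ord0 j + r[%classic) //.
by apply/seteqP; split => t /=; rewrite in_itv/= ltr_norml => /andP[? ?];
    apply/andP; split; lra.
Qed.

Lemma measurable_closed_cube (r : R) :
  measurable [set x : 'rV[R]_n | forall j, `|x ord0 j| <= r].
Proof.
apply: (measurable_box (B := fun j => [set t : R | `|t| <= r])) => j.
rewrite (_ : [set _ | _] = `[- r, r]%classic) //.
by apply/seteqP; split => t /=; rewrite in_itv/= ler_norml.
Qed.

Lemma ball_rVP (c x : 'rV[R]_n) (r : R) : 0 < r ->
  (`|x - c| < r) <-> (forall j, `|x ord0 j - c ord0 j| < r).
Proof.
move=> r0; split=> [xc j|xc].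
  apply: le_lt_trans xc.
  rewrite [leRHS]/Num.norm/= mx_normrE.
  rewrite (_ : x ord0 j - c ord0 j = (x - c) ord0 j); last by rewrite !mxE.
  by apply: (@le_bigmax _ _ _ _ (fun i : 'I_1 * 'I_n => `|(x - c) i.1 i.2|) (ord0,j)).
rewrite /Num.norm/= mx_normrE; apply/bigmax_ltP; split => // -[i j] _ /=.
by rewrite !mxE ord1.
Qed.

Lemma rat_approx_rV (x : 'rV[R]_n) (d : R) : 0 < d ->
  exists q : 'rV[rat]_n, forall j, `|x ord0 j - ratr (q ord0 j)| < d.
Proof.
move=> d0; have H j : exists q : rat, `|x ord0 j - ratr q| < d.
  have : x ord0 j - d < x ord0 j + d by lra.
  move=> /rat_in_itvoo[q]; rewrite in_itv/= => /andP[q1 q2]; exists q.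
  by rewrite ltr_norml; apply/andP; split; lra.
exists (\row_j projT1 (cid (H j))) => j; rewrite mxE; exact: projT2 (cid (H j)).
Qed.

(** The sigma-algebra is generated by the coordinates, so openness enters through second
    countability: [U] is the countable union of the cubes with rational centre and radius
    [k.+1%:R^-1] that it contains. *)
Lemma open_measurable_rV U : open U -> measurable U.
Proof.
move=> oU.
pose I := ('rV[rat]_n * nat)%type.
pose D := [set i : I | [set x : 'rV[R]_n | forall j,
  `|x ord0 j - (map_mx ratr i.1 : 'rV[R]_n) ord0 j| < i.2.+1%:R^-1] `<=` U].
rewrite (_ : U = \bigcup_(i in D) [set x : 'rV[R]_n | forall j,
  `|x ord0 j - (map_mx ratr i.1 : 'rV[R]_n) ord0 j| < i.2.+1%:R^-1]).
  rewrite bigcup_mkcond; apply: countable_bigcupT_measurable => [|i].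
    exact: countableP.
  by case: ifPn => // _; exact: measurable_cube.
apply/seteqP; split => [x Ux|x [i Di]]; last exact: Di.
have /nbhs_ballP := open_nbhs_nbhs (conj oU Ux); move=> [e /= e0 xeU].
(* Half of [e], because a point of the cube around [q] is only known to be within twice the radius
   of [x]. *)
have e20 : 0 < e / 2 by rewrite divr_gt0.
have [k ke] : exists k, k.+1%:R^-1 < e / 2.
  have := @near_infty_natSinv_lt R (PosNum e20).
  by move=> [k _ /(_ k (leqnn _))]; exists k.
have k0 : 0 < k.+1%:R^-1 :> R by rewrite invr_gt0.
have [q qx] := rat_approx_rV x k0.
exists (q, k) => /=; last by move=> j; rewrite mxE.
move=> y /= yq; apply: xeU; rewrite -ball_normE/= /ball_/=.
rewrite distrC; apply/ball_rVP => // j.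
have := yq j; have := qx j; rewrite mxE.
move: ke k0; move: (k.+1%:R^-1) => d ke d0; rewrite !ltr_norml => /andP[? ?] /andP[? ?].
by apply/andP; split; lra.
Qed.

Lemma continuous_measurable_rV (f : 'rV[R]_n -> R) : continuous f ->
  measurable_fun setT f.
Proof.
move=> /continuousP cf; apply: (measurability _ (RGenOpens.measurableE R)) => _ [_ [a [b ->] <-]].
rewrite setTI; apply: open_measurable_rV; apply: cf; exact: interval_open.
Qed.

Lemma continuous_rV (T : topologicalType) (f : T -> 'rV[R]_n) :
  (forall j, continuous (fun t => f t ord0 j)) -> continuous f.
Proof.
move=> cf t; apply/cvgrPdist_lt => e e0.
have H j : \forall s \near t, `|f t ord0 j - f s ord0 j| < e.
  by have /cvgrPdist_lt := cf j t; apply.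
have : \forall s \near t, forall j, `|f t ord0 j - f s ord0 j| < e.
  exact: filter_forall.
by apply: filterS => s Hs; apply/ball_rVP.
Qed.

End measurability.

Section lebesgue_rV_theory.
Context {R : realType}.
Local Open Scope ereal_scope.

(** The image of Lebesgue measure under a translation has the same values on half-open intervals,
    which determine it. *)
Lemma ge0_integral_translation1 (a : R) (f : R -> \bar R) :
  measurable_fun [set: R] f -> (forall t, 0 <= f t) ->
  \int[lebesgue_measure]_t f (t + a)%R = \int[lebesgue_measure]_t f t.
Proof.
move=> mf f0.
have ms : measurable_fun setT (fun t : measurableTypeR R => (t + a)%R : measurableTypeR R).
  exact: measurable_funD.
transitivity (\int[pushforward lebesgue_measure
    (fun t : measurableTypeR R => (t + a)%R : measurableTypeR R)]_t f t).
  by rewrite ge0_integral_pushforward// preimage_setT.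
apply: eq_measure_integral => //= A mA _; apply/esym/lebesgue_measure_unique => //= _ [[c b]] _ <-.
rewrite /pushforward [X in _ = lebesgue_measure X](_ : _ = `](c - a)%R, (b - a)%R]%classic).
  rewrite !lebesgue_measure_itv/= !lte_fin ltrD2r.
  by case: ifPn => // _; congr (_%:E); lra.
by apply/seteqP; split => t /=; rewrite !in_itv/= => /andP[? ?]; apply/andP; split; lra.
Qed.

(** Tonelli for the pushforward that defines [lebesgue_rV m.+1]; it carries the induction on the
    dimension for translation invariance. *)
Lemma ge0_integral_rVS m (f : 'rV[R]_m.+1 -> \bar R) :
  measurable_fun setT f -> (forall x, 0 <= f x) ->
  \int[lebesgue_rV m.+1]_x f x =
  \int[lebesgue_measure]_t \int[lebesgue_rV m]_y f (consr (t, y)).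
Proof.
move=> mf f0.
rewrite -(@fubini_tonelli1 _ _ _ _ _ _ _ (fun p => f (consr p)))//; last first.
  exact: (measurableT_comp mf measurable_consr).
transitivity (\int[pushforward (lebesgue_measure \x lebesgue_rV m) consr]_x f x) => //.
by rewrite ge0_integral_pushforward// ?preimage_setT//; exact: measurable_consr.
Qed.

Lemma consrEl m (t : R) (y : 'rV[R]_m) (k : 'I_1) : consr (t, y) ord0 (lshift m k) = t.
Proof.
by rewrite (row_mxEl t%:M y ord0 k : consr (t, y) ord0 _ = _) mxE !ord1 eqxx mulr1n.
Qed.

Lemma consrEr m (t : R) (y : 'rV[R]_m) (k : 'I_m) : consr (t, y) ord0 (rshift 1 k) = y ord0 k.
Proof. exact: (row_mxEr t%:M y ord0 k). Qed.

Lemma measurable_addrV n (h : 'rV[R]_n) : measurable_fun setT (fun x : 'rV[R]_n => (x + h)%R).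
Proof.
apply: measurable_fun_rV => j.
rewrite (_ : (fun _ => _) = fun x : 'rV[R]_n => (x ord0 j + h ord0 j)%R); last first.
  by apply/funext => x; rewrite mxE.
apply: measurable_funD => //; exact: measurable_coord.
Qed.

Lemma ge0_integral_translation n (h : 'rV[R]_n) (f : 'rV[R]_n -> \bar R) :
  measurable_fun setT f -> (forall x, 0 <= f x) ->
  \int[lebesgue_rV n]_x f (x + h)%R = \int[lebesgue_rV n]_x f x.
Proof.
elim: n h f => [|m IH] h f mf f0.
  by apply: eq_integral => x _; congr f; apply/rowP => -[].
rewrite !ge0_integral_rVS//; last first.
  by apply: (measurableT_comp mf); exact: measurable_addrV.
pose h0 := h ord0 (@lshift 1 m ord0); pose h1 := @rsubmx R 1 1 m h.
have mfc : measurable_fun setT (fun p => f (consr p)).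
  exact: (measurableT_comp mf (@measurable_consr R m)).
transitivity (\int[lebesgue_measure]_t \int[lebesgue_rV m]_y f (consr ((t + h0)%R, y))).
  apply: eq_integral => t _.
  rewrite -(IH h1 (fun y => f (consr ((t + h0)%R, y))))//.
    apply: eq_integral => y _; congr f; apply/rowP => j; rewrite [LHS]mxE.
    case: (@split_ordP 1 m j) => k ->; last by rewrite !consrEr !mxE.
    by rewrite !consrEl ord1.
  by apply: (measurableT_comp mfc); exact: measurable_pair1.
rewrite (ge0_integral_translation1 h0 (f := fun t => \int[lebesgue_rV m]_y f (consr (t, y))))//.
  by apply: (@measurable_fun_fubini_tonelli_F _ _ _ _ _ (lebesgue_rV m) (fun p => f (consr p))).
by move=> t; exact: integral_ge0.
Qed.

Lemma lebesgue_rV_cube n (M : R) : (0 <= M)%R ->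
  lebesgue_rV n [set x : 'rV[R]_n | forall j, (`|x ord0 j| <= M)%R] = ((2 * M) ^+ n)%:E.
Proof.
move=> M0; elim: n => [|m IH].
  by rewrite /= diracE expr0 mem_set//= => -[].
rewrite /= /lebesgue_consr /pushforward.
transitivity ((lebesgue_measure \x lebesgue_rV m)%E
    (`[(- M)%R, M]%classic `*` [set x : 'rV[R]_m | forall j, (`|x ord0 j| <= M)%R])).
  congr ((lebesgue_measure \x lebesgue_rV m)%E _).
  apply/seteqP; split => -[t y] /=.
    move=> H; split => [|j].
      by have := H (@lshift 1 m ord0); rewrite consrEl in_itv/= ler_norml.
    by have := H (@rshift 1 m j); rewrite consrEr.
  rewrite in_itv/= => -[tM yM] j.
  by case: (@split_ordP 1 m j) => k ->; rewrite ?consrEl ?consrEr// ler_norml.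
rewrite product_measure1E//; last exact: measurable_closed_cube.
rewrite IH/=. rewrite lebesgue_measure_itv/= lte_fin.
case: ifPn => [_|]; first by rewrite exprS EFinM; congr (_ * _); congr (_%:E); lra.
rewrite -leNgt => M0'; have -> : M = 0%R by lra.
by rewrite mul0e mulr0 expr0n.
Qed.

End lebesgue_rV_theory.

(** * Calculus of smooth functions *)

Section calculus_theory.
Context {R : realType}.

Lemma is_derive_line n (f : 'rV[R]_n -> R) (x v : 'rV[R]_n) (t : R) :
  differentiable f (x + t *: v) ->
  is_derive t 1 (fun s : R => f (x + s *: v)) ('D_v f (x + t *: v)).
Proof.
move=> /(@diff_derivable _ _ _ _ _ v) df.
have E : (fun h : R => h^-1 *: (((fun s : R => f (x + s *: v)) \o shift t) (h *: 1) -
    f (x + t *: v))) =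
    (fun h : R => h^-1 *: ((f \o shift (x + t *: v)) (h *: v) - f (x + t *: v))).
  apply/funext => h /=; congr (_ *: (f _ - _)).
  by rewrite [h *: 1]mulr1 scalerDl addrCA.
by apply: DeriveDef; rewrite /derivable /derive E.
Qed.

Lemma derive_sum_partial n (f : 'rV[R]_n -> R) (x v : 'rV[R]_n) :
  differentiable f x -> 'D_v f x = \sum_(a < n) v ord0 a * partial f a x.
Proof.
move=> df; rewrite deriveE// {1}[v]row_sum_delta linear_sum/=.
by apply: eq_bigr => a _; rewrite linearZ/= /partial deriveE.
Qed.

Lemma Ck_differentiable n k (f : 'rV[R]_n -> R) : Ck k.+1 f -> forall x, differentiable f x.
Proof. by case. Qed.

Lemma Ck_continuous n k (f : 'rV[R]_n -> R) : Ck k f -> continuous f.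
Proof. by case: k => // k [df _] x; exact: differentiable_continuous. Qed.

Lemma CkW n k (f : 'rV[R]_n -> R) : Ck k.+1 f -> Ck k f.
Proof.
elim: k f => [|k IH] f; first exact: Ck_continuous.
by move=> [df pf]; split => // j; apply: IH; exact: pf.
Qed.

Lemma Ck_cst n k (c : R) : Ck k (fun _ : 'rV[R]_n => c).
Proof.
elim: k c => [|k IH] c; first exact: cst_continuous.
split => [x|j]; first exact: differentiable_cst.
rewrite (_ : partial _ j = fun=> 0) //; apply/funext => x.
by rewrite /partial derive_cst.
Qed.

Lemma partialD n (f g : 'rV[R]_n -> R) j x : differentiable f x -> differentiable g x ->
  partial (fun y => f y + g y) j x = partial f j x + partial g j x.
Proof. by move=> df dg; rewrite /partial (@deriveD _ _ _ f g)//; exact: diff_derivable. Qed.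

Lemma partialM n (f g : 'rV[R]_n -> R) j x : differentiable f x -> differentiable g x ->
  partial (fun y => f y * g y) j x = f x * partial g j x + g x * partial f j x.
Proof. by move=> df dg; rewrite /partial (@deriveM _ _ f g)//; exact: diff_derivable. Qed.

Lemma partial_expR n (f : 'rV[R]_n -> R) j x : differentiable f x ->
  partial (fun y => expR (f y)) j x = expR (f x) * partial f j x.
Proof.
move=> df; have de : differentiable (expR : R -> R) (f x).
  exact/derivable1_diffP/derivable_expR.
have L := @is_derive_line _ (fun y => expR (f y)) x (delta_mx ord0 j) 0.
have Lf := @is_derive_line _ f x (delta_mx ord0 j) 0.
rewrite scale0r addr0 in L Lf.
have {}L := L (differentiable_comp df de).
have {}Lf := Lf df.
have := @is_derive1_comp R expR (fun s => f (x + s *: delta_mx ord0 j)) 0 _ _ (is_derive_expR _) Lf.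
move=> Le; rewrite /partial -(@derive_val _ _ _ _ _ _ _ L) (@derive_val _ _ _ _ _ _ _ Le).
by rewrite scale0r addr0.
Qed.

Lemma CkD n k (f g : 'rV[R]_n -> R) : Ck k f -> Ck k g -> Ck k (fun x => f x + g x).
Proof.
elim: k f g => [|k IH] f g /=; first by move=> cf cg x; exact: (cvgD (cf x) (cg x)).
move=> [df pf] [dg pg]; split => [x|j]; first exact: differentiableD.
rewrite (_ : partial _ j = fun x => partial f j x + partial g j x); first exact: IH.
by apply/funext => x; rewrite partialD.
Qed.

Lemma CkM n k (f g : 'rV[R]_n -> R) : Ck k f -> Ck k g -> Ck k (fun x => f x * g x).
Proof.
elim: k f g => [|k IH] f g; first by move=> cf cg x; exact: (cvgM (cf x) (cg x)).
move=> Cf Cg; have [[df pf] [dg pg]] := (Cf, Cg).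
split => [x|j]; first exact: differentiableM.
rewrite (_ : partial _ j = fun x => f x * partial g j x + g x * partial f j x).
  by apply: CkD; apply: IH; solve [exact: CkW | exact: pf | exact: pg].
by apply/funext => x; rewrite partialM.
Qed.

Lemma Ck_expR n k (f : 'rV[R]_n -> R) : Ck k f -> Ck k (fun x => expR (f x)).
Proof.
elim: k f => [|k IH] f.
  by move=> cf x; apply: continuous_comp; [exact: cf|exact: continuous_expR].
move=> Cf; have [df pf] := Cf; split => [x|j].
  by apply: differentiable_comp => //; exact/derivable1_diffP/derivable_expR.
rewrite (_ : partial _ j = fun x => expR (f x) * partial f j x).
  by apply: CkM; [apply: IH; exact: CkW|exact: pf].
by apply/funext => x; rewrite partial_expR.
Qed.

Lemma Ck_sum n k I (r : seq I) (P : pred I) (f : I -> 'rV[R]_n -> R) :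
  (forall i, P i -> Ck k (f i)) -> Ck k (fun x => \sum_(i <- r | P i) f i x).
Proof.
move=> Cf; elim: r => [|i r IH].
  have -> : (fun x => \sum_(i <- [::] | P i) f i x) = fun=> 0.
    by apply/funext => x; rewrite big_nil.
  exact: Ck_cst.
have -> : (fun x => \sum_(i <- (i :: r) | P i) f i x) =
    fun x => (if P i then f i x else 0) + \sum_(i <- r | P i) f i x.
  by apply/funext => x; rewrite big_cons; case: ifPn => //; rewrite add0r.
by apply: CkD => //; case: (boolP (P i)) => [/Cf//|_]; exact: Ck_cst.
Qed.

Lemma is_diff_affine n p (b : 'rV[R]_n) (A : 'M[R]_(p, n)) (y : 'rV[R]_p) :
  is_diff y (fun y : 'rV[R]_p => b + y *m A) (mulmxr A).
Proof.
have cA : continuous (mulmxr A : 'rV[R]_p -> 'rV[R]_n).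
  apply: continuous_rV => j.
  have -> : (fun y : 'rV[R]_p => mulmxr A y ord0 j) =
      fun y : 'rV[R]_p => \sum_k (y ord0 k * A k j).
    by apply/funext => y'; rewrite mxE.
  change (Ck 0 (fun y : 'rV[R]_p => \sum_k (y ord0 k * A k j))).
  apply: Ck_sum => k _; apply: CkM; first exact: coord_continuous.
  exact: cst_continuous.
have dA : is_diff y (mulmxr A : 'rV[R]_p -> 'rV[R]_n) (mulmxr A).
  by apply: DiffDef; [exact: linear_differentiable|rewrite diff_lin].
have := @is_diffD _ _ _ (cst b) _ 0 _ y (is_diff_cst _ _) dA.
by rewrite add0r.
Qed.

Lemma differentiable_affine n p (b : 'rV[R]_n) (A : 'M[R]_(p, n)) y :
  differentiable (fun y : 'rV[R]_p => b + y *m A) y.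
Proof. by have [] := is_diff_affine b A y. Qed.

Lemma diff_affine n p (b : 'rV[R]_n) (A : 'M[R]_(p, n)) y v :
  'd (fun y : 'rV[R]_p => b + y *m A) y v = v *m A.
Proof. by have [_ ->] := is_diff_affine b A y. Qed.

Lemma partial_affine n p (f : 'rV[R]_n -> R) (b : 'rV[R]_n) (A : 'M[R]_(p, n)) j y :
  differentiable f (b + y *m A) ->
  partial (fun y => f (b + y *m A)) j y = \sum_a A j a * partial f a (b + y *m A).
Proof.
move=> df; have da := differentiable_affine b A y.
rewrite /partial deriveE//; last exact: (differentiable_comp da df).
rewrite (diff_comp da df)/= diff_affine -deriveE// derive_sum_partial//.
by apply: eq_bigr => a _; rewrite -rowE mxE.
Qed.

Lemma Ck_affine n p k (f : 'rV[R]_n -> R) (b : 'rV[R]_n) (A : 'M[R]_(p, n)) :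
  Ck k f -> Ck k (fun y : 'rV[R]_p => f (b + y *m A)).
Proof.
elim: k f => [|k IH] f.
  move=> cf y; apply: (@continuous_comp _ _ _ (fun y : 'rV[R]_p => b + y *m A) f y); last exact: cf.
  exact/differentiable_continuous/differentiable_affine.
move=> [df pf]; split => [y|j].
  exact: (differentiable_comp (differentiable_affine b A y) (df _)).
rewrite (_ : partial _ j = fun y => \sum_a A j a * partial f a (b + y *m A)).
  by apply: Ck_sum => a _; apply: CkM; [exact: Ck_cst|apply: IH; exact: pf].
by apply/funext => y; rewrite partial_affine.
Qed.

End calculus_theory.

Lemma partial_cst {R : realType} n (c : R) j (x : 'rV[R]_n) : partial (fun=> c) j x = 0.
Proof. exact: derive_cst. Qed.

Lemma partial_sum {R : realType} n I (r : seq I) (P : pred I) (f : I -> 'rV[R]_n -> R) j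
    (x : 'rV[R]_n) : (forall i, P i -> smooth (f i)) ->
  partial (fun y => \sum_(i <- r | P i) f i y) j x = \sum_(i <- r | P i) partial (f i) j x.
Proof.
move=> sf; elim: r => [|i r IH].
  have -> : (fun x => \sum_(i <- [::] | P i) f i x) = fun=> 0.
    by apply/funext => y; rewrite big_nil.
  by rewrite partial_cst big_nil.
rewrite big_cons -IH; case: (boolP (P i)) => Pi.
  have -> : (fun x => \sum_(i <- (i :: r) | P i) f i x) =
      fun x => f i x + \sum_(i <- r | P i) f i x.
    by apply/funext => y; rewrite big_cons Pi.
  apply: partialD; first by have [] := sf _ Pi 1.
  by have [] := @Ck_sum R n 1 _ r P f (fun i Pi => sf i Pi 1).
congr partial; apply/funext => y; by rewrite big_cons (negbTE Pi).
Qed.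

Section smooth_theory.
Context {R : realType} {n : nat}.
Implicit Types f g : 'rV[R]_n -> R.

Lemma smooth_differentiable f : smooth f -> forall x, differentiable f x.
Proof. by move=> sf; exact: (Ck_differentiable (sf 1)). Qed.

Lemma smooth_continuous f : smooth f -> continuous f.
Proof. by move=> sf; exact: (Ck_continuous (sf 0)). Qed.

Lemma smooth_partial f j : smooth f -> smooth (partial f j).
Proof. by move=> sf k; case: (sf k.+1) => _; apply. Qed.

Lemma smooth_cst (c : R) : smooth (fun _ : 'rV[R]_n => c).
Proof. move=> k; exact: Ck_cst. Qed.

Lemma smoothD f g : smooth f -> smooth g -> smooth (fun x => f x + g x).
Proof. by move=> sf sg k; exact: CkD. Qed.

Lemma smoothM f g : smooth f -> smooth g -> smooth (fun x => f x * g x).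
Proof. by move=> sf sg k; exact: CkM. Qed.

Lemma smooth_expR f : smooth f -> smooth (fun x => expR (f x)).
Proof. by move=> sf k; exact: Ck_expR. Qed.

Lemma smooth_sum I (r : seq I) (P : pred I) (f : I -> 'rV[R]_n -> R) :
  (forall i, P i -> smooth (f i)) -> smooth (fun x => \sum_(i <- r | P i) f i x).
Proof. by move=> sf k; apply: Ck_sum => i /sf. Qed.

Lemma smoothN f : smooth f -> smooth (fun x => - f x).
Proof.
move=> sf; rewrite (_ : (fun _ => _) = fun x => (-1) * f x).
  by apply: smoothM => //; exact: smooth_cst.
by apply/funext => x; rewrite mulN1r.
Qed.

Lemma smoothB f g : smooth f -> smooth g -> smooth (fun x => f x - g x).
Proof. by move=> sf sg; apply: smoothD => //; exact: smoothN. Qed.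

Lemma smoothX f k : smooth f -> smooth (fun x => f x ^+ k).
Proof.
move=> sf; elim: k => [|k IH].
  rewrite (_ : (fun _ => _) = fun=> 1); first exact: smooth_cst.
  by apply/funext => x; rewrite expr0.
rewrite (_ : (fun _ => _) = fun x => f x * f x ^+ k); first exact: smoothM.
by apply/funext => x; rewrite exprS.
Qed.

End smooth_theory.

Lemma smooth_affine {R : realType} n p (f : 'rV[R]_n -> R) (b : 'rV[R]_n) (A : 'M[R]_(p, n)) :
  smooth f -> smooth (fun y : 'rV[R]_p => f (b + y *m A)).
Proof. by move=> sf k; exact: Ck_affine. Qed.

Lemma uniform_bound {R : realType} (I : finType) T (G : I -> T -> R) :
  (forall i, exists2 C : R, 0 <= C & forall y, `|G i y| <= C) ->
  exists2 C : R, 0 <= C & forall i y, `|G i y| <= C.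
Proof.
move=> H; pose c i := projT1 (cid2 (H i)).
exists (\big[Num.max/0]_i c i); first exact: bigmax_ge_id.
move=> i y; apply: le_trans (le_bigmax _ c i).
by rewrite /c; case: cid2 => /= C _; apply.
Qed.

(** * Mean value estimates and functions supported in a ball *)

Section bounds.
Context {R : realType} {n : nat}.
Implicit Types f g : 'rV[R]_n -> R.

(* [`|x|] is the sup norm. *)
Definition supp_in f (M : R) := forall x, M < `|x| -> f x = 0.

Lemma coord_le_norm (x : 'rV[R]_n) j : `|x ord0 j| <= `|x|.
Proof.
rewrite [leRHS]/Num.norm/= mx_normrE.
by apply: (@le_bigmax _ _ _ _ (fun i : 'I_1 * 'I_n => `|x i.1 i.2|) (ord0,j)).
Qed.

Lemma norm_rV_le (x : 'rV[R]_n) M : 0 <= M ->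
  (`|x| <= M) <-> (forall j, `|x ord0 j| <= M).
Proof.
move=> M0; split=> [xM j|xM]; first exact: le_trans (coord_le_norm x j) xM.
rewrite /Num.norm/= mx_normrE; apply/bigmax_leP; split => // -[i j] _ /=.
by rewrite ord1.
Qed.

Lemma sum_coord_le (h F : 'I_n -> R) (a b : R) :
  0 <= a -> (forall j, `|h j| <= a) -> (forall j, `|F j| <= b) ->
  `|\sum_(j < n) h j * F j| <= n%:R * (a * b).
Proof.
move=> a0 ha Fb; apply: le_trans (ler_norm_sum _ _ _) _.
apply: (@le_trans _ _ (\sum_(j < n) (a * b))).
  by apply: ler_sum => j _; rewrite normrM; exact: ler_pM.
by rewrite sumr_const card_ord -[leLHS]mulr_natl.
Qed.

Lemma mvt_line f (x h : 'rV[R]_n) : (forall y, differentiable f y) ->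
  exists2 c : R, `|c| <= 1 & f (x + h) - f x = \sum_(a < n) h ord0 a * partial f a (x + c *: h).
Proof.
move=> df.
have [c c01 fc] := @MVT R (fun t => f (x + t *: h)) (fun t => 'D_h f (x + t *: h)) 0 1 ltr01
  (fun t _ => is_derive_line (df _)) (derivable_within_continuous (fun t _ =>
    @ex_derive _ _ _ _ _ _ _ (is_derive_line (df (x + t *: h))))).
exists c; first by move: c01; rewrite in_itv/= => /andP[/ltW ? /ltW ?]; rewrite ger0_norm.
by move: fc; rewrite scale1r scale0r addr0 subr0 mulr1 derive_sum_partial.
Qed.

Lemma lipschitz_rV f C (x h : 'rV[R]_n) : (forall y, differentiable f y) ->
  (forall a y, `|partial f a y| <= C) -> `|f (x + h) - f x| <= n%:R * (`|h| * C).
Proof.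
move=> df fC; have [c _ ->] := mvt_line x h df.
by apply: sum_coord_le => // j; exact: coord_le_norm.
Qed.

(** The mean value theorem is used twice, on [f] and then on each partial derivative between [x] and
    the intermediate point. The constant is crude; what matters later is the order two in [h]. *)
Lemma taylor2_rV f C (x h : 'rV[R]_n) : smooth f ->
  (forall a b y, `|partial (partial f a) b y| <= C) ->
  `|f (x + h) - f x - \sum_(a < n) h ord0 a * partial f a x| <= n%:R ^+ 2 * C * `|h| ^+ 2.
Proof.
move=> sf fC; have [c c1 ->] := mvt_line x h (smooth_differentiable sf).
rewrite -sumrB; under eq_bigr do rewrite -mulrBr.
rewrite (_ : _ * C * _ = n%:R * (`|h| * (n%:R * (`|h| * C)))); last by ring.
apply: sum_coord_le => // j; first exact: coord_le_norm.
apply: le_trans (lipschitz_rV x (c *: h) (smooth_differentiable (smooth_partial j sf)) (fC j)) _.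
apply: ler_wpM2l => //; apply: ler_wpM2r; first exact: le_trans (normr_ge0 _) (fC j j x).
by rewrite normrZ ler_piMl.
Qed.

Lemma cont_supp_bounded f M : continuous f -> supp_in f M ->
  exists2 C : R, 0 <= C & forall x, `|f x| <= C.
Proof.
move=> cf fM.
(* The radius is [|M|] and not [M], so that the ball contains 0 even if [M] is negative. *)
have cB : compact [set x : 'rV[R]_n | `|x| <= `|M|].
  apply: bounded_closed_compact.
    exists `|M|; split => // N MN x /= xM; exact: le_trans xM (ltW MN).
  rewrite (_ : [set x | _] = (fun x : 'rV[R]_n => `|x|) @^-1` [set t | t <= `|M|])//.
  by apply: closed_comp => [x _|]; [exact: norm_continuous|exact: closed_le].
have [| |x _ fx] := @EVT_max_rV R n (fun x => `|f x|) _ _ cB.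
- by exists 0 => /=; rewrite normr0.
- apply: continuous_subspaceT => x; apply: continuous_comp; [exact: cf|exact: norm_continuous].
exists `|f x| => // y; have [yM|My] := leP `|y| `|M|; first by apply: fx; rewrite inE.
by rewrite fM ?normr0//; exact: le_lt_trans (ler_norm M) My.
Qed.

Lemma supp_in_partial f M j : supp_in f M -> supp_in (partial f j) M.
Proof.
move=> fM x Mx; rewrite /partial (@near_eq_derive _ _ _ f (cst 0)) ?derive_cst//.
have : open [set y : 'rV[R]_n | M < `|y|].
  rewrite (_ : [set x | _] = (fun x : 'rV[R]_n => `|x|) @^-1` [set t | M < t])//.
  by apply: open_comp => [y _|]; [exact: norm_continuous|exact: open_gt].
move=> oM; apply: filterS (open_nbhs_nbhs (conj oM Mx)) => y /= /fM//.
Qed.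

Lemma supp_inW f M M' : M <= M' -> supp_in f M -> supp_in f M'.
Proof. by move=> MM fM x Mx; apply: fM; exact: le_lt_trans MM Mx. Qed.

Lemma supp_inMl f g M : supp_in g M -> supp_in (fun x => f x * g x) M.
Proof. by move=> gM x /gM ->; rewrite mulr0. Qed.

Lemma supp_inMr f g M : supp_in f M -> supp_in (fun x => f x * g x) M.
Proof. by move=> gM x /gM ->; rewrite mul0r. Qed.

Lemma test_functionP f : test_function f <-> smooth f /\ exists M, supp_in f M.
Proof.
split=> -[sf].
  move=> /compact_bounded[M [Mr fM]]; split => //; exists (M + 1) => x Mx.
  apply/eqP; apply: contraTT Mx => fx; rewrite -leNgt.
  by apply: (fM (M + 1)); [rewrite ltrDl|exact: subset_closure].
move=> [M fM]; split => //; apply: bounded_closed_compact; last exact: closed_closure.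
exists `|M|; split => // N MN x.
have cB : closed [set x : 'rV[R]_n | `|x| <= `|M|].
  rewrite (_ : [set x | _] = (fun x : 'rV[R]_n => `|x|) @^-1` [set t | t <= `|M|])//.
  by apply: closed_comp => [y _|]; [exact: norm_continuous|exact: closed_le].
move=> xc; have : [set x : 'rV[R]_n | `|x| <= `|M|] x.
  apply: cB; apply: closureS xc => y /= /eqP fy; rewrite leNgt; apply/negP => My.
  by apply: fy; apply: fM; exact: le_lt_trans (ler_norm M) My.
by move=> /= /le_trans; apply; exact: ltW.
Qed.

Lemma partial_bounded f M : smooth f -> supp_in f M ->
  exists2 C : R, 0 <= C & forall a y, `|partial f a y| <= C.
Proof.
move=> sf fM; apply: uniform_bound => a.
apply: (@cont_supp_bounded _ M); first exact: smooth_continuous (smooth_partial a sf).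
exact: supp_in_partial.
Qed.

Lemma partial2_bounded f M : smooth f -> supp_in f M ->
  exists2 C : R, 0 <= C & forall a b y, `|partial (partial f a) b y| <= C.
Proof.
move=> sf fM; have [C C0 fC] : exists2 C : R, 0 <= C &
    forall (i : 'I_n * 'I_n) y, `|partial (partial f i.1) i.2 y| <= C.
  apply: uniform_bound => i; apply: (@cont_supp_bounded _ M).
    by apply: smooth_continuous; do 2 apply: smooth_partial.
  by do 2 apply: supp_in_partial.
by exists C => // a b; exact: (fC (a, b)).
Qed.

End bounds.

Section differentiability.
Context {R : realType} {n : nat}.

(** An increment of order two is negligible with respect to [h], so 0 is the differential by
    uniqueness. The domain is a general normed module because the lemma serves on R, for [flat] at
    0, as well as on row vectors. *)
Lemma differentiable_quadratic0 (V : normedModType R) (g : V -> R) (x : V) (K : R) :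
  (forall h : V, `|h| <= 1 -> `|g (h + x) - g x| <= K * `|h| ^+ 2) ->
  is_diff x g (fun=> 0).
Proof.
move=> gK.
have c0 : continuous (\0 : {linear V -> R}) by move=> y; exact: cst_continuous.
(* The expansion to be proved is used twice: it gives the value of the differential, and then
   differentiability itself. *)
have H (P Q : Prop) : (P -> Q) -> P -> P /\ Q by move=> PQ p; split => //; exact: PQ.
have [|E D] := H _ _ (@diff_unique _ _ _ g (\0 : {linear V -> R}) x c0).
  apply/eqaddoP => e e0.
  have K1 : 0 < `|K| + 1 by rewrite ltr_pwDr.
  have d0 : 0 < Num.min 1 (e / (`|K| + 1)) by rewrite lt_min ltr01 divr_gt0.
  apply/nbhs_ballP; exists (Num.min 1 (e / (`|K| + 1))) => //= h.
  rewrite -ball_normE/= /ball_/= sub0r normrN lt_min => /andP[h1 he].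
  rewrite [X in `|X|](_ : _ = g (h + x) - g x); last first.
    by rewrite /= /GRing.add/= /GRing.opp/= ; rewrite addr0.
  apply: le_trans (gK h (ltW h1)) _.
  rewrite expr2 mulrA ler_wpM2r//.
  apply: le_trans (_ : (`|K| + 1) * `|h| <= _).
    by rewrite ler_wpM2r// (le_trans (ler_norm K))// lerDl.
  by rewrite mulrC -ler_pdivlMr// ltW.
apply: DiffDef; last by rewrite D.
by apply/diff_locallyP; rewrite D.
Qed.

Lemma differentiable_coord_rV (a : 'I_n) (x : 'rV[R]_n) :
  differentiable (fun y : 'rV[R]_n => y ord0 a : R) x.
Proof. exact: differentiable_coord. Qed.

Lemma partial_coord (a b : 'I_n) (x : 'rV[R]_n) :
  partial (fun y : 'rV[R]_n => y ord0 a : R) b x = (a == b)%:R.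
Proof.
have L := @is_derive_line _ _ (fun y : 'rV[R]_n => y ord0 a : R) x (delta_mx ord0 b) 0.
rewrite scale0r addr0 in L.
have {}L := L (differentiable_coord_rV a x).
rewrite /partial -(@derive_val _ _ _ _ _ _ _ L).
rewrite (_ : (fun _ => _) = fun s : R => x ord0 a + s * (a == b)%:R); last first.
  by apply/funext => s; rewrite !mxE.
by rewrite deriveD//= derive_cst add0r deriveMr//= derive_id mulr1.
Qed.

Lemma smooth_coord (a : 'I_n) : smooth (fun y : 'rV[R]_n => y ord0 a : R).
Proof.
case=> [|k]; first exact: coord_continuous.
split => [x|b]; first exact: differentiable_coord_rV.
rewrite (_ : partial _ b = fun=> (a == b)%:R); first exact: Ck_cst.
by apply/funext => x; exact: partial_coord.
Qed.

(** Subtracting the linear function [A] reduces to a vanishing first order part. In [convol_partial]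
    this criterion does the work of differentiation under the integral sign. *)
Lemma differentiable_quadratic (f : 'rV[R]_n -> R) (x : 'rV[R]_n) (l : 'I_n -> R) (K : R) :
  (forall h : 'rV[R]_n, `|h| <= 1 ->
     `|f (x + h) - f x - \sum_(a < n) h ord0 a * l a| <= K * `|h| ^+ 2) ->
  differentiable f x /\ forall a, partial f a x = l a.
Proof.
move=> fK.
pose A (y : 'rV[R]_n) := \sum_(a < n) y ord0 a * l a.
have sA : smooth A.
  by apply: smooth_sum => a _; apply: smoothM; [exact: smooth_coord|exact: smooth_cst].
pose g y := f y - A y.
have dg : is_diff x g (fun=> 0).
  apply: (@differentiable_quadratic0 _ g x K) => h h1; apply: le_trans (fK h h1).
  rewrite /g addrC le_eqVlt; apply/orP; left; apply/eqP; congr `|_|.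
  rewrite [h + x]addrC; have -> : A (x + h) = A x + \sum_(a < n) h ord0 a * l a.
    by rewrite /A -big_split/=; apply: eq_bigr => a _; rewrite mxE mulrDl.
  by ring.
have dg1 : differentiable g x by case: dg.
have fE : f = fun y => A y + g y by apply/funext => y; rewrite /g; ring.
have dA := smooth_differentiable sA x.
split; first by rewrite fE; exact: differentiableD.
move=> b; rewrite fE partialD// /partial [X in _ + X]deriveE//.
have [_ ->] := dg; rewrite addr0 -/(partial A b x).
rewrite partial_sum//; last first.
  by move=> a _; apply: smoothM; [exact: smooth_coord|exact: smooth_cst].
have pE a : partial (fun y : 'rV[R]_n => y ord0 a * l a) b x = l a * (a == b)%:R.
  have dl : differentiable (fun _ : 'rV[R]_n => l a) x by exact: (smooth_differentiable (smooth_cst (l a))).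
  rewrite (@partialM _ n (fun y => y ord0 a) (fun=> l a) b x (differentiable_coord_rV a x) dl).
  by rewrite partial_coord partial_cst mulr0 add0r.
rewrite (bigD1 b)//= big1 => [|a ab]; first by rewrite pE eqxx mulr1 addr0.
by rewrite pE (negbTE ab) mulr0.
Qed.

End differentiability.

(** * Real-valued integrals *)

Section real_integrable.
Context d (T : measurableType d) (R : realType) (mu : {measure set T -> \bar R}).
Implicit Types f g : T -> R.

Definition rint f : Prop := mu.-integrable setT (EFin \o f).

Lemma rint_measurable f : rint f -> measurable_fun setT f.
Proof. by move=> /measurable_int /measurable_EFinP. Qed.

Lemma eq_rint f g : f =1 g -> rint f -> rint g.
Proof. by move=> /funext ->. Qed.

Lemma rint0 : rint (fun=> 0).
Proof. exact: integrable0. Qed.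

Lemma rintD f g : rint f -> rint g -> rint (fun x => f x + g x).
Proof. by move=> fi gi; have := integrableD measurableT fi gi. Qed.

Lemma rintB f g : rint f -> rint g -> rint (fun x => f x - g x).
Proof. by move=> fi gi; have := integrableB measurableT fi gi. Qed.

Lemma rintZ (c : R) f : rint f -> rint (fun x => c * f x).
Proof. by move=> fi; have := integrableZl measurableT c fi. Qed.

Lemma rint_norm f : rint f -> rint (fun x => `|f x|).
Proof. exact: integrable_norm. Qed.

Lemma rint_sum I (r : seq I) (P : pred I) (f : I -> T -> R) :
  (forall i, P i -> rint (f i)) -> rint (fun x => \sum_(i <- r | P i) f i x).
Proof.
move=> fi; elim: r => [|i r IH].
  by apply: eq_rint rint0 => x; rewrite big_nil.
case: (boolP (P i)) => Pi; last by apply: eq_rint IH => x; rewrite big_cons (negbTE Pi).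
by apply: eq_rint (rintD (fi _ Pi) IH) => x; rewrite big_cons Pi.
Qed.

Lemma le_rint f g : measurable_fun setT f -> (forall x, `|f x| <= g x) -> rint g -> rint f.
Proof.
move=> mf fg gi; apply: le_integrable gi => //; first exact/measurable_EFinP.
by move=> x _; rewrite /= lee_fin (le_trans (fg x))// ler_norm.
Qed.

Lemma IntD f g : rint f -> rint g -> \int[mu]_x (f x + g x) = \int[mu]_x f x + \int[mu]_x g x.
Proof. exact: RintegralD. Qed.

Lemma IntB f g : rint f -> rint g -> \int[mu]_x (f x - g x) = \int[mu]_x f x - \int[mu]_x g x.
Proof. exact: RintegralB. Qed.

Lemma IntZ (c : R) f : rint f -> \int[mu]_x (c * f x) = c * \int[mu]_x f x.
Proof. by move=> fi; rewrite RintegralZl. Qed.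

Lemma eq_Int f g : f =1 g -> \int[mu]_x f x = \int[mu]_x g x.
Proof. by move=> fg; apply: eq_Rintegral => x _. Qed.

Lemma Int0 : \int[mu]_x (0 : R) = 0.
Proof. by rewrite /Rintegral integral0. Qed.

Lemma Int_sum I (r : seq I) (P : pred I) (f : I -> T -> R) :
  (forall i, P i -> rint (f i)) ->
  \int[mu]_x (\sum_(i <- r | P i) f i x) = \sum_(i <- r | P i) \int[mu]_x f i x.
Proof.
move=> fi; elim: r => [|i r IH].
  by rewrite big_nil -[RHS]Int0; apply: eq_Int => x; rewrite big_nil.
rewrite big_cons -IH; case: (boolP (P i)) => Pi; last first.
  by apply: eq_Int => x; rewrite big_cons (negbTE Pi).
rewrite -IntD//; [|exact: fi|exact: rint_sum].
by apply: eq_Int => x; rewrite big_cons Pi.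
Qed.

Lemma le_Int f g : rint f -> rint g -> (forall x, f x <= g x) ->
  \int[mu]_x f x <= \int[mu]_x g x.
Proof. by move=> fi gi fg; exact: le_Rintegral. Qed.

Lemma Int_ge0 f : (forall x, 0 <= f x) -> 0 <= \int[mu]_x f x.
Proof. by move=> f0; apply: Rintegral_ge0. Qed.

Lemma Int_norm f : rint f -> `|\int[mu]_x f x| <= \int[mu]_x `|f x|.
Proof. by move=> fi; exact: le_normr_Rintegral. Qed.

Lemma IntE f : rint f -> (\int[mu]_x (f x)%:E)%E = (\int[mu]_x f x)%:E.
Proof. by move=> fi; rewrite /Rintegral fineK//; exact: integrable_fin_num. Qed.

(** With a, b, c the integrals of f^2, g^2 and f g, the integral of (s f + t g)^2 is nonnegative; at
    (s, t) = (b, -c) it equals b (a b - c^2). If b = 0 the values (-c, a), or (1, -c) when a = 0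
    too, force c = 0. *)
Lemma Int_CS f g : rint (fun x => f x ^+ 2) -> rint (fun x => g x ^+ 2) ->
  measurable_fun setT f -> measurable_fun setT g ->
  rint (fun x => f x * g x) /\
  (\int[mu]_x (f x * g x)) ^+ 2 <= \int[mu]_x (f x ^+ 2) * \int[mu]_x (g x ^+ 2).
Proof.
move=> f2 g2 mf mg.
have fgi : rint (fun x => f x * g x).
  apply: le_rint (rintD f2 g2); first exact: measurable_funM.
  move=> x; rewrite normrM -(real_normK (num_real (f x))) -(real_normK (num_real (g x))).
  have := sqr_ge0 (`|f x| - `|g x|); have := normr_ge0 (f x); have := normr_ge0 (g x).
  by nra.
split => //.
set a := Rintegral _ _ (fun x => f x ^+ 2); set b := Rintegral _ _ (fun x => g x ^+ 2).
set c := Rintegral _ _ _.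
have a0 : 0 <= a by apply: Int_ge0 => x; exact: sqr_ge0.
have b0 : 0 <= b by apply: Int_ge0 => x; exact: sqr_ge0.
have P s t : 0 <= s ^+ 2 * a + 2 * s * t * c + t ^+ 2 * b.
  rewrite /a /b /c -!IntZ// -!IntD//; try by repeat (apply: rintD || apply: rintZ).
  apply: Int_ge0 => x.
  rewrite (_ : _ + _ = (s * f x + t * g x) ^+ 2); [exact: sqr_ge0|by ring].
move: a b c a0 b0 P => a b c a0 b0 P.
have [b1|b1] := eqVneq b 0.
  subst b; have [a1|a1] := eqVneq a 0; first by subst a; have := P 1 (- c); nra.
  have a2 : 0 < a by rewrite lt_neqAle eq_sym a1.
  have := P (- c) a; rewrite (_ : _ + _ = a * (- c ^+ 2)); last by ring.
  by rewrite pmulr_rge0// mulr0 oppr_ge0.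
have b2 : 0 < b by rewrite lt_neqAle eq_sym b1.
have := P b (- c); rewrite (_ : _ + _ = b * (a * b - c ^+ 2)); last by ring.
by rewrite pmulr_rge0// subr_ge0.
Qed.

End real_integrable.

(** * Local integrability and the integral of a derivative *)

Section integration.
Context {R : realType} {n : nat}.
Local Notation lam := (lebesgue_rV n).
Implicit Types f g F : 'rV[R]_n -> R.

Definition cball (M : R) : set 'rV[R]_n := [set x | `|x| <= M].

Lemma cballE M : 0 <= M -> cball M = [set x | forall j, `|x ord0 j| <= M].
Proof. by move=> M0; apply/seteqP; split => x /norm_rV_le; apply. Qed.

Lemma measurable_cball M : measurable (cball M).
Proof.
have [M0|M0] := leP 0 M; first by rewrite cballE//; exact: measurable_closed_cube.
rewrite (_ : cball M = set0)//; apply/seteqP; split => x //= xM.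
by have := normr_ge0 x; rewrite leNgt (le_lt_trans xM M0).
Qed.

Lemma cball_fin M : (lam (cball M) < +oo)%E.
Proof.
apply: (@le_lt_trans _ _ (lam (cball `|M|))).
  apply: le_measure; rewrite ?inE; try exact: measurable_cball.
  by move=> x /= /le_trans; apply; exact: ler_norm.
by rewrite cballE// lebesgue_rV_cube// ltry.
Qed.

Lemma integrable_cball_cst M (c : R) : lam.-integrable (cball M) (EFin \o cst c).
Proof.
apply: measurable_bounded_integrable => //; [exact: measurable_cball|exact: cball_fin|].
by exists `|c|; split => // N cN x _; exact: ltW.
Qed.

(** Local integrability, tested on closed cubes only, since every compact set lies in one. *)
Definition locint F := measurable_fun setT F /\
  forall M, lam.-integrable (cball M) (EFin \o F).

Lemma continuous_bounded_cball M F : continuous F ->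
  exists C : R, forall x, cball M x -> `|F x| <= C.
Proof.
move=> cF; have cB : compact (cball `|M|).
  apply: bounded_closed_compact.
    exists `|M|; split => // N MN x /= xM; exact: le_trans xM (ltW MN).
  rewrite (_ : cball _ = (fun x : 'rV[R]_n => `|x|) @^-1` [set t | t <= `|M|])//.
  by apply: closed_comp => [x _|]; [exact: norm_continuous|exact: closed_le].
have [| |x _ fx] := @EVT_max_rV R n (fun x => `|F x|) _ _ cB.
- by exists 0; rewrite /cball/= normr0.
- apply: continuous_subspaceT => x; apply: continuous_comp; [exact: cF|exact: norm_continuous].
exists `|F x| => y yM; apply: fx; rewrite inE /cball/=; exact: le_trans yM (ler_norm M).
Qed.

Lemma continuous_locint F : continuous F -> locint F.
Proof.
move=> cF; split; first exact: continuous_measurable_rV.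
move=> M; have mF := continuous_measurable_rV cF.
have [C FC] := continuous_bounded_cball M cF.
have iC : lam.-integrable (cball M) (EFin \o cst C).
  exact: integrable_cball_cst.
apply: le_integrable iC; first exact: measurable_cball.
  by apply/measurable_EFinP; exact: measurable_funTS.
by move=> x xM; rewrite /= lee_fin (le_trans (FC x xM))// ler_norm.
Qed.

Lemma integrable_locintM F g M C : locint F -> measurable_fun setT g ->
  (forall x, `|g x| <= C) -> supp_in g M -> rint lam (fun x => F x * g x).
Proof.
move=> [mF iF] mg gC gM.
have := iF M; rewrite integrable_mkcond; last exact: measurable_cball.
move=> /(integrableZl measurableT C) iF'.
apply: le_integrable iF' => //.
  by apply/measurable_EFinP; exact: measurable_funM.
move=> x _; rewrite /= /patch; case: ifPn => xM.
  rewrite /= lee_fin !normrM mulrC ler_wpM2r//.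
  exact: le_trans (gC x) (ler_norm C).
rewrite gM ?mulr0 ?normr0 ?abse_ge0// ltNge; apply: contra xM => xM; by rewrite inE.
Qed.

Lemma rint_loc F M : locint F -> rint lam (fun x => F x * \1_(cball M) x).
Proof.
move=> lF; apply: (integrable_locintM (M := M) (C := 1) lF).
- by apply: measurable_indic; exact: measurable_cball.
- by move=> x; rewrite indicE; case: (_ \in _); rewrite ?normr1 ?normr0.
by move=> x xB; rewrite indicE memNset//= /cball/=; apply/negP; rewrite -ltNge.
Qed.

Lemma rint_indic_cball M : rint lam (\1_(cball M)).
Proof.
have l1 : locint (fun=> 1) by apply: continuous_locint; exact: cst_continuous.
by apply: eq_rint (rint_loc M l1) => x; rewrite mul1r.
Qed.

Lemma integrable_cs f M : continuous f -> supp_in f M -> rint lam f.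
Proof.
move=> cf fM; have [C _ fC] := cont_supp_bounded cf fM.
apply: (@eq_rint _ _ _ _ (fun x => 1 * f x)); first by move=> x; rewrite mul1r.
apply: (@integrable_locintM (fun=> 1) _ M C) => //; last exact: continuous_measurable_rV.
by apply: continuous_locint; exact: cst_continuous.
Qed.

Lemma integrable_translation (h : 'rV[R]_n) f : rint lam f -> rint lam (fun x => f (x + h)).
Proof.
move=> /integrableP[mf fi]; apply/integrableP.
have mfh : measurable_fun setT (fun x : 'rV[R]_n => (f (x + h))%:E).
  exact: (measurableT_comp mf (measurable_addrV h)).
split => //.
rewrite (ge0_integral_translation h (f := fun x => `|(f x)%:E|%E))//.
by apply: measurableT_comp.
Qed.

Lemma Rintegral_translation (h : 'rV[R]_n) f : measurable_fun setT f ->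
  \int[lam]_x f (x + h) = \int[lam]_x f x.
Proof.
move=> mf; rewrite /Rintegral; congr fine; rewrite integralE [RHS]integralE.
have mf' : measurable_fun setT (EFin \o f) by exact/measurable_EFinP.
rewrite (funepos_comp (EFin \o f) (fun x => x + h)) (funeneg_comp (EFin \o f) (fun x => x + h)).
congr (_ - _)%E.
  by apply: (ge0_integral_translation h (f := (EFin \o f)^\+%E)) => //; exact: measurable_funepos.
by apply: (ge0_integral_translation h (f := (EFin \o f)^\-%E)) => //; exact: measurable_funeneg.
Qed.

(** Translation invariance makes f (x + t e) - f x integrate to 0. By Taylor, its difference with t
    times the derivative is O(t^2) on a fixed ball, so t [D] = O(t^2) for all small t, which forces
    [D] = 0. *)
Lemma integral_partial f M j : smooth f -> supp_in f M -> \int[lam]_x partial f j x = 0.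
Proof.
move=> sf fM.
have [C C0 fC] := partial2_bounded sf fM.
pose e := delta_mx ord0 j : 'rV[R]_n.
pose D := \int[lam]_x partial f j x.
have e1 : `|e| <= 1.
  apply/norm_rV_le => // k; rewrite mxE/=; case: (_ == _) => /=; rewrite ?normr1 ?normr0//.
have cf := smooth_continuous sf; have cpf := smooth_continuous (smooth_partial j sf).
have if_ := integrable_cs cf fM.
have ipf : rint lam (partial f j).
  by apply: (integrable_cs cpf); exact: supp_in_partial fM.
have ift t := integrable_translation (t *: e) if_.
(* The ball of radius [|M| + 1] contains the supports of [f] and of its translates by [t *: e] with
   [t <= 1]. *)
pose V := fine (lam (cball (`|M| + 1))).
have key t : 0 < t -> t <= 1 -> `|t * D| <= n%:R ^+ 2 * C * t ^+ 2 * V.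
  move=> t0 t1.
  have iE : \int[lam]_x (f (x + t *: e) - f x - t * partial f j x) = - (t * D).
    rewrite IntB; [|exact: rintB|exact: rintZ].
    rewrite IntB// Rintegral_translation ?subrr ?sub0r; last exact: continuous_measurable_rV.
    by rewrite IntZ.
  rewrite -normrN -iE.
  apply: le_trans (le_normr_Rintegral _ _) _ => //.
    by apply: rintB; [exact: rintB|exact: rintZ].
  have te : `|t *: e| <= t by rewrite normrZ (gtr0_norm t0) ler_piMr// ltW.
  have tay x := taylor2_rV x (t *: e) sf fC.
  apply: (@le_trans _ _ (\int[lam]_(x in cball (`|M| + 1)) (n%:R ^+ 2 * C * t ^+ 2))).
    rewrite [leRHS]Rintegral_mkcond; apply: le_Int.
    - by apply: rint_norm; apply: rintB; [exact: rintB|exact: rintZ].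
    - rewrite /rint -restrict_EFin -integrable_mkcond; last exact: measurable_cball.
      exact: integrable_cball_cst.
    move=> x; rewrite /patch; case: ifPn => xM.
      have := tay x; rewrite (bigD1 j)//= big1 ?addr0.
        rewrite !mxE !eqxx mulr1 => /le_trans; apply.
        apply: ler_wpM2l; first by rewrite mulr_ge0// exprn_ge0.
        by rewrite ler_sqr ?nnegrE ?(ltW t0).
      by move=> k kj; rewrite !mxE/= (negbTE kj) mulr0 mul0r.
    rewrite (_ : point = 0 :> R)//.
    have Mx : `|M| + 1 < `|x| by rewrite ltNge; apply: contra xM; rewrite inE.
    have Mx' : M < `|x|.
      by apply: le_lt_trans Mx; apply: le_trans (ler_norm M) _; rewrite lerDl.
    rewrite (supp_in_partial j fM Mx') (fM x Mx') fM ?subr0 ?mulr0 ?subr0 ?normr0//.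
    apply: le_lt_trans (ler_norm M) _; rewrite -(ltrD2r 1).
    apply: lt_le_trans Mx _; rewrite -{1}(addrK (t *: e) x).
    apply: le_trans (ler_normB _ _) _; rewrite lerD2l normrZ (ger0_norm (ltW t0)).
    by rewrite mulr_ile1// ltW.
  by rewrite Rintegral_cst//; exact: measurable_cball.
apply/eqP; rewrite -normr_eq0 eq_le normr_ge0 andbT.
have V0 : 0 <= V by exact: fine_ge0.
pose K := n%:R ^+ 2 * C * V + 1.
have K0 : 0 < K by rewrite ltr_pwDr// !mulr_ge0// exprn_ge0.
have keyK t : 0 < t -> t <= 1 -> `|D| <= K * t.
  move=> t0 t1; rewrite -(ler_pM2l t0) -{1}(gtr0_norm t0) -normrM.
  apply: le_trans (key t t0 t1) _.
  rewrite /K mulrDl mul1r mulrDr -[leLHS]addr0; apply: lerD; last by rewrite mulr_ge0// ltW.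
  by rewrite le_eqVlt; apply/orP; left; apply/eqP; ring.
apply/ler_addgt0Pl => eps eps0; rewrite addr0.
have m0 : 0 < Num.min 1 (eps / K) by rewrite lt_min ltr01 divr_gt0.
apply: le_trans (keyK _ m0 _) _; first by rewrite ge_min lexx.
by rewrite mulrC -ler_pdivlMr// ge_min lexx orbT.
Qed.

End integration.

(** The bound [h] on the inner integrals of absolute values gives integrability on the product.
    Since every slice is integrable, and not just almost every one, the inner integrals are real
    everywhere and the conclusion can be stated with real-valued integrals. *)
Lemma Int_fubini {R : realType} d1 d2 (T1 : measurableType d1) (T2 : measurableType d2)
    (m1 : {sigma_finite_measure set T1 -> \bar R})
    (m2 : {sigma_finite_measure set T2 -> \bar R}) (f : T1 -> T2 -> R) (h : T2 -> R) :
  measurable_fun setT (fun p : T1 * T2 => f p.1 p.2) ->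
  (forall y, rint m1 (f^~ y)) -> (forall x, rint m2 (f x)) ->
  rint m2 h -> (forall y, \int[m1]_x `|f x y| <= h y) ->
  [/\ rint m1 (fun x => \int[m2]_y f x y), rint m2 (fun y => \int[m1]_x f x y) &
    \int[m1]_x (\int[m2]_y f x y) = \int[m2]_y (\int[m1]_x f x y)].
Proof.
move=> mf f1 f2 hi fh.
pose F (p : T1 * T2) := (f p.1 p.2)%:E.
have mF : measurable_fun setT F by exact/measurable_EFinP.
have iF : (m1 \x m2)%E.-integrable setT F.
  apply/(integrable21ltyP m1 m2 mF).
  move/integrableP : (hi) => [_]; apply: le_lt_trans.
  apply: ge0_le_integral => //.
  - by move=> y _; apply: integral_ge0.
  - apply: (measurable_fun_fubini_tonelli_G (abse \o F)) => //.
    exact: measurableT_comp.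
    by move=> ?; exact: abse_ge0.
  - by apply: measurableT_comp => //; apply: measurable_int hi.
  move=> y _; rewrite (_ : (fun x => _) = (fun x => `|f x y|%:E))//.
  rewrite IntE; last exact: rint_norm (f1 y).
  by rewrite lee_fin (le_trans (fh y))// ler_norm.
have E1 : fubini_F m2 F = (EFin \o (fun x => \int[m2]_y f x y)).
  by apply/funext => x; rewrite /fubini_F /= -IntE//; exact: f2.
have E2 : fubini_G m1 F = (EFin \o (fun y => \int[m1]_x f x y)).
  by apply/funext => x; rewrite /fubini_G /= -IntE//; exact: f1.
split.
- by rewrite /rint -E1; exact: integrable_fubini_F.
- apply: le_rint hi.
    by have := measurable_fubini_G iF; rewrite E2 => /measurable_EFinP.
  by move=> y; apply: le_trans (Int_norm (f1 y)) (fh y).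
have := Fubini iF.
rewrite [X in X = _](_ : _ = (\int[m1]_x (fubini_F m2 F x))%E)// E1.
rewrite [X in _ = X](_ : _ = (\int[m2]_x (fubini_G m1 F x))%E)// E2.
by rewrite /Rintegral => ->.
Qed.

(** * Mollification *)

Section shift.
Context {R : realType} {n : nat}.
Implicit Types k f : 'rV[R]_n -> R.

Lemma partial_shift f a (x y : 'rV[R]_n) : partial (fun y => f (y - x)) a y = partial f a (y - x).
Proof.
rewrite /partial /derive.
have -> : (fun h => h^-1 *: (((fun y => f (y - x)) \o shift y) (h *: delta_mx ord0 a) - f (y - x))) =
    (fun h : R => h^-1 *: ((f \o shift (y - x)) (h *: delta_mx ord0 a) - f (y - x))).
  by apply/funext => h /=; rewrite addrA.
by [].
Qed.

Lemma smooth_shift f (x : 'rV[R]_n) : smooth f -> smooth (fun y => f (y - x)).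
Proof.
move=> sf; have := smooth_affine (- x) 1%:M sf.
by under eq_fun do rewrite mulmx1 addrC.
Qed.

Lemma supp_in_shift f M (x : 'rV[R]_n) : supp_in f M -> supp_in (fun y => f (y - x)) (M + `|x|).
Proof.
move=> fM y My; apply: fM; rewrite -(ltrD2r `|x|); apply: lt_le_trans My _.
by rewrite -{1}(subrK x y) ler_normD.
Qed.

End shift.

Section convolution.
Context {R : realType} {n : nat}.
Local Notation lam := (lebesgue_rV n).
Implicit Types (F G k psi : 'rV[R]_n -> R) (x y z h : 'rV[R]_n).

(* A correlation rather than a convolution, whence the sign in [convol_partial]. *)
Definition convol F k x : R := \int[lam]_z (F (x + z) * k z).

(** Moves [x] into the smooth factor, where it can be differentiated. *)
Lemma convolE F k x : measurable_fun setT F -> measurable_fun setT k ->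
  convol F k x = \int[lam]_y (F y * k (y - x)).
Proof.
move=> mF mk; rewrite /convol.
have msub : measurable_fun setT (fun y => k (y - x)).
  exact: (measurableT_comp mk (measurable_addrV (- x))).
rewrite -(Rintegral_translation x (f := fun y => F y * k (y - x))); last exact: measurable_funM.
by apply: eq_Int => z; rewrite addrK [z + x]addrC.
Qed.

Lemma convol_rint F k M x : locint F -> continuous k -> supp_in k M ->
  rint lam (fun y => F y * k (y - x)).
Proof.
move=> lF ck kM; have [C _ kC] := cont_supp_bounded ck kM.
apply: (integrable_locintM (C := C) lF) (supp_in_shift kM) => //.
exact: (measurableT_comp (continuous_measurable_rV ck) (measurable_addrV (- x))).
Qed.

Lemma convol_rintz F k M x : locint F -> continuous k -> supp_in k M ->
  rint lam (fun z => F (x + z) * k z).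
Proof.
move=> lF ck kM; have := integrable_translation x (convol_rint x lF ck kM).
by apply: eq_rint => z; rewrite addrK [z + x]addrC.
Qed.

Lemma locint_norm F : locint F -> locint (fun x => `|F x|).
Proof.
move=> [mF iF]; split; first exact: measurableT_comp.
by move=> M; apply: integrable_norm; exact: iF.
Qed.

(** Taylor's formula for the kernel is integrated against [F]: the remainder is at most a constant
    times [|h| ^+ 2] times the integral of [|F|] over a ball, and [differentiable_quadratic]
    concludes. *)
Lemma convol_partial F k M x : locint F -> smooth k -> supp_in k M ->
  differentiable (convol F k) x /\ forall a, partial (convol F k) a x = - convol F (partial k a) x.
Proof.
move=> lF sk kM.
have mF := lF.1.
have [C C0 kC] := partial2_bounded sk kM.
have ck := smooth_continuous sk; have mk := continuous_measurable_rV ck.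
have cp a := smooth_continuous (smooth_partial a sk).
(* For y outside [B] and [|h| <= 1], the kernel vanishes at [y - x] and at [y - x - h], and so do
   its derivatives at [y - x]. *)
pose B : set 'rV[R]_n := cball (`|M| + 1 + `|x|).
have mB : measurable B by exact: measurable_cball.
pose I := \int[lam]_y (`|F y| * \1_B y).
have Ii : rint lam (fun y => `|F y| * \1_B y).
  by apply: rint_loc; exact: locint_norm.
apply: (differentiable_quadratic (l := fun a => - convol F (partial k a) x)
  (K := n%:R ^+ 2 * C * I)) => h h1.
have cpi a := convol_rint x lF (cp a) (supp_in_partial a kM).
pose S y := \sum_(a < n) (- h) ord0 a * partial k a (y - x).
have SE y : F y * S y = \sum_(a < n) (- h) ord0 a * (F y * partial k a (y - x)).
  by rewrite /S mulr_sumr; apply: eq_bigr => a _; ring.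
have Si : rint lam (fun y => F y * S y).
  by apply: (eq_rint (fun y => esym (SE y))); apply: rint_sum => a _; exact: rintZ.
have Es : \sum_(a < n) h ord0 a * - convol F (partial k a) x = \int[lam]_y (F y * S y).
  rewrite (eq_Int _ SE) Int_sum; last by move=> a _; exact: rintZ.
  apply: eq_bigr => a _; rewrite IntZ// convolE ?mxE ?mulrN ?mulNr//.
  exact: continuous_measurable_rV.
pose D y := k (y - x - h) - k (y - x) - S y.
have k1i := convol_rint x lF ck kM.
have k2i : rint lam (fun y => F y * k (y - x - h)).
  by apply: eq_rint (convol_rint (x + h) lF ck kM) => y; rewrite opprD addrA.
have DE y : F y * D y = F y * k (y - x - h) - F y * k (y - x) - F y * S y by rewrite /D; ring.
have Di : rint lam (fun y => F y * D y).
  by apply: (eq_rint (fun y => esym (DE y))); apply: rintB => //; exact: rintB.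
have -> : convol F k (x + h) - convol F k x - \sum_(a < n) h ord0 a * - convol F (partial k a) x =
    \int[lam]_y (F y * D y).
  rewrite Es (eq_Int _ DE) IntB//; last exact: rintB.
  rewrite IntB// (convolE _ mF mk) (convolE _ mF mk); congr (_ - _ - _).
  by apply: eq_Int => y; rewrite opprD addrA.
apply: le_trans (Int_norm Di) _.
rewrite mulrAC /I -IntZ//; apply: le_Int; [exact: rint_norm|exact: rintZ|] => y.
rewrite normrM mulrCA ler_wpM2l//; have [yB|yB] := boolP (y \in B).
  rewrite indicE yB mulr1 -[`|h|]normrN; exact: taylor2_rV.
have yM : `|M| + 1 + `|x| < `|y| by rewrite ltNge; apply: contra yB; rewrite inE.
have yx : `|M| + 1 < `|y - x|.
  rewrite -(ltrD2r `|x|); apply: lt_le_trans yM _.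
  by rewrite -{1}(subrK x y) ler_normD.
have yx1 : M < `|y - x|.
  by apply: le_lt_trans yx; rewrite (le_trans (ler_norm M))// lerDl.
have yx2 : M < `|y - x - h|.
  apply: le_lt_trans (ler_norm M) _; rewrite -(ltrD2r 1); apply: lt_le_trans yx _.
  by rewrite -{1}(subrK h (y - x)) (le_trans (ler_normD _ _))// lerD2l.
rewrite /D /S kM// kM// big1 => [|a _]; last by rewrite (supp_in_partial a kM)// mulr0.
by rewrite !subr0 normr0 !mulr_ge0// exprn_ge0.
Qed.

Lemma convol_smooth F k M : locint F -> smooth k -> supp_in k M -> smooth (convol F k).
Proof.
move=> lF sk kM m; elim: m k sk kM => [|m IH] k sk kM.
  by move=> x; apply: differentiable_continuous; have [] := convol_partial x lF sk kM.
split=> [x|a]; first by have [] := convol_partial x lF sk kM.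
have -> : partial (convol F k) a = fun x => (-1) * convol F (partial k a) x.
  by apply/funext => x; have [_ ->] := convol_partial x lF sk kM; rewrite mulN1r.
apply: CkM; first exact: Ck_cst.
by apply: IH; [exact: smooth_partial|exact: supp_in_partial].
Qed.

End convolution.

Section mollifier.
Context {R : realType} {n : nat}.
Local Notation lam := (lebesgue_rV n).
Implicit Types (F G g k psi : 'rV[R]_n -> R) (x y z h : 'rV[R]_n).

Definition mollifier k (e : R) :=
  [/\ smooth k, supp_in k e, forall x, 0 <= k x & \int[lam]_x k x = 1].

Lemma local_lipschitz g M : smooth g -> exists2 L : R, 0 <= L &
  forall x h, `|x| <= M -> `|h| <= 1 -> `|g (x + h) - g x| <= L * `|h|.
Proof.
move=> sg.
(* The derivatives are bounded on a ball only; they are set to 0 outside so that [uniform_bound],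
   which asks for global bounds, applies. The radius [|M| + 1] contains the segment from [x] to
   [x + h]. *)
have [C C0 gC] : exists2 C : R, 0 <= C &
    forall a y, `|(if `|y| <= `|M| + 1 then partial g a y else 0)| <= C.
  apply: uniform_bound => a.
  have cp := smooth_continuous (smooth_partial a sg).
  have [C FC] := continuous_bounded_cball (`|M| + 1) cp.
  exists `|C| => // y; case: ifPn => [yM|]; last by rewrite normr0.
  by rewrite (le_trans (FC y yM))// ler_norm.
exists (n%:R * C) => [|x h xM h1]; first by rewrite mulr_ge0.
have [c c1 ->] := mvt_line x h (smooth_differentiable sg).
rewrite mulrAC -mulrA; apply: sum_coord_le => // j; first exact: coord_le_norm.
have := gC j (x + c *: h); rewrite ifT//.
apply: le_trans (ler_normD _ _) _; rewrite lerD//; first exact: le_trans xM (ler_norm M).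
by rewrite normrZ mulr_ile1.
Qed.

Lemma locintMl g F : continuous g -> locint F -> locint (fun x => g x * F x).
Proof.
move=> cg lF; have mg := continuous_measurable_rV cg.
split; first by apply: measurable_funM => //; exact: lF.1.
move=> M; have [C gC] := continuous_bounded_cball M cg.
have := integrableZl (measurable_cball M) C ((locint_norm lF).2 M).
apply: le_integrable; first exact: measurable_cball.
  by apply/measurable_EFinP; apply: measurable_funTS; apply: measurable_funM => //; exact: lF.1.
move=> x xM; rewrite /= lee_fin !normrM normr_id ler_wpM2r//.
exact: le_trans (gC x xM) (ler_norm C).
Qed.

Lemma locintZ (c : R) F : locint F -> locint (fun x => c * F x).
Proof. by apply: locintMl; exact: cst_continuous. Qed.

(** From |F| <= F^2 + 1, as balls have finite measure. *)
Lemma locintW F : measurable_fun setT F -> locint (fun x => F x ^+ 2) -> locint F.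
Proof.
move=> mF [mF2 iF2]; split => // M.
have := integrableD (measurable_cball M) (iF2 M) (integrable_cball_cst M 1).
apply: le_integrable; first exact: measurable_cball.
  by apply/measurable_EFinP; exact: measurable_funTS.
move=> x _; rewrite /= lee_fin [leRHS]ger0_norm ?addr_ge0 ?sqr_ge0//.
rewrite -[X in _ <= X + _](real_normK (num_real (F x))); have := sqr_ge0 (`|F x| - 1); have := normr_ge0 (F x); nra.
Qed.

Lemma measurable_add2 : measurable_fun setT (fun p : 'rV[R]_n * 'rV[R]_n => p.1 + p.2).
Proof.
apply: measurable_fun_rV => j.
have -> : (fun p : 'rV[R]_n * 'rV[R]_n => (p.1 + p.2) ord0 j) =
    (fun p : 'rV[R]_n * 'rV[R]_n => p.1 ord0 j + p.2 ord0 j).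
  by apply/funext => p; rewrite mxE.
apply: measurable_funD.
  exact: (measurableT_comp (measurable_coord j) measurable_fst).
exact: (measurableT_comp (measurable_coord j) measurable_snd).
Qed.

Variables (k : 'rV[R]_n -> R) (e : R).
Hypothesis kk : mollifier k e.
Let sk : smooth k. Proof. by case: kk. Qed.
Let ck : continuous k. Proof. exact: smooth_continuous. Qed.
Let ke : supp_in k e. Proof. by case: kk. Qed.
Let k0 x : 0 <= k x. Proof. by case: kk. Qed.
Let k1 : \int[lam]_x k x = 1. Proof. by case: kk. Qed.
Let ki : rint lam k. Proof. exact: integrable_cs ck ke. Qed.

Lemma convol_le F G x : locint F -> locint G ->
  (forall z, `|z| <= e -> F (x + z) <= G (x + z)) -> convol F k x <= convol G k x.
Proof.
move=> lF lG FG; apply: le_Int; [exact: convol_rintz lF ck ke|exact: convol_rintz lG ck ke|] => z.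
have [ze|ze] := leP `|z| e; first by rewrite ler_wpM2r// FG.
by rewrite ke// !mulr0.
Qed.

Lemma convolD F G x : locint F -> locint G ->
  convol (fun y => F y + G y) k x = convol F k x + convol G k x.
Proof.
move=> lF lG; rewrite /convol -IntD; [|exact: convol_rintz lF ck ke|exact: convol_rintz lG ck ke].
by apply: eq_Int => z; rewrite mulrDl.
Qed.

Lemma convolZ (c : R) F x : locint F -> convol (fun y => c * F y) k x = c * convol F k x.
Proof.
move=> lF; rewrite /convol -IntZ; [|exact: convol_rintz lF ck ke].
by apply: eq_Int => z; rewrite mulrA.
Qed.

Lemma convol_cst (c : R) x : convol (fun=> c) k x = c.
Proof. by rewrite /convol IntZ// k1 mulr1. Qed.

(** The kernel is a probability density, so this is the nonnegativity of a variance: the average of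
    (F - c)^2 is expanded and taken at c = [convol F k x]. *)
Lemma convol_jensen F x : measurable_fun setT F -> locint (fun y => F y ^+ 2) ->
  convol F k x ^+ 2 <= convol (fun y => F y ^+ 2) k x.
Proof.
move=> mF lF2; have lF := locintW mF lF2.
have i1 := convol_rintz x lF ck ke; have i2 := convol_rintz x lF2 ck ke.
suff : forall c, 0 <= convol (fun y => F y ^+ 2) k x - (2 * c) * convol F k x + c ^+ 2 * \int[lam]_x k x.
  by move=> /(_ (convol F k x)); rewrite k1 => ?; lra.
move=> c.
rewrite /convol -!IntZ// -IntB//; last exact: rintZ.
rewrite -IntD; [|by apply: rintB => //; exact: rintZ|exact: rintZ].
apply: Int_ge0 => z.
have -> : F (x + z) ^+ 2 * k z - 2 * c * (F (x + z) * k z) + c ^+ 2 * k z =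
  (F (x + z) - c) ^+ 2 * k z by ring.
by rewrite mulr_ge0 ?sqr_ge0.
Qed.

(* Friedrichs' commutator estimate. *)
Lemma convol_commutator g F M L x : smooth g -> measurable_fun setT F ->
  locint (fun y => F y ^+ 2) -> e <= 1 -> `|x| <= M -> 0 <= L ->
  (forall h, `|h| <= 1 -> `|g (x + h) - g x| <= L * `|h|) ->
  (convol (fun y => g y * F y) k x - g x * convol F k x) ^+ 2 <=
    (L * e) ^+ 2 * convol (fun y => F y ^+ 2) k x.
Proof.
move=> sg mF lF2 e1 xM L0 gL; have lF := locintW mF lF2.
have cg := smooth_continuous sg.
have lgF := locintMl cg lF.
have cd : continuous (fun y => g y - g x).
  by apply: (@smooth_continuous _ _ (fun y => g y - g x)); apply: smoothB => //; exact: smooth_cst.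
(* The commutator is the mollification of [(g y - g x) * F y], whose first factor is at most [L * e]
   on the support of the translated kernel; Jensen then gives the bound. *)
have E : convol (fun y => g y * F y) k x - g x * convol F k x = convol (fun y => (g y - g x) * F y) k x.
  rewrite -convolZ// -[X in _ - X]mul1r -[- _]mulN1r mul1r -convolZ; last exact: locintZ.
  rewrite -convolD//; last by do 2 apply: locintZ.
  by congr convol; apply/funext => y; ring.
rewrite E.
have lD2 : locint (fun y => ((g y - g x) * F y) ^+ 2).
  have -> : (fun y => ((g y - g x) * F y) ^+ 2) = fun y => (g y - g x) ^+ 2 * F y ^+ 2.
    by apply/funext => y; rewrite exprMn.
  apply: locintMl => //.
  apply: (@smooth_continuous _ _ (fun y => (g y - g x) ^+ 2)); apply: smoothX.
  by apply: smoothB => //; exact: smooth_cst.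
apply: le_trans (convol_jensen _ _ lD2) _.
  by apply: measurable_funM => //; exact: continuous_measurable_rV.
rewrite -convolZ//; apply: convol_le => //; first exact: locintZ.
move=> z ze; rewrite exprMn ler_wpM2r ?sqr_ge0//.
rewrite -(real_normK (num_real (g (x + z) - g x))) ler_sqr ?nnegrE ?mulr_ge0//.
  by apply: le_trans (gL z (le_trans ze e1)) _; rewrite ler_wpM2l.
exact: le_trans (normr_ge0 z) ze.
Qed.

(** By Fubini the difference of the integrals is that of [k z * (T z - T 0)], where [T z] can be
    written with the translation by z carried by [psi]. The Lipschitz bound on [psi] yields a rate
    that involves [G] only through its L^1 norm on a ball. *)
Lemma convol_weak G psi M L : locint G -> smooth psi -> supp_in psi M -> e <= 1 -> 0 <= e -> 0 <= L ->
  (forall x h, `|psi (x + h) - psi x| <= L * `|h|) ->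
  rint lam (fun x => convol G k x * psi x) /\
  `|\int[lam]_x (convol G k x * psi x) - \int[lam]_x (G x * psi x)| <=
    L * e * \int[lam]_x (`|G x| * \1_(cball (`|M| + 1)) x).
Proof.
move=> lG sp pM e1 e0 L0 pL.
have mG := lG.1; have cp := smooth_continuous sp.
have mp := continuous_measurable_rV cp; have mk := continuous_measurable_rV ck.
pose B : set 'rV[R]_n := cball (`|M| + 1).
have mB : measurable B by exact: measurable_cball.
pose I := \int[lam]_x (`|G x| * \1_B x).
have Ii : rint lam (fun y => `|G y| * \1_B y).
  by apply: rint_loc; exact: locint_norm.
have Gpi := integrable_locintM lG mp _ pM.
have [Cp Cp0 psiC] := cont_supp_bounded cp pM.
have {}Gpi := Gpi Cp psiC.
pose T z := \int[lam]_x (G (x + z) * psi x).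
have TE z : T z = \int[lam]_x (G x * psi (x - z)).
  rewrite /T -(Rintegral_translation z (f := fun x => G x * psi (x - z))).
    by apply: eq_Int => x; rewrite addrK.
  apply: measurable_funM => //.
  exact: (measurableT_comp mp (measurable_addrV (- z))).
have psi_shift z : rint lam (fun x => G x * psi (x - z)) by exact: convol_rint lG cp pM.
have slice z : rint lam (fun x => G (x + z) * psi x).
  have := integrable_translation z (psi_shift z).
  by apply: eq_rint => x; rewrite addrK.
pose f x z := G (x + z) * k z * psi x.
have [f1 f2 fE] : [/\ rint lam (fun x => \int[lam]_z f x z), rint lam (fun z => \int[lam]_x f x z) &
    \int[lam]_x (\int[lam]_z f x z) = \int[lam]_z (\int[lam]_x f x z)].
  apply: (@Int_fubini _ _ _ _ _ _ _ f (fun z => Cp * I * k z)).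
  - apply: measurable_funM; first apply: measurable_funM.
    + exact: (measurableT_comp mG measurable_add2).
    + exact: (measurableT_comp mk measurable_snd).
    + exact: (measurableT_comp mp measurable_fst).
  - move=> z; have := rintZ (k z) (slice z).
    by apply: eq_rint => x; rewrite /f; ring.
  - move=> x; have := rintZ (psi x) (convol_rintz x lG ck ke).
    by apply: eq_rint => z; rewrite /f; ring.
  - exact: rintZ.
  move=> z; have [ze|ze] := leP `|z| e; last first.
    rewrite ke// mulr0 (eq_Int _ (g := fun=> 0)) ?Int0// => x.
    by rewrite /f ke// mulr0 mul0r normr0.
  have -> : \int[lam]_x `|f x z| = k z * \int[lam]_x (`|G x * psi (x - z)|).
    rewrite -IntZ; last exact: rint_norm.
    rewrite -(Rintegral_translation z (f := fun x => k z * `|G x * psi (x - z)|)).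
      by apply: eq_Int => x; rewrite /f addrK !normrM (ger0_norm (k0 z)); ring.
    apply: measurable_funM => //; apply: measurableT_comp => //.
    exact: rint_measurable (psi_shift z).
  rewrite mulrC ler_wpM2r// -IntZ//; apply: le_Int; [exact: rint_norm|exact: rintZ|] => x.
  rewrite normrM mulrCA ler_wpM2l//; have [xB|xB] := boolP (x \in B).
    by rewrite indicE xB mulr1.
  rewrite pM ?normr0 ?mulr_ge0// ltNge; apply: contra xB => xz; rewrite inE /B /cball/=.
  rewrite -(subrK z x) (le_trans (ler_normD _ _))// lerD ?(le_trans ze)//.
  exact: le_trans xz (ler_norm M).
have E1 x : \int[lam]_z f x z = convol G k x * psi x.
  rewrite /convol mulrC -IntZ; last exact: convol_rintz lG ck ke.
  by apply: eq_Int => z; rewrite /f; ring.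
have E2 z : \int[lam]_x f x z = k z * T z.
  by rewrite /T -IntZ//; apply: eq_Int => x; rewrite /f; ring.
split; first by apply: eq_rint f1.
have -> : \int[lam]_x (convol G k x * psi x) - \int[lam]_x (G x * psi x) =
    \int[lam]_z (k z * (T z - T 0)).
  rewrite -(eq_Int _ E1) fE (eq_Int _ E2).
  have T0 : \int[lam]_x (G x * psi x) = T 0.
    by rewrite /T; apply: eq_Int => x; rewrite addr0.
  rewrite T0 -[X in _ - X]mulr1 -k1 -IntZ// -IntB; [| |exact: rintZ].
    by apply: eq_Int => z; ring.
  by apply: eq_rint f2.
have Di : rint lam (fun z => k z * (T z - T 0)).
  apply: (@eq_rint _ _ _ _ (fun z => \int[lam]_x f x z - T 0 * k z)).
    by move=> z; rewrite E2; ring.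
  by apply: rintB => //; exact: rintZ.
apply: le_trans (Int_norm Di) _.
rewrite -/B -/I -[leRHS]mulr1 -k1 -IntZ//; apply: le_Int; [exact: rint_norm|exact: rintZ|] => z.
rewrite normrM (ger0_norm (k0 z)) mulrC; have [ze|ze] := leP `|z| e; last by rewrite ke// !mulr0.
rewrite ler_wpM2r// !TE -IntB//.
apply: le_trans (Int_norm _) _; first exact: rintB.
rewrite /I -IntZ//; apply: le_Int; [by apply: rint_norm; exact: rintB|exact: rintZ|] => x.
rewrite subr0 -mulrBr normrM mulrCA ler_wpM2l//; have [xB|xB] := boolP (x \in B).
  rewrite indicE xB mulr1; apply: le_trans (pL x (- z)) _; rewrite normrN ler_wpM2l//.
have Mx : `|M| + 1 < `|x| by rewrite ltNge; apply: contra xB; rewrite inE.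
rewrite !pM ?subr0 ?normr0 ?mulr_ge0//.
- by apply: le_lt_trans Mx; rewrite (le_trans (ler_norm M))// lerDl.
- apply: le_lt_trans (ler_norm M) _; rewrite -(ltrD2r 1); apply: lt_le_trans Mx _.
  by rewrite -{1}(subrK z x) (le_trans (ler_normD _ _))// lerD2l (le_trans ze).
Qed.

End mollifier.

(** * Bump functions and cutoffs *)

Section flat.
Context {R : realType}.
Implicit Types (p q : {poly R}) (t s : R).

(** Each power satisfies s^i <= i! e^s, by a single term of the exponential series. *)
Lemma poly_expR_bounded q : exists2 K : R, 0 <= K & forall s, 0 <= s -> `|q.[s] * expR (- s)| <= K.
Proof.
exists (\sum_(i < size q) `|q`_i| * (i`!)%:R); first by apply: sumr_ge0 => i _; exact: mulr_ge0.
move=> s s0; rewrite horner_coef mulr_suml; apply: le_trans (ler_norm_sum _ _ _) _.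
apply: ler_sum => i _; rewrite -mulrA normrM ler_wpM2l//.
rewrite ger0_norm ?mulr_ge0 ?exprn_ge0 ?expR_ge0// expRN ler_pdivrMr ?expR_gt0//.
case: (nat_of_ord i) => [|j].
  by rewrite fact0 mul1r expr0 (le_trans _ (expR_ge1Dx s))// lerDl.
have := expR_ge1Dxn j s0; have f0 : 0 < (j.+1`!)%:R :> R by rewrite ltr0n fact_gt0.
move=> H; rewrite -ler_pdivrMl// mulrC; apply: le_trans H; by rewrite lerDr.
Qed.

(* [flat 1] is t |-> exp (- 1 / t); the family is closed under differentiation. *)
Definition flat p t : R := if 0 < t then p.[t^-1] * expR (- t^-1) else 0.

(** For t > 0 the derivative of p(1/t) exp(-1/t) is t^-2 (p - p')(1/t) exp(-1/t), which explains the
    polynomial. At t = 0 the function is O(t^2), so its derivative is 0. *)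
Lemma flat_derive p t : is_derive t 1 (flat p) (flat ('X^2 * (p - p^`())) t).
Proof.
have [t0|t0|->] := ltgtP t 0.
- rewrite [X in is_derive _ _ _ X](_ : _ = 0); last by rewrite /flat ltNge (ltW t0).
  apply: (@near_eq_is_derive _ _ _ (cst 0)).
  have : open [set s : R | s < 0] by exact: open_lt.
  move=> o0; apply: filterS (open_nbhs_nbhs (conj o0 t0)) => s /= s0.
  by rewrite /flat ltNge (ltW s0).
- apply: (@near_eq_is_derive _ _ _ (fun s => p.[s^-1] * expR (- s^-1))).
    have : open [set s : R | 0 < s] by exact: open_gt.
    move=> o0; apply: filterS (open_nbhs_nbhs (conj o0 t0)) => s /= s0.
    by rewrite /flat s0.
  have tn0 : t != 0 by rewrite gt_eqF.
  have dinv : is_derive t 1 (fun s : R => s^-1) (- t ^- 2).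
    by have := is_deriveV tn0 (is_derive_id t 1); rewrite [_ *: _]mulr1.
  have dp : is_derive t 1 (fun s => p.[s^-1]) ((p^`()).[t^-1] * (- t ^- 2)).
    exact: (is_derive1_comp (is_derive_poly p t^-1) dinv).
  have dN : is_derive t 1 (fun s : R => - s^-1) (t ^- 2).
    by have := is_deriveN dinv; rewrite opprK.
  have de : is_derive t 1 (fun s => expR (- s^-1)) (expR (- t^-1) * (t ^- 2)).
    exact: (@is_derive1_comp R expR (fun s => - s^-1) t _ _ (is_derive_expR _) dN).
  have := @is_deriveM _ _ _ _ _ _ _ _ dp de.
  rewrite /flat t0 !hornerE => /(@is_derive_eq _ _ _ _ _ _ _ _); apply.
  by rewrite /GRing.scale/= exprVn; ring.
(* The factor ['X^2] turns the bound on the polynomial times the exponential into |flat p h| <= K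
   h^2. *)
have [K K0 pK] := poly_expR_bounded (p * 'X^2).
have d0 : is_diff (0 : R) (flat p) (fun=> 0).
  apply: (@differentiable_quadratic0 _ R (flat p) 0 K) => h _.
  rewrite addr0 /flat ltxx subr0; case: ifPn => h0; last first.
    by rewrite normr0 mulr_ge0// exprn_ge0.
  rewrite (gtr0_norm h0); have := pK h^-1; rewrite invr_ge0 ltW// => /(_ isT).
  rewrite hornerM hornerXn exprVn => H.
  rewrite -ler_pdivrMr ?exprn_gt0// -[X in _ / X]gtr0_norm ?exprn_gt0// -normf_div.
  by apply: le_trans H; rewrite le_eqVlt; apply/orP; left; apply/eqP; congr `|_|; ring.
rewrite [X in is_derive _ _ _ X](_ : _ = 0); last by rewrite /flat ltxx.
have [dd dE] := d0.
by apply: DeriveDef; [exact: diff_derivable|rewrite deriveE// dE].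
Qed.

Lemma flat_ge0 t : 0 <= flat 1 t.
Proof. by rewrite /flat; case: ifPn => // _; rewrite hornerE mul1r expR_ge0. Qed.

Lemma flat_le0 p t : t <= 0 -> flat p t = 0.
Proof. by move=> t0; rewrite /flat ltNge t0. Qed.

Lemma flat_ge s t : 0 < s -> s <= t -> flat 1 s <= flat 1 t.
Proof.
move=> s0 st; have t0 := lt_le_trans s0 st; rewrite /flat s0 t0 !hornerE ler_expR lerN2.
by rewrite lef_pV2.
Qed.

Lemma flat_gt0 t : 0 < t -> 0 < flat 1 t.
Proof. by move=> t0; rewrite /flat t0 hornerE mul1r expR_gt0. Qed.

End flat.

Section cube_bump.
Context {R : realType} {n : nat}.
Local Notation lam := (lebesgue_rV n).

Lemma partial_comp1 (g : R -> R) (dg : R) (f : 'rV[R]_n -> R) j x : differentiable f x ->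
  is_derive (f x) 1 g dg ->
  differentiable (fun y => g (f y)) x /\ partial (fun y => g (f y)) j x = dg * partial f j x.
Proof.
move=> df [/derivable1_diffP dg1 dgE].
have D : differentiable (fun y => g (f y)) x by exact: (differentiable_comp df dg1).
split => //.
have L := @is_derive_line _ _ (fun y => g (f y)) x (delta_mx ord0 j) 0.
have Lf := @is_derive_line _ _ f x (delta_mx ord0 j) 0.
rewrite scale0r addr0 in L Lf.
have {}L := L D; have {}Lf := Lf df.
have dg2 : is_derive (f (x + 0 *: delta_mx ord0 j)) 1 g dg.
  by rewrite scale0r addr0; apply: DeriveDef => //; exact/derivable1_diffP.
have Le := @is_derive1_comp R g (fun s => f (x + s *: delta_mx ord0 j)) 0 _ _ dg2 Lf.
by rewrite /partial -(@derive_val _ _ _ _ _ _ _ L) (@derive_val _ _ _ _ _ _ _ Le).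
Qed.

Lemma smooth_flat p (f : 'rV[R]_n -> R) : smooth f -> smooth (fun x => flat p (f x)).
Proof.
move=> sf k; elim: k p => [|k IH] p.
  move=> x; apply: (@continuous_comp _ _ _ f (flat p)); first exact: smooth_continuous.
  by apply: differentiable_continuous; apply/derivable1_diffP; case: (flat_derive p (f x)).
have D x j := partial_comp1 j (smooth_differentiable sf x) (flat_derive p (f x)).
split=> [x|j].
  apply: (differentiable_comp (smooth_differentiable sf x)).
  by apply/derivable1_diffP; case: (flat_derive p (f x)).
have -> : partial (fun y => flat p (f y)) j =
    fun x => flat ('X^2 * (p - p^`())) (f x) * partial f j x.
  by apply/funext => x; have [_ ->] := D x j.
by apply: CkM; [exact: IH|exact: smooth_partial].
Qed.

(** A product over the coordinates, because the balls of the sup norm are cubes: it is positive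
    exactly when all coordinates lie strictly between [- e] and [e]. *)
Definition cube_bump (e : R) (x : 'rV[R]_n) := \prod_(j < n) (flat 1 (e - x ord0 j) * flat 1 (e + x ord0 j)).

Lemma smooth_prod I (r : seq I) (P : pred I) (f : I -> 'rV[R]_n -> R) :
  (forall i, P i -> smooth (f i)) -> smooth (fun x => \prod_(i <- r | P i) f i x).
Proof.
move=> sf; elim: r => [|i r IH].
  have -> : (fun x => \prod_(i <- [::] | P i) f i x) = fun=> 1.
    by apply/funext => x; rewrite big_nil.
  exact: smooth_cst.
have -> : (fun x => \prod_(i <- (i :: r) | P i) f i x) =
    fun x => (if P i then f i x else 1) * \prod_(i <- r | P i) f i x.
  by apply/funext => x; rewrite big_cons; case: ifPn => //; rewrite mul1r.
by apply: smoothM => //; case: (boolP (P i)) => [/sf//|_]; exact: smooth_cst.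
Qed.

Lemma cube_bump_smooth e : smooth (cube_bump e).
Proof.
apply: smooth_prod => j _; apply: smoothM; apply: smooth_flat.
  by apply: smoothB; [exact: smooth_cst|exact: smooth_coord].
by apply: smoothD; [exact: smooth_cst|exact: smooth_coord].
Qed.

Lemma cube_bump_ge0 e x : 0 <= cube_bump e x.
Proof. by apply: prodr_ge0 => j _; rewrite mulr_ge0// flat_ge0. Qed.

Lemma cube_bump_supp e : 0 <= e -> supp_in (cube_bump e) e.
Proof.
move=> e0 x ex.
have [j xj] : exists j, e < `|x ord0 j|.
  apply/not_existsP => H; move: ex; rewrite ltNge => /negP; apply.
  by apply/norm_rV_le => // j; rewrite leNgt; apply/negP; exact: H.
rewrite /cube_bump (bigD1 j)//=; have [xj0|xj0] := leP 0 (x ord0 j).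
  by rewrite (ger0_norm xj0) in xj; rewrite flat_le0 ?mul0r// subr_le0 ltW.
rewrite (ltr0_norm xj0) in xj; rewrite (@flat_le0 _ 1 (e + x ord0 j)) ?mulr0 ?mul0r//.
by move: (x ord0 j) xj => t; lra.
Qed.

(** On the cube of half the size each factor is at least [flat 1 (e / 2)], so the integral dominates
    [c] times a positive volume. *)
Lemma cube_bump_int_gt0 e : 0 < e -> 0 < \int[lam]_x cube_bump e x.
Proof.
move=> e0.
have bi : rint lam (cube_bump e).
  exact: integrable_cs (smooth_continuous (@cube_bump_smooth e)) (cube_bump_supp (ltW e0)).
pose c : R := (flat 1 (e / 2) ^+ 2) ^+ n.
have f0 : 0 < flat 1 (e / 2) by rewrite flat_gt0// divr_gt0.
have c0 : 0 < c by do 2 rewrite exprn_gt0//.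
pose B : set 'rV[R]_n := cball (e / 2).
have mB : measurable B by exact: measurable_cball.
have BE : lam B = ((2 * (e / 2)) ^+ n)%:E.
  by rewrite /B cballE ?lebesgue_rV_cube// divr_ge0// ltW.
have Bi : rint lam (fun x => c * \1_B x).
  by apply: rintZ; exact: rint_indic_cball.
apply: (@lt_le_trans _ _ (\int[lam]_x (c * \1_B x))); last first.
  apply: le_Int => // x; rewrite indicE; have [xB|xB] := boolP (x \in B); last first.
    by rewrite mulr0 cube_bump_ge0.
  have {}xB : `|x| <= e / 2 by move: xB; rewrite inE.
  rewrite mulr1 /cube_bump /c -[X in _ ^+ X](card_ord n) -prodr_const.
  apply: ler_prod => j _; rewrite exprn_ge0 ?flat_ge0//= expr2.
  have := le_trans (coord_le_norm x j) xB; rewrite ler_norml => /andP[x1 x2].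
  apply: ler_pM; rewrite ?flat_ge0//; apply: flat_ge; rewrite ?divr_gt0//; lra.
rewrite IntZ; last exact: rint_indic_cball.
rewrite mulr_gt0//; have -> : \int[lam]_x (\1_B x : R) = (2 * (e / 2)) ^+ n.
  by transitivity (fine (lam B)); [rewrite /Rintegral integral_indic// setIT|rewrite BE].
by rewrite exprn_gt0// mulr_gt0// divr_gt0.
Qed.

Lemma mollifier_exists e : 0 < e -> exists k : 'rV[R]_n -> R, mollifier k e.
Proof.
move=> e0; have I0 := cube_bump_int_gt0 e0; set I := Rintegral _ _ _ in I0.
exists (fun x => I^-1 * cube_bump e x); split.
- by apply: smoothM; [exact: smooth_cst|exact: cube_bump_smooth].
- by apply: supp_inMl; exact: cube_bump_supp (ltW e0).
- by move=> x; rewrite mulr_ge0 ?cube_bump_ge0// invr_ge0 ltW.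
rewrite IntZ; first by rewrite -/I mulVf// gt_eqF.
exact: integrable_cs (smooth_continuous (@cube_bump_smooth e)) (cube_bump_supp (ltW e0)).
Qed.

(** The indicator of the ball of radius 2, mollified at scale 1, is 1 on the ball of radius 1 and 0
    beyond 3. A dilation by [r] divides its derivatives by [r], so [C] is the same for all radii. *)
Lemma cutoff_exists : exists2 C : R, 0 <= C & forall r : R, 0 < r ->
  exists eta : 'rV[R]_n -> R, [/\ smooth eta, supp_in eta (3 * r),
    forall x, 0 <= eta x <= 1, forall x, `|x| <= r -> eta x = 1 &
    forall a x, `|partial eta a x| <= C / r].
Proof.
have [k kk] := mollifier_exists ltr01; have [sk k1 k0 ik] := kk.
pose B : set 'rV[R]_n := cball 2.
have mB : measurable B by exact: measurable_cball.
have lB : locint (\1_B : 'rV[R]_n -> R).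
  split; first exact: measurable_indic.
  move=> M; apply: le_integrable (integrable_cball_cst M 1).
  - exact: measurable_cball.
  - by apply/measurable_EFinP; apply: measurable_funTS; exact: measurable_indic.
  by move=> x _; rewrite /= lee_fin indicE; case: (_ \in _); rewrite ?normr1 ?normr0.
pose eta1 := convol (\1_B : 'rV[R]_n -> R) k.
have s1 : smooth eta1 := convol_smooth lB sk k1.
have e0 x : 0 <= eta1 x.
  by apply: Int_ge0 => z; rewrite mulr_ge0// indicE ler0n.
have l1 : locint (fun _ : 'rV[R]_n => 1 : R) by apply: continuous_locint; exact: cst_continuous.
have e1 x : eta1 x <= 1.
  rewrite -[leRHS](convol_cst kk 1 x); exact: (convol_le kk).
have eE x : `|x| <= 1 -> eta1 x = 1.
  move=> x1; apply/eqP; rewrite eq_le e1 -[leLHS](convol_cst kk 1 x).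
  apply: (convol_le kk) => // z z1; rewrite indicE mem_set// /B /cball/=.
  by apply: le_trans (ler_normD _ _) _; lra.
have es : supp_in eta1 3.
  move=> x x3; apply/eqP; rewrite eq_le e0 andbT -[leRHS](convol_cst kk 0 x).
  have l0 : locint (fun _ : 'rV[R]_n => 0 : R) by apply: continuous_locint; exact: cst_continuous.
  apply: (convol_le kk) => // z z1; rewrite indicE memNset// /B /cball/= => xz.
  have : `|x| <= `|x + z| + `|z| by rewrite -{1}(addrK z x) ler_normB.
  lra.
have [C C0 eC] := partial_bounded s1 es.
exists C => // r r0; have r1 : 0 < r^-1 by rewrite invr_gt0.
exists (fun x => eta1 (0 + x *m (r^-1)%:M)).
have nE (x : 'rV[R]_n) : `|0 + x *m (r^-1)%:M| = r^-1 * `|x|.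
  by rewrite add0r mul_mx_scalar normrZ gtr0_norm.
split.
- exact: smooth_affine.
- move=> x x3; apply: es; rewrite nE mulrC ltr_pdivlMr//.
- by move=> x; rewrite e0 e1.
- by move=> x xr; apply: eE; rewrite nE mulrC ler_pdivrMr// mul1r.
move=> a x; rewrite partial_affine; last exact: (smooth_differentiable s1).
rewrite (bigD1 a)//= big1 ?addr0 => [|b ba].
  rewrite mxE eqxx mulr1n normrM (gtr0_norm r1) mulrC ler_wpM2r//; exact: ltW.
by rewrite mxE eq_sym (negbTE ba) mulr0n mul0r.
Qed.

End cube_bump.

(** * Measures with a density *)

Section density.
Context d (T : measurableType d) (R : realType).
Variables (lam P : {measure set T -> \bar R}) (w : T -> R).
Hypotheses (mw : measurable_fun setT w) (w0 : forall x, 0 <= w x).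
Hypothesis Pw : forall A, measurable A -> P A = (\int[lam]_(x in A) (w x)%:E)%E.
Import HBNNSimple.
Local Open Scope ereal_scope.

Let integral_density_nnsfun (h : {nnsfun T >-> R}) :
  \int[P]_x (h x)%:E = \int[lam]_x ((h x)%:E * (w x)%:E).
Proof.
under [LHS]eq_integral do rewrite fimfunE -fsumEFin//.
rewrite [LHS]ge0_integral_fsum//; last 2 first.
  - by move=> r; exact/measurable_EFinP/measurableT_comp.
  - by move=> n x _; rewrite EFinM nnfun_muleindic_ge0.
under [RHS]eq_integral.
  move=> x xD; rewrite fimfunE -fsumEFin// muleC ge0_mule_fsumr; last first.
    by move=> r; rewrite EFinM nnfun_muleindic_ge0.
  over.
rewrite [RHS]ge0_integral_fsum//; last 2 first.
  - move=> r; apply/measurable_EFinP => /=; apply: measurable_funM => //.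
    exact: measurableT_comp.
  - move=> n x _; rewrite EFinM mule_ge0//; first by rewrite lee_fin w0.
    by rewrite nnfun_muleindic_ge0.
apply: eq_fsbigr => r _.
have mr : measurable (h @^-1` [set r]) by exact: measurable_sfunP.
rewrite integralZl_indic_nnsfun// integral_indic// setIT Pw//.
have [r0|r0] := leP 0%R r; last first.
  rewrite [X in _ * X](_ : _ = 0); last first.
    by rewrite preimage_nnfun0// integral_set0.
  rewrite mule0; apply/esym; rewrite -[RHS](integral0 lam setT).
  by apply: eq_integral => x _; rewrite preimage_nnfun0// indic0/= mulr0 mule0.
rewrite [X in _ * X]integral_mkcond -ge0_integralZl//; last first.
- by move=> x _; rewrite patchE; case: ifPn => // _; rewrite lee_fin.
- by apply/(measurable_restrictT _ _).1 => //; exact/measurable_EFinP/measurable_funTS.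
apply: eq_integral => x _; rewrite patchE indicE; case: ifPn => _.
  by rewrite mulr1 muleC.
by rewrite mulr0 !mule0.
Qed.

(** Gibbs measures are given by their values on sets; integrals against them are transferred to
    Lebesgue measure through simple functions and monotone convergence. *)
Lemma ge0_integral_density (f : T -> \bar R) : measurable_fun setT f -> (forall x, 0 <= f x) ->
  \int[P]_x f x = \int[lam]_x (f x * (w x)%:E).
Proof.
move=> mf f0.
pose f_ := nnsfun_approx measurableT mf.
transitivity (lim (\int[P]_x (f_ n x)%:E @[n --> \oo])).
  rewrite -monotone_convergence//=.
  - apply: eq_integral => ? /[!inE] xD; apply/esym/cvg_lim => //=.
    exact: cvg_nnsfun_approx.
  - by move=> n; exact/measurable_EFinP/measurable_funTS.
  - by move=> n ? _; rewrite lee_fin.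
  - by move=> ? _ ? ? mn; rewrite lee_fin; exact/lefP/nd_nnsfun_approx.
transitivity (lim (\int[lam]_x ((f_ n x)%:E * (w x)%:E) @[n --> \oo])).
  by apply: congr_lim; apply/funext => n /=; exact: integral_density_nnsfun.
rewrite -monotone_convergence//=.
- apply: eq_integral => x /[!inE] xD; apply/cvg_lim => //=.
  apply: cvgeZr => //; exact: cvg_nnsfun_approx.
- move=> n; apply: emeasurable_funM; last exact/measurable_EFinP.
  exact/measurable_EFinP/measurable_funTS.
- by move=> n ? _; rewrite mule_ge0 ?lee_fin.
- by move=> ? _ ? ? mn; rewrite lee_wpmul2r ?lee_fin//; exact/lefP/nd_nnsfun_approx.
Qed.

Lemma rint_density (f : T -> R) : measurable_fun setT f ->
  rint P f <-> rint lam (fun x => f x * w x)%R.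
Proof.
move=> mf.
have mfw : measurable_fun setT (fun x => f x * w x)%R by exact: measurable_funM.
have E : \int[P]_x `|(f x)%:E| = \int[lam]_x `|(f x * w x)%:E|.
  rewrite ge0_integral_density//; last exact/measurable_EFinP/measurableT_comp.
  by apply: eq_integral => x _; rewrite EFinM abseM [`|(w x)%:E|]gee0_abs// lee_fin.
split => /integrableP[_ fi]; apply/integrableP; split; try exact/measurable_EFinP.
  by rewrite -E.
by rewrite /= E.
Qed.

Lemma Int_density (f : T -> R) : measurable_fun setT f ->
  (\int[P]_x f x = \int[lam]_x (f x * w x))%R.
Proof.
move=> mf; rewrite /Rintegral integralE [in RHS]integralE.
have mf' : measurable_fun setT (EFin \o f) by exact/measurable_EFinP.
congr (fine (_ - _)).
  rewrite ge0_integral_density//; last exact: measurable_funepos.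
  apply: eq_integral => x _; rewrite !funeposE -!EFin_max -EFinM; congr EFin.
  by rewrite maxr_pMl// mul0r.
rewrite ge0_integral_density//; last exact: measurable_funeneg.
apply: eq_integral => x _; rewrite !funenegE -!EFinN -!EFin_max -EFinM; congr EFin.
by rewrite maxr_pMl// mul0r mulNr.
Qed.

End density.

Section measure_with_density.
Context d (T : measurableType d) (R : realType) (lam : {measure set T -> \bar R}) (w : T -> R).
Hypotheses (mw : measurable_fun setT w) (w0 : forall x, 0 <= w x).
Hypothesis w1 : (\int[lam]_x (w x)%:E = 1)%E.
Local Open Scope ereal_scope.

Let P (A : set T) : \bar R := \int[lam]_(x in A) (w x)%:E.

Let P0 : P set0 = 0. Proof. by rewrite /P integral_set0. Qed.

Let P_ge0 A : 0 <= P A.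
Proof. by apply: integral_ge0 => x _; rewrite lee_fin. Qed.

Let P_sigma_additive : semi_sigma_additive P.
Proof.
move=> F mF tF mUF; rewrite /P; apply: cvg_toP.
  apply: ereal_nondecreasing_is_cvgn => m n mn.
  by apply: lee_sum_nneg_natr => // k _ _; apply: integral_ge0 => x _; rewrite lee_fin.
rewrite ge0_integral_bigcup//=.
- by apply/measurable_EFinP; exact: measurable_funTS.
- by move=> x _; rewrite lee_fin.
Qed.

(** Serves to construct the conditional measures on the fibres. *)
Lemma probability_with_density : exists Q : probability T R,
  forall A, measurable A -> Q A = \int[lam]_(x in A) (w x)%:E.
Proof.
pose M1 := isMeasure.Build d T R P P0 P_ge0 P_sigma_additive.
pose Pm : {measure set T -> \bar R} := HB.pack P M1.
pose M2 := Measure_isProbability.Build d T R Pm w1.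
pose Q : probability T R := HB.pack P Pm M2.
by exists Q.
Qed.

End measure_with_density.

Ltac smth := repeat first [assumption | exact: smooth_cst | exact: smooth_coord
  | apply: smooth_partial | apply: smoothX | apply: smoothM | apply: smoothN
  | apply: smoothD | apply: smooth_expR | (apply: smooth_sum; move=> ? _)].

(** * The Poincare inequality in dual form *)

Section more_calculus.
Context {R : realType} {n : nat}.
Local Notation lam := (lebesgue_rV n).
Implicit Types f g H u : 'rV[R]_n -> R.

Lemma partialN f j x : differentiable f x -> partial (fun y => - f y) j x = - partial f j x.
Proof. by move=> df; rewrite /partial (@deriveN _ _ _ f)//; exact: diff_derivable. Qed.

Lemma delta_norm (a : 'I_n) : `|delta_mx ord0 a : 'rV[R]_n| <= 1.
Proof.
by apply/norm_rV_le => // k; rewrite mxE/=; case: (_ == _) => /=; rewrite ?normr1 ?normr0.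
Qed.

Lemma mvt_delta f (x : 'rV[R]_n) (t : R) a : smooth f -> exists2 c : R, `|c| <= 1 &
  f (x + t *: delta_mx ord0 a) - f x = t * partial f a (x + (c * t) *: delta_mx ord0 a).
Proof.
move=> sf; have [c c1 fE] := mvt_line x (t *: delta_mx ord0 a) (smooth_differentiable sf).
exists c => //; rewrite fE (bigD1 a)//= big1 ?addr0; first by rewrite !mxE !eqxx mulr1 scalerA.
by move=> b ba; rewrite !mxE (negbTE ba) andbF mulr0 mul0r.
Qed.

Lemma second_difference f (x : 'rV[R]_n) (t : R) a b : smooth f ->
  exists c c' : R, [/\ `|c| <= 1, `|c'| <= 1 &
  f (x + t *: delta_mx ord0 a + t *: delta_mx ord0 b) - f (x + t *: delta_mx ord0 a)
    - f (x + t *: delta_mx ord0 b) + f x =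
  t ^+ 2 * partial (partial f a) b (x + ((c * t) *: delta_mx ord0 a + (c' * t) *: delta_mx ord0 b))].
Proof.
move=> sf; pose d := t *: delta_mx ord0 b : 'rV[R]_n.
pose F y := f (y - - d) - f y.
have sF : smooth F by apply: smoothB => //; exact: smooth_shift.
have [c c1 E] := mvt_delta x t a sF.
have [c' c1' E'] := mvt_delta (x + (c * t) *: delta_mx ord0 a) t b (smooth_partial a sf).
exists c, c'; split; [exact: c1|exact: c1'|].
rewrite addrA expr2 -mulrA -E'.
have <- : partial F a (x + (c * t) *: delta_mx ord0 a) =
    partial f a (x + (c * t) *: delta_mx ord0 a + t *: delta_mx ord0 b) -
    partial f a (x + (c * t) *: delta_mx ord0 a).
  have sf' := smooth_shift (- d) sf.
  rewrite /F partialD; [|exact: smooth_differentiable|].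
    by rewrite partialN ?partial_shift ?opprK//; exact: smooth_differentiable.
  exact: (smooth_differentiable (smoothN sf)).
by rewrite -E /F !opprK; ring.
Qed.

(** The second difference of [f] in two directions is symmetric in them, and equals t^2 times either
    mixed derivative at a point within 2 t of [x]. Both derivatives are locally Lipschitz, so t
    tending to 0 identifies their values at [x]. *)
Lemma partialC f a b x : smooth f -> partial (partial f a) b x = partial (partial f b) a x.
Proof.
move=> sf.
have [L L0 fL] := local_lipschitz `|x| (smooth_partial b (smooth_partial a sf)).
have [L' L0' fL'] := local_lipschitz `|x| (smooth_partial a (smooth_partial b sf)).
apply/eqP; rewrite -subr_eq0 -normr_eq0 eq_le normr_ge0 andbT.
apply/ler_addgt0Pl => eps eps0; rewrite addr0.
(* Each mixed derivative moves by at most its Lipschitz constant times [2 * t]; the last summand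
   only keeps [K] positive. *)
pose K := 2 * L + 2 * L' + 2.
have K0 : 0 < K by rewrite /K; lra.
pose t := Num.min (2^-1) (eps / K).
have t0 : 0 < t by rewrite lt_min invr_gt0 ltr0n divr_gt0.
have t1 : t <= 2^-1 by rewrite ge_min lexx.
have tK : K * t <= eps by rewrite mulrC -ler_pdivlMr// ge_min lexx orbT.
have [c [c' [c1 c1' E]]] := second_difference x t a b sf.
have [d [d' [d1 d1' E']]] := second_difference x t b a sf.
have hn0 (s : R) (p : 'I_n) : `|s| <= 1 -> `|(s * t) *: delta_mx ord0 p : 'rV[R]_n| <= t.
  move=> s1; rewrite normrZ; have -> : `|s * t| = `|s| * t by rewrite normrM (gtr0_norm t0).
  have := delta_norm p; move: s1 (normr_ge0 s) (normr_ge0 (delta_mx ord0 p : 'rV[R]_n)).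
  move: (`|s|) (`|delta_mx ord0 p : 'rV[R]_n|) => x1 x2 h1 h2 h3 h4.
  have : x1 * t <= t by rewrite ler_piMl// ltW.
  apply: le_trans; rewrite ler_piMr//; apply: mulr_ge0 => //; exact: ltW.
have hn (s s' : R) p q : `|s| <= 1 -> `|s'| <= 1 ->
    `|(s * t) *: delta_mx ord0 p + (s' * t) *: delta_mx ord0 q : 'rV[R]_n| <= 2 * t.
  move=> s1 s1'; apply: le_trans (ler_normD _ _) _.
  by rewrite mulr_natl mulr2n; apply: lerD; exact: hn0.
have h1 (s s' : R) p q : `|s| <= 1 -> `|s'| <= 1 ->
    `|(s * t) *: delta_mx ord0 p + (s' * t) *: delta_mx ord0 q : 'rV[R]_n| <= 1.
  by move=> s1 s1'; apply: le_trans (hn _ _ _ _ s1 s1') _; clear -t1; lra.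
have l1 := fL _ _ (lexx _) (h1 _ _ a b c1 c1').
have l2 := fL' _ _ (lexx _) (h1 _ _ b a d1 d1').
have EE : partial (partial f a) b (x + ((c * t) *: delta_mx ord0 a + (c' * t) *: delta_mx ord0 b)) =
   partial (partial f b) a (x + ((d * t) *: delta_mx ord0 b + (d' * t) *: delta_mx ord0 a)).
  apply: (@mulfI _ (t ^+ 2)); first by rewrite expf_neq0// gt_eqF.
  apply: etrans (esym E) _; apply: etrans _ E'; congr (_ + _).
  by rewrite [RHS]addrAC; congr (f _ - _ - _); exact: addrAC.
rewrite EE in l1.
have m1 := ler_wpM2l L0 (hn _ _ a b c1 c1'); have m2 := ler_wpM2l L0' (hn _ _ b a d1 d1').
apply: le_trans tK; rewrite /K.
have tri (A B C : R) : `|A - B| <= `|C - A| + `|C - B|.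
  by rewrite [`|C - A|]distrC; have := ler_normD (A - C) (C - B); rewrite addrA subrK.
apply: le_trans (tri _ _ _) _; apply: le_trans (lerD l1 l2) _.
apply: le_trans (lerD m1 m2) _; clear -t0.
rewrite -subr_ge0 (_ : _ - _ = 2 * t); [by rewrite mulr_ge0// ltW|by ring].
Qed.

End more_calculus.

Section divergence.
Context {R : realType} {n : nat}.
Local Notation lam := (lebesgue_rV n).
Implicit Types f g H u eta : 'rV[R]_n -> R.

(** The divergence theorem for compactly supported fields; the predicate [P] permits integrating by
    parts along one block only. *)
Lemma Int_div (Psi : 'I_n -> 'rV[R]_n -> R) M (P : pred 'I_n) :
  (forall a, smooth (Psi a)) -> (forall a, supp_in (Psi a) M) ->
  rint lam (fun x => \sum_(a | P a) partial (Psi a) a x) /\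
  \int[lam]_x (\sum_(a | P a) partial (Psi a) a x) = 0.
Proof.
move=> sP pM.
have i a : rint lam (partial (Psi a) a).
  by apply: integrable_cs (smooth_continuous (smooth_partial a (sP a))) (supp_in_partial a (pM a)).
split; first by apply: rint_sum => a _; exact: i.
by rewrite Int_sum// big1// => a _; exact: integral_partial (sP a) (pM a).
Qed.

(* The part of e^H div (e^-H grad u) that comes from the coordinates in [P]. *)
Definition lap (P : pred 'I_n) H u x :=
  \sum_(a | P a) (partial (partial u a) a x - partial H a x * partial u a x).

Lemma smooth_lap P H u : smooth H -> smooth u -> smooth (lap P H u).
Proof. by move=> sH su; rewrite /lap; smth. Qed.

Lemma rint_smooth_cs f M : smooth f -> supp_in f M -> rint lam f.
Proof. by move=> sf; exact: integrable_cs (smooth_continuous sf). Qed.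

Lemma partial_expRN H a x : smooth H ->
  partial (fun y => expR (- H y)) a x = - (expR (- H x) * partial H a x).
Proof.
move=> sH; rewrite partial_expR; last exact: (smooth_differentiable (smoothN sH) x).
by rewrite partialN ?mulrN//; exact: smooth_differentiable.
Qed.

(** The number Z in [gibbs] comes without a sign. Total mass 1 against a positive exponential
    excludes [Z^-1 <= 0], and [c] is [Z^-1]. *)
Lemma gibbs_density H (P : probability 'rV[R]_n R) : smooth H -> gibbs H P ->
  exists c : R, [/\ 0 < c, rint lam (fun x => expR (- H x)),
    c * \int[lam]_x expR (- H x) = 1 &
    forall A, measurable A -> P A = (\int[lam]_(x in A) (c * expR (- H x))%:E)%E].
Proof.
move=> sH [Z PZ].
have mw : measurable_fun setT (fun x => expR (- H x)).
  apply: continuous_measurable_rV; apply: smooth_continuous; smth.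
have P1 : (\int[lam]_x (Z^-1 * expR (- H x))%:E = 1)%E.
  by rewrite -PZ// probability_setT.
have Z0 : 0 < Z^-1.
  rewrite ltNge; apply/negP => Z0.
  have : (1 <= (0 : \bar R))%E.
    rewrite -P1 (_ : (\int[lam]_x _ = - \int[lam]_x (- (Z^-1 * expR (- H x)))%:E)%E); last first.
    rewrite -integral_ge0N//; last by move=> x _; rewrite lee_fin oppr_ge0 mulr_le0_ge0 ?expR_ge0.
    by apply: eq_integral => x _; rewrite -EFinN opprK.
  rewrite oppe_le0; apply: integral_ge0 => x _.
  by rewrite lee_fin oppr_ge0 mulr_le0_ge0 ?expR_ge0.
  by rewrite lee_fin ler10.
have ri : rint lam (fun x => Z^-1 * expR (- H x)).
  apply/integrableP; split; first by apply/measurable_EFinP; exact: measurable_funM.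
  under eq_integral => x _ do rewrite gee0_abs ?lee_fin ?mulr_ge0 ?expR_ge0// ?(ltW Z0)//.
  by rewrite P1 ltry.
have ri' : rint lam (fun x => expR (- H x)).
  have := rintZ Z ri; apply: eq_rint => x.
  by rewrite mulrA divff ?mul1r// -invr_eq0 gt_eqF.
exists Z^-1; split => //; rewrite -IntZ//.
by apply: EFin_inj; rewrite -IntE.
Qed.

(** The Poincare inequality against the unnormalised weight e^-H, with [m] the mean of [h] under
    [nu]; the normalising constant cancels from both sides. Compact support of [h] ensures that all
    the integrals are finite. *)
Lemma poincare_smooth H h M rho (nu : probability 'rV[R]_n R) :
  smooth H -> smooth h -> supp_in h M -> 0 < rho -> gibbs H nu -> poincare rho nu ->
  exists m : R, rint lam (fun x => expR (- H x) * (h x - m) ^+ 2) /\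
    rho * \int[lam]_x (expR (- H x) * (h x - m) ^+ 2) <=
    \int[lam]_x (expR (- H x) * \sum_a partial h a x ^+ 2).
Proof.
move=> sH sh hM r0 gH PI.
have [c [c0 ei c1 nuE]] := gibbs_density sH gH.
pose w x := c * expR (- H x).
have sw : smooth w by rewrite /w; smth.
have mw := continuous_measurable_rV (smooth_continuous sw).
have w0 x : 0 <= w x by rewrite mulr_ge0 ?expR_ge0// ltW.
have hi : rint nu h.
  apply/(rint_density mw w0 nuE).
    exact: continuous_measurable_rV (smooth_continuous sh).
  by apply: (@rint_smooth_cs _ M); [smth|exact: supp_inMr].
have {PI} := PI h sh hi; set m := Rintegral _ _ _ => PI.
have eh : rint lam (fun x => expR (- H x) * (h x - m) ^+ 2).
  apply: (@eq_rint _ _ _ _ (fun x => expR (- H x) * (h x ^+ 2 - 2 * m * h x) + m ^+ 2 * expR (- H x))).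
    by move=> x; ring.
  apply: rintD; last exact: rintZ.
  apply: (@rint_smooth_cs _ M); first by smth.
  apply: supp_inMl => x Mx; rewrite hM//; ring.
exists m; split => //.
have shm : smooth (fun x => (h x - m) ^+ 2) by smth.
have sgh : smooth (fun x => \sum_a partial h a x ^+ 2) by smth.
have mhm := continuous_measurable_rV (smooth_continuous shm).
have mgh := continuous_measurable_rV (smooth_continuous sgh).
have i1 : rint nu (fun x => (h x - m) ^+ 2).
  apply/(rint_density mw w0 nuE) => //.
  by apply: eq_rint (rintZ c eh) => x; rewrite /w; ring.
have eg : rint lam (fun x => expR (- H x) * \sum_a partial h a x ^+ 2).
  apply: (@rint_smooth_cs _ M); first by smth.
  apply: supp_inMl => x Mx; rewrite big1// => a _; rewrite (supp_in_partial a hM Mx) expr0n//.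
have i2 : rint nu (fun x => \sum_a partial h a x ^+ 2).
  apply/(rint_density mw w0 nuE) => //.
  by apply: eq_rint (rintZ c eg) => x; rewrite /w; ring.
have gE x : enorm (gradient h x) ^+ 2 = \sum_a partial h a x ^+ 2.
  rewrite /enorm sqr_sqrtr /dotv; last by apply: sumr_ge0 => a _; rewrite -expr2 sqr_ge0.
  by apply: eq_bigr => a _; rewrite !mxE expr2.
move: PI; rewrite IntE//.
rewrite (_ : (\int[nu]_x _)%E = (\int[nu]_x (\sum_a partial h a x ^+ 2))%:E); last first.
  by rewrite -IntE//; apply: eq_integral => x _; rewrite gE.
rewrite -EFinM lee_fin !(Int_density mw w0 nuE)//.
have -> : \int[lam]_x ((h x - m) ^+ 2 * w x) = c * \int[lam]_x (expR (- H x) * (h x - m) ^+ 2).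
  by rewrite -IntZ//; apply: eq_Int => x; rewrite /w; ring.
have -> : \int[lam]_x ((\sum_a partial h a x ^+ 2) * w x) =
    c * \int[lam]_x (expR (- H x) * \sum_a partial h a x ^+ 2).
  by rewrite -IntZ//; apply: eq_Int => x; rewrite /w; ring.
by rewrite mulrCA ler_pM2l// mulrC ler_pdivlMr// mulrC.
Qed.

(* The divergence of e^-H eta^2 (h - m) grad u integrates to 0; what remains is AM-GM
   between (h - m) and the last integrand.  [h] stands for a compactly supported
   modification of [u] away from the support of [eta]. *)
Lemma poincare_cutoff H u h eta M M' rho (nu : probability 'rV[R]_n R) :
  smooth H -> smooth u -> smooth h -> smooth eta -> supp_in eta M -> supp_in h M' ->
  (forall x, 0 <= eta x <= 1) ->
  (forall a x, eta x * partial h a x = eta x * partial u a x) ->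
  0 < rho -> gibbs H nu -> poincare rho nu ->
  2 * (\int[lam]_x (expR (- H x) * (eta x ^+ 2 * \sum_a partial u a x ^+ 2))) <=
  \int[lam]_x (expR (- H x) * \sum_a partial h a x ^+ 2) +
  rho^-1 * \int[lam]_x (expR (- H x) *
    (eta x * lap xpredT H u x + 2 * \sum_a partial eta a x * partial u a x) ^+ 2).
Proof.
move=> sH su sh se eM hM e01 he r0 gH PI.
have [m [im Pm]] := poincare_smooth sH sh hM r0 gH PI.
pose Q x := eta x * lap xpredT H u x + 2 * \sum_a partial eta a x * partial u a x.
have sL := smooth_lap xpredT sH su.
have sQ : smooth Q by rewrite /Q; smth.
have QM : supp_in Q M.
  move=> x Mx; rewrite /Q eM// mul0r add0r big1 ?mulr0// => a _.
  by rewrite (supp_in_partial a eM) ?mul0r.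
pose Psi a x := expR (- H x) * (eta x ^+ 2 * (partial u a x * (h x - m))).
have sPsi a : smooth (Psi a) by rewrite /Psi; smth.
have PsiM a : supp_in (Psi a) M.
  by move=> x Mx; rewrite /Psi eM// expr0n/= mul0r mulr0.
have [Di D0] := Int_div xpredT sPsi PsiM.
have dPsi a x : partial (Psi a) a x = expR (- H x) *
    ((h x - m) * eta x * (eta x * (partial (partial u a) a x - partial H a x * partial u a x)
      + 2 * (partial eta a x * partial u a x)) + eta x ^+ 2 * partial u a x ^+ 2).
  (* The product rule produces grad u . grad h; on the support of [eta] it is the square of grad u
     by [he]. *)
  have -> : eta x ^+ 2 * partial u a x ^+ 2 = eta x * partial u a x * (eta x * partial h a x).
    by rewrite he; ring.
  have D g : smooth g -> differentiable g x by move=> sg; exact: smooth_differentiable.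
  rewrite /Psi partialM; [|apply: D; smth|apply: D; smth].
  rewrite partial_expRN// partialM; [|apply: D; smth|apply: D; smth].
  rewrite [partial (fun y => partial u a y * (h y - m)) a x]partialM; [|apply: D; smth|apply: D; smth].
  rewrite [partial (fun y => h y - m) a x]partialD; [|apply: D; smth|apply: D; smth].
  rewrite partial_cst.
  have -> : partial (fun y => eta y ^+ 2) a x = 2 * (eta x * partial eta a x).
    have -> : (fun y => eta y ^+ 2) = (fun y => eta y * eta y) by apply/funext => y; rewrite expr2.
    by rewrite partialM; [ring|apply: D; smth|apply: D; smth].
  ring.
have dE x : \sum_a partial (Psi a) a x =
    expR (- H x) * ((h x - m) * eta x * Q x + eta x ^+ 2 * \sum_a partial u a x ^+ 2).
  rewrite (eq_bigr _ (fun a _ => dPsi a x)) -mulr_sumr big_split/= -mulr_sumr -mulr_sumr.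
  by rewrite big_split/= -mulr_sumr -mulr_sumr.
have iu : rint lam (fun x => expR (- H x) * (eta x ^+ 2 * \sum_a partial u a x ^+ 2)).
  apply: (@rint_smooth_cs _ M); first by smth.
  by apply: supp_inMl; apply: supp_inMr => x Mx; rewrite eM// expr0n.
have iQ : rint lam (fun x => expR (- H x) * Q x ^+ 2).
  apply: (@rint_smooth_cs _ M); first by smth.
  by apply: supp_inMl => x Mx; rewrite QM// expr0n.
apply: le_trans (lerD Pm (lexx _)).
rewrite -[X in _ <= _ + rho^-1 * X]/(\int[lam]_x (expR (- H x) * Q x ^+ 2)).
have -> : 2 * \int[lam]_x (expR (- H x) * (eta x ^+ 2 * \sum_a partial u a x ^+ 2)) =
    \int[lam]_x (2 * (expR (- H x) * (eta x ^+ 2 * \sum_a partial u a x ^+ 2)) -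
      2 * \sum_a partial (Psi a) a x).
  rewrite IntB; [|exact: rintZ iu|exact: rintZ Di].
  by rewrite (IntZ 2 iu) (IntZ 2 Di) D0 mulr0 subr0.
rewrite -(IntZ rho im) -(IntZ rho^-1 iQ) -IntD; [|exact: rintZ|exact: rintZ].
apply: le_Int; [by apply: rintB; exact: rintZ|by apply: rintD; exact: rintZ|] => x.
rewrite dE; have /andP[e0 e1] := e01 x; have ex := expR_gt0 (- H x).
move: (expR (- H x)) ex (\sum_a _) (Q x) (h x - m) (eta x) e0 e1 => E E0 S q d e e0 e1.
rewrite -subr_ge0.
(* The difference of the two integrands: the bound [eta <= 1] makes the first term nonnegative, and
   the second is the completed square of the AM-GM step. *)
have -> : rho * (E * d ^+ 2) + rho^-1 * (E * q ^+ 2) -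
  (2 * (E * (e ^+ 2 * S)) - 2 * (E * (d * e * q + e ^+ 2 * S))) =
  E * (rho * d ^+ 2 * (1 - e ^+ 2) + rho^-1 * (rho * d * e + q) ^+ 2).
  by field; rewrite gt_eqF.
apply: mulr_ge0; first exact: ltW.
apply: addr_ge0; last by rewrite mulr_ge0 ?sqr_ge0// invr_ge0 ltW.
apply: mulr_ge0; first by rewrite mulr_ge0 ?sqr_ge0// ltW.
by rewrite subr_ge0 expr_le1.
Qed.

End divergence.

(** * Integration along fibres *)

Section fibre.
Context {R : realType} {n m : nat}.
Variable A : 'M[R]_(m, n).

Lemma measurable_mulmxr p k (B : 'M[R]_(p, k)) : measurable_fun setT (fun y : 'rV[R]_p => y *m B).
Proof.
apply: measurable_fun_rV => j; apply: continuous_measurable_rV.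
rewrite (_ : (fun _ => _) = fun y : 'rV[R]_p => \sum_i y ord0 i * B i j).
  by apply: smooth_continuous; smth.
by apply/funext => y; rewrite mxE.
Qed.

Lemma measurable_fibre : measurable_fun setT (fun p : 'rV[R]_n * 'rV[R]_m => p.1 + p.2 *m A).
Proof.
have mg : measurable_fun setT (fun p : 'rV[R]_n * 'rV[R]_m => (p.1, p.2 *m A)).
  apply: measurable_fun_pair => /=; first exact: measurable_fst.
  exact: (measurableT_comp (measurable_mulmxr A) measurable_snd).
exact: (measurableT_comp measurable_add2 mg).
Qed.

End fibre.

Section fibre_integral.
Context {R : realType} {n m : nat}.
Variables (A : 'M[R]_(m, n)) (P : 'M[R]_(n, m)).
Hypotheses (AP : A *m P = 1%:M) (P1 : forall z : 'rV[R]_n, `|z *m P| <= `|z|).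
Local Notation lamn := (lebesgue_rV n).
Local Notation lamm := (lebesgue_rV m).

Let q : 'rV[R]_m -> R := cube_bump 1.
Let sq : smooth q. Proof. exact: cube_bump_smooth. Qed.
Let q0 y : 0 <= q y. Proof. exact: cube_bump_ge0. Qed.
Let q1 : supp_in q 1. Proof. exact: cube_bump_supp. Qed.
Let qi : rint lamm q. Proof. exact: rint_smooth_cs sq q1. Qed.
Let C := \int[lamm]_y q y.
Let C0 : 0 < C. Proof. exact: cube_bump_int_gt0. Qed.
Let mq : measurable_fun setT q.
Proof. exact: continuous_measurable_rV (smooth_continuous sq). Qed.

Let qN y : q (- y) = q y.
Proof.
rewrite /q /cube_bump; apply: eq_bigr => j _.
by rewrite !mxE opprK mulrC.
Qed.

Let qC a : \int[lamm]_y q (a - y) = C.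
Proof.
transitivity (\int[lamm]_y q (y - a)).
  by apply: eq_Int => y; rewrite -qN opprB.
exact: (Rintegral_translation (- a) mq).
Qed.

Let mqP : measurable_fun setT (fun p : 'rV[R]_n * 'rV[R]_m => q (p.1 *m P - p.2)).
Proof.
have mN : measurable_fun setT (fun p : 'rV[R]_n * 'rV[R]_m => - p.2).
  apply: measurable_fun_rV => j.
  rewrite (_ : (fun _ => _) = fun t : 'rV[R]_n * 'rV[R]_m => - (t.2 ord0 j)).
    by apply: measurableT_comp => //; exact: (measurableT_comp (measurable_coord j) measurable_snd).
  by apply/funext => t; rewrite mxE.
have mg : measurable_fun setT (fun p : 'rV[R]_n * 'rV[R]_m => (p.1 *m P, - p.2)).
  apply: measurable_fun_pair => //=.
  exact: (measurableT_comp (measurable_mulmxr P) measurable_fst).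
exact: (measurableT_comp mq (measurableT_comp measurable_add2 mg)).
Qed.

(** Translating by [y *m A] turns [V (x + y *m A) * q (x *m P)] into [V x * q (x *m P - y)], whose
    double integral is [C] times that of [V]. The weight [q] keeps it finite: without it each fibre
    would be counted once for each of its base points. *)
Lemma fibre_average (V : 'rV[R]_n -> R) : measurable_fun setT V -> (forall x, 0 <= V x) ->
  rint lamn V ->
  {ae lamn, forall x, q (x *m P) != 0 -> rint lamm (fun y => V (x + y *m A))}.
Proof.
move=> mV V0 Vi.
pose f (p : 'rV[R]_n * 'rV[R]_m) := (V (p.1 + p.2 *m A) * q (p.1 *m P))%:E.
have mf : measurable_fun setT f.
  apply/measurable_EFinP; apply: measurable_funM.
    exact: (measurableT_comp mV (measurable_fibre A)).
  exact: (measurableT_comp mq (measurableT_comp (measurable_mulmxr P) measurable_fst)).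
have f0 p : (0 <= f p)%E by rewrite lee_fin mulr_ge0.
pose g (p : 'rV[R]_n * 'rV[R]_m) := (V p.1 * q (p.1 *m P - p.2))%:E.
have mg : measurable_fun setT g.
  by apply/measurable_EFinP; apply: measurable_funM => //; exact: (measurableT_comp mV measurable_fst).
have g0 p : (0 <= g p)%E by rewrite lee_fin mulr_ge0.
have I1 : (\int[lamn]_x \int[lamm]_y f (x, y) < +oo)%E.
  rewrite (fubini_tonelli f mf f0).
  rewrite (_ : (\int[lamm]_y _)%E = (\int[lamm]_y \int[lamn]_x g (x, y))%E); last first.
    apply: eq_integral => y _.
    rewrite -(@ge0_integral_translation _ _ (y *m A) (fun x => g (x, y))).
    - apply: eq_integral => x _; rewrite /f /g/= mulmxDl -[y *m A *m P]mulmxA AP mulmx1 addrK.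
      by [].
    - exact: (measurableT_comp mg (measurable_pair2 _)).
    - by move=> x; exact: g0.
  rewrite -(fubini_tonelli g mg g0).
  rewrite (_ : (\int[lamn]_x _)%E = (\int[lamn]_x (C * V x)%:E)%E).
    by rewrite IntE; [rewrite ltry|exact: rintZ].
  apply: eq_integral => x _; rewrite /g/=.
  rewrite (_ : (fun y => _) = (fun y => (V x * q (x *m P - y))%:E))//.
  have i1 : rint lamm (fun y => q (x *m P - y)).
    have := integrable_translation (- (x *m P)) qi; apply: eq_rint => y.
    by rewrite -qN opprB.
  rewrite IntE; last exact: rintZ.
  by rewrite IntZ// qC mulrC.
have mF : measurable_fun setT (fubini_F lamm f) by exact: measurable_fun_fubini_tonelli_F.
have F0 x : (0 <= fubini_F lamm f x)%E by apply: integral_ge0.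
have Fi : lamn.-integrable setT (fubini_F lamm f).
  apply/integrableP; split => //.
  by under eq_integral => x _ do rewrite gee0_abs//.
have := integrable_ae measurableT Fi; apply: filterS => x /(_ I) /= fx qx.
have qx0 : 0 < q (x *m P) by rewrite lt_neqAle eq_sym qx q0.
have mVx : measurable_fun setT (fun y => V (x + y *m A)).
  exact: (measurableT_comp (measurableT_comp mV (measurable_fibre A)) (measurable_pair1 x)).
have : rint lamm (fun y => q (x *m P) * V (x + y *m A)).
  apply/integrableP; split.
    by apply/measurable_EFinP; exact: measurable_funM.
  move: fx; rewrite ge0_fin_numE// /fubini_F; congr (_ < _)%E.
  by apply: eq_integral => y _; rewrite /f/= ger0_norm ?mulr_ge0// mulrC.
move=> /(rintZ (q (x *m P))^-1); apply: eq_rint => y.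
by rewrite mulrA mulVf// mul1r.
Qed.

(* \int F is a multiple of the average over y of \int q (x *m P) F (x + y *m A) dx, by
   translation invariance; [V] is integrable on almost every fibre only. *)
Lemma fibre_Int_ge0 (V F : 'rV[R]_n -> R) M : measurable_fun setT V -> (forall x, 0 <= V x) ->
  rint lamn V -> continuous F -> supp_in F M ->
  (forall x, rint lamm (fun y => V (x + y *m A)) -> 0 <= \int[lamm]_y F (x + y *m A)) ->
  0 <= \int[lamn]_x F x.
Proof.
move=> mV V0 Vi cF FM FP.
have mF := continuous_measurable_rV cF.
have Fi := integrable_cs cF FM.
have [Cq Cq0 qb] := cont_supp_bounded (smooth_continuous sq) q1.
pose f2 x y := F x * q (x *m P - y).
pose f x y := F (x + y *m A) * q (x *m P).
(* [f2 x y] vanishes unless [|x| <= M] and [x *m P] is within 1 of [y]; since [P] does not increase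
   the norm, [y] is confined to this ball. *)
pose h y := Cq * (\int[lamn]_x `|F x|) * \1_(cball (`|M| + 1) : set 'rV[R]_m) y.
have hi : rint lamm h by apply: rintZ; exact: rint_indic_cball.
have mqy y : measurable_fun setT (fun x => q (x *m P - y)).
  exact: (measurableT_comp mqP (measurable_pair2 y)).
have f2y y : rint lamn (f2^~ y).
  apply: (@le_rint _ _ _ _ _ (fun x => Cq * `|F x|)).
  - exact: measurable_funM.
  - by move=> x; rewrite /f2 normrM mulrC ler_wpM2r.
  - by apply: rintZ; exact: rint_norm.
have f2x x : rint lamm (f2 x).
  apply: rintZ; have := integrable_translation (- (x *m P)) qi; apply: eq_rint => y.
  by rewrite -qN opprB.
have f2h y : \int[lamn]_x `|f2 x y| <= h y.
  rewrite /h indicE; have [yM|yM] := boolP (y \in _).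
    rewrite mulr1 -IntZ; last exact: rint_norm.
    apply: le_Int; [exact: rint_norm|by apply: rintZ; exact: rint_norm|] => x.
    by rewrite /f2 normrM mulrC ler_wpM2r.
  rewrite mulr0 (eq_Int _ (g := fun=> 0)) ?Int0// => x.
  have [xM|xM] := leP `|x| M; last by rewrite /f2 FM ?mul0r ?normr0.
  rewrite /f2 q1 ?mulr0 ?normr0//.
  have yM' : `|M| + 1 < `|y| by rewrite ltNge; apply: contra yM; rewrite inE.
  have : `|y| <= `|x *m P - y| + `|x *m P|.
    by rewrite [`|x *m P - y|]distrC; apply: le_trans (ler_normD _ _); rewrite subrK.
  have := P1 x; have := ler_norm M; clear -xM yM'.
  by move: (`|x *m P|) (`|x *m P - y|) (`|x|) (`|M|) (`|y|) xM yM' => *; lra.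
have fE y : \int[lamn]_x f x y = \int[lamn]_x f2 x y.
  rewrite -(@Rintegral_translation _ _ (y *m A) (f2^~ y)).
    by apply: eq_Int => x; rewrite /f /f2 mulmxDl -[y *m A *m P]mulmxA AP mulmx1 addrK.
  exact: rint_measurable (f2y y).
have fy y : rint lamn (f^~ y).
  have := integrable_translation (y *m A) (f2y y); apply: eq_rint => x.
  by rewrite /f /f2 mulmxDl -[y *m A *m P]mulmxA AP mulmx1 addrK.
have Fx x : rint lamm (fun y => F (x + y *m A)).
  apply: (@integrable_cs _ _ _ (`|M| + `|x *m P|)).
    move=> y; apply: (@continuous_comp _ _ _ (fun y : 'rV[R]_m => x + y *m A) F); last exact: cF.
    exact: (differentiable_continuous (differentiable_affine x A y)).
  move=> y My; apply: FM.
  have : `|y| <= `|(x + y *m A) *m P| + `|x *m P|.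
    rewrite mulmxDl -[y *m A *m P]mulmxA AP mulmx1.
    by apply: le_trans (ler_normB _ _); rewrite addrAC subrr add0r.
  have := P1 (x + y *m A); have := ler_norm M; clear -My.
  by move: (`|x *m P|) (`|(x + y *m A) *m P|) (`|x + y *m A|) (`|M|) (`|y|) My => *; lra.
have fx x : rint lamm (f x).
  by apply: eq_rint (rintZ (q (x *m P)) (Fx x)) => y; rewrite /f mulrC.
have [_ _ E2] : [/\ rint lamn (fun x => \int[lamm]_y f2 x y), rint lamm (fun y => \int[lamn]_x f2 x y) &
    \int[lamn]_x (\int[lamm]_y f2 x y) = \int[lamm]_y (\int[lamn]_x f2 x y)].
  apply: (Int_fubini _ f2y f2x hi f2h).
  by apply: measurable_funM => //; exact: (measurableT_comp mF measurable_fst).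
have [Ti _ E1] : [/\ rint lamn (fun x => \int[lamm]_y f x y), rint lamm (fun y => \int[lamn]_x f x y) &
    \int[lamn]_x (\int[lamm]_y f x y) = \int[lamm]_y (\int[lamn]_x f x y)].
  apply: (Int_fubini _ fy fx hi).
    apply: measurable_funM.
      exact: (measurableT_comp mF (measurable_fibre A)).
    exact: (measurableT_comp mq (measurableT_comp (measurable_mulmxr P) measurable_fst)).
  move=> y; apply: le_trans (f2h y); rewrite le_eqVlt; apply/orP; left; apply/eqP.
  rewrite -(@Rintegral_translation _ _ (y *m A) (fun x => `|f2 x y|)).
    by apply: eq_Int => x; rewrite /f /f2 mulmxDl -[y *m A *m P]mulmxA AP mulmx1 addrK.
  by apply: measurableT_comp => //; exact: rint_measurable (f2y y).
rewrite -(pmulr_rge0 _ C0) -IntZ//.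
have -> : \int[lamn]_x (C * F x) = \int[lamn]_x (\int[lamm]_y f x y).
  rewrite E1 (eq_Int _ fE) -E2; apply: eq_Int => x.
  rewrite /f2 IntZ ?qC 1?mulrC//.
  have := integrable_translation (- (x *m P)) qi; apply: eq_rint => y.
  by rewrite -qN opprB.
pose T x := \int[lamm]_y f x y.
(* [T x] carries the factor [q (x *m P)]. Where this factor is nonzero, [fibre_average] makes [V]
   integrable on the fibre for almost every [x], and [FP] gives the sign of [T x]. *)
have Tae : ae_eq lamn setT (EFin \o T) (EFin \o (fun x => `|T x|)).
  have := fibre_average mV V0 Vi; apply: filterS => x /= xV _.
  congr EFin; rewrite ger0_norm// /T.
  have -> : \int[lamm]_y f x y = q (x *m P) * \int[lamm]_y F (x + y *m A).
    by rewrite -IntZ//; apply: eq_Int => y; rewrite /f mulrC.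
  by have [->|qx] := eqVneq (q (x *m P)) 0; [rewrite mul0r|rewrite mulr_ge0//; apply: FP; exact: xV].
have -> : \int[lamn]_x T x = \int[lamn]_x `|T x|.
  rewrite /Rintegral; congr fine; apply: ae_eq_integral => //.
    exact: measurable_int Ti.
  exact: measurable_int (rint_norm Ti).
exact: Int_ge0.
Qed.

End fibre_integral.

#[local] Opaque partial.

(** * The Bochner inequality for a block *)

Section row.
Context {R : realType} {n : nat}.
Local Notation lam := (lebesgue_rV n).
Implicit Types f g H u eta : 'rV[R]_n -> R.

Lemma partial_sqr f a x : smooth f -> partial (fun y => f y ^+ 2) a x = 2 * (f x * partial f a x).
Proof.
move=> sf; have -> : (fun y => f y ^+ 2) = (fun y => f y * f y).
  by apply/funext => y; rewrite expr2.
by rewrite partialM; [ring|exact: smooth_differentiable|exact: smooth_differentiable].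
Qed.

Lemma partial_lap (P : pred 'I_n) H u a x : smooth H -> smooth u ->
  partial (lap P H u) a x = \sum_(b | P b) (partial (partial (partial u b) a) b x -
    (partial (partial H b) a x * partial u b x + partial H b x * partial (partial u b) a x)).
Proof.
move=> sH su; rewrite /lap partial_sum; last by move=> b _; smth.
apply: eq_bigr => b _.
have D k : smooth k -> differentiable k x by move=> sk; exact: smooth_differentiable.
rewrite partialD; [|apply: D; smth|apply: D; smth].
rewrite partialN; [|apply: D; smth].
rewrite partialM; [|apply: D; smth|apply: D; smth].
have C := partialC b a x (smooth_partial b su).
have alg (c1 c2 c3 c4 c5 c6 : R) : c1 = c2 -> c1 - (c3 * c4 + c5 * c6) = c2 - (c6 * c5 + c3 * c4).
  by move=> ->; ring.
exact: alg C.
Qed.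

(* Writing D_a v = \partial_a v - \partial_a H v, this exchanges D_a and \partial_b in the
   products D_a (\partial_a u) D_b (\partial_b u); the commutator is \partial_a \partial_b H. *)
Lemma row_pointwise (P : pred 'I_n) H u f eta (m0 : R) x :
  smooth H -> smooth u -> smooth f -> smooth eta ->
  let w y := expR (- H y) in
  let g := lap P H u in
  let K y := (f y - m0) + lap (predC P) H u y in
  let q := 2 * \sum_(a | P a) partial eta a x * partial u a x in
  let s a b := partial (partial u b) a x in
  \sum_(a | P a) partial (fun y => w y * (eta y ^+ 2 * (partial u a y * K y))) a x -
  \sum_(b | ~~ P b) partial (fun y => \sum_(a | P a) w y * (eta y ^+ 2 *
    (partial u a y * partial (partial u b) a y))) b x =
  w x * (eta x ^+ 2 * g x * K x + eta x * q * K x +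
    eta x ^+ 2 * (\sum_(a | P a) partial u a x * partial f a x) +
    \sum_(a | P a) \sum_(b | ~~ P b)
      (- (eta x ^+ 2 * (partial (partial H b) a x * (partial u a x * partial u b x)))
       - 2 * (eta x * partial eta b x * partial u a x * s a b) - eta x ^+ 2 * s a b ^+ 2)).
Proof.
move=> sH su sf se w g K q s.
have D k : smooth k -> differentiable k x by move=> sk; exact: smooth_differentiable.
have sw : smooth w by rewrite /w; smth.
have sL := smooth_lap (predC P) sH su.
have sK : smooth K by rewrite /K; smth.
have dw a : partial w a x = - (w x * partial H a x) by rewrite partial_expRN.
have dK a : partial K a x = partial f a x + \sum_(b | ~~ P b) (partial (partial (partial u b) a) b x -
    (partial (partial H b) a x * partial u b x + partial H b x * s a b)).
  rewrite /K partialD; [|apply: D; smth|apply: D; smth].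
  rewrite partialD; [|apply: D; smth|apply: D; smth].
  by rewrite partial_cst addr0 partial_lap.
have E1 a : partial (fun y => w y * (eta y ^+ 2 * (partial u a y * K y))) a x =
    w x * eta x ^+ 2 * K x * (partial (partial u a) a x - partial H a x * partial u a x) +
    w x * eta x * K x * 2 * (partial eta a x * partial u a x) +
    w x * eta x ^+ 2 * (partial u a x * partial f a x) +
    \sum_(b | ~~ P b) w x * eta x ^+ 2 * partial u a x * (partial (partial (partial u b) a) b x -
    (partial (partial H b) a x * partial u b x + partial H b x * s a b)).
  rewrite partialM; [|apply: D; smth|apply: D; smth].
  rewrite partialM; [|apply: D; smth|apply: D; smth].
  rewrite [partial (fun y => partial u a y * K y) a x]partialM; [|apply: D; smth|apply: D; smth].
  rewrite partial_sqr// dw dK -mulr_sumr; ring.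
have E2 b : partial (fun y => \sum_(a | P a) w y * (eta y ^+ 2 *
    (partial u a y * partial (partial u b) a y))) b x =
    \sum_(a | P a) (w x * eta x ^+ 2 * partial u a x * (partial (partial (partial u b) a) b x -
      partial H b x * s a b) + w x * (2 * (eta x * partial eta b x * partial u a x * s a b)
      + eta x ^+ 2 * s a b ^+ 2)).
  rewrite partial_sum; last by move=> a _; smth.
  apply: eq_bigr => a _.
  rewrite partialM; [|apply: D; smth|apply: D; smth].
  rewrite partialM; [|apply: D; smth|apply: D; smth].
  rewrite [partial (fun y => partial u a y * _) b x]partialM; [|apply: D; smth|apply: D; smth].
  rewrite partial_sqr// dw (partialC a b x su) /s.
  move: (partial (partial (partial u b) a) b x) (partial (partial u b) a x) => c1 c2.
  move: (partial u a x) (partial H b x) (partial eta b x) (w x) (eta x) => c3 c4 c5 c6 c7; ring.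
(* The third derivatives in [E1] and [E2] have the same coefficient and cancel, as do the products
   of [partial H b x] with [s a b]; the mixed derivative of [H] remains. *)
rewrite (eq_bigr _ (fun a _ => E1 a)) (eq_bigr _ (fun b _ => E2 b)) exchange_big/=.
rewrite big_split/= -addrA -sumrB big_split/= big_split/=.
rewrite -mulr_sumr -mulr_sumr -mulr_sumr.
have -> : \sum_(a | P a) (\sum_(b | ~~ P b) w x * eta x ^+ 2 * partial u a x *
      (partial (partial (partial u b) a) b x -
        (partial (partial H b) a x * partial u b x + partial H b x * s a b)) -
    \sum_(b | ~~ P b) (w x * eta x ^+ 2 * partial u a x *
        (partial (partial (partial u b) a) b x - partial H b x * s a b) +
        w x * (2 * (eta x * partial eta b x * partial u a x * s a b) + eta x ^+ 2 * s a b ^+ 2))) =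
  w x * \sum_(a | P a) \sum_(b | ~~ P b)
      (- (eta x ^+ 2 * (partial (partial H b) a x * (partial u a x * partial u b x)))
       - 2 * (eta x * partial eta b x * partial u a x * s a b) - eta x ^+ 2 * s a b ^+ 2).
  rewrite mulr_sumr; apply: eq_bigr => a Pa.
  rewrite -sumrB mulr_sumr; apply: eq_bigr => b Pb.
  move: (s a b) (partial (partial (partial u b) a) b x) (partial (partial H b) a x).
  move: (partial u a x) (partial u b x) (partial H b x) (partial eta b x) => c1 c2 c3 c4 c5 c6 c7; ring.
rewrite -/q -[\sum_(i < n | P i) (partial (partial u i) i x - _)]/(g x).
rewrite /q; move: (\sum_(i < n | P i) partial eta i x * partial u i x) (g x) (K x).
move: (\sum_(i < n | P i) partial u i x * partial f i x) => c1 c2 c3 c4.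
rewrite [in RHS]mulrDr; congr (_ + _).
by move: (w x) (eta x) => c6 c7; ring.
Qed.

(** Completing the square in [e * s] absorbs the mixed second derivative [s] of the solution, for
    which no bound is available, at the cost of a term in the gradient of the cutoff. *)
Let cross_le (e de h s va vb : R) :
  - (e ^+ 2 * (h * (va * vb))) - 2 * (e * de * va * s) - e ^+ 2 * s ^+ 2 <=
  - (e ^+ 2 * (h * (va * vb))) + de ^+ 2 * va ^+ 2.
Proof. by have := sqr_ge0 (e * s + de * va); lra. Qed.

Let collect_le (e g r q S1 T1 T2 T3 : R) : T1 <= - (e ^+ 2 * T2) + T3 ->
  (e * g) ^+ 2 + e * g * (e * r + q) + e * r * q +
    (e ^+ 2 * g * (- r - g) + e * q * (- r - g) + e ^+ 2 * S1 + T1) <=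
  e ^+ 2 * S1 - e ^+ 2 * T2 + T3.
Proof. by move=> ?; lra. Qed.

(** The two divergences of [row_pointwise] integrate to 0 and may be added to the left side. By
    definition of the residual [r], the function [K] is - r - g, so that the product of [g] with [K]
    supplies - g^2 - g r. *)
Lemma row_inequality (P : pred 'I_n) H u f eta (m0 : R) M (g r q : 'rV[R]_n -> R) :
  smooth H -> smooth u -> smooth f -> smooth eta -> supp_in eta M ->
  g = lap P H u -> r = (fun x => - lap xpredT H u x - (f x - m0)) ->
  q = (fun x => 2 * \sum_(a | P a) partial eta a x * partial u a x) ->
  \int[lam]_x (expR (- H x) * ((eta x * g x) ^+ 2 + eta x * g x * (eta x * r x + q x) + eta x * r x * q x)) <=
  \int[lam]_x (expR (- H x) * (eta x ^+ 2 * (\sum_(a | P a) partial u a x * partial f a x) -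
    eta x ^+ 2 * (\sum_(a | P a) \sum_(b | ~~ P b)
      partial (partial H b) a x * (partial u a x * partial u b x)) +
    \sum_(a | P a) \sum_(b | ~~ P b) partial eta b x ^+ 2 * partial u a x ^+ 2)).
Proof.
move=> sH su sf se eM gE rE qE.
have sT := smooth_lap xpredT sH su; have sg : smooth g by rewrite gE; exact: smooth_lap.
have sC := smooth_lap (predC P) sH su.
pose K y := (f y - m0) + lap (predC P) H u y.
have sK : smooth K by rewrite /K; smth.
have sr : smooth r by rewrite rE; smth.
have sq : smooth q by rewrite qE; smth.
have qM : supp_in q M.
  by move=> x Mx; rewrite qE big1 ?mulr0// => a _; rewrite (supp_in_partial a eM) ?mul0r.
pose Psi1 a y := expR (- H y) * (eta y ^+ 2 * (partial u a y * K y)).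
pose Psi2 b y := \sum_(a | P a) expR (- H y) * (eta y ^+ 2 * (partial u a y * partial (partial u b) a y)).
have s1 a : smooth (Psi1 a) by rewrite /Psi1; smth.
have s2 a : smooth (Psi2 a) by rewrite /Psi2; smth.
have M1 a : supp_in (Psi1 a) M by move=> x Mx; rewrite /Psi1 eM// expr0n/= mul0r mulr0.
have M2 a : supp_in (Psi2 a) M.
  by move=> x Mx; rewrite /Psi2 big1// => b _; rewrite eM// expr0n/= mul0r mulr0.
have [i1 z1] := Int_div P s1 M1; have [i2 z2] := Int_div (predC P) s2 M2.
set L := fun x => expR (- H x) * _; set Rr := fun x => expR (- H x) * (_ - _ + _).
have iL : rint lam L.
  apply: (@rint_smooth_cs _ _ _ M); first by rewrite /L; smth.
  by move=> x Mx; rewrite /L eM// qM//; ring.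
have iR : rint lam Rr.
  apply: (@rint_smooth_cs _ _ _ M).
    rewrite /Rr; smth.
  move=> x Mx; have Z : \sum_(a | P a) \sum_(b | ~~ P b) partial eta b x ^+ 2 * partial u a x ^+ 2 = 0.
    by do 2 (apply: big1 => ? _); rewrite (supp_in_partial _ eM Mx) expr0n mul0r.
  by rewrite /Rr eM// Z; ring.
have -> : \int[lam]_x L x = \int[lam]_x (L x + (\sum_(a | P a) partial (Psi1 a) a x -
    \sum_(b | predC P b) partial (Psi2 b) b x)).
  by rewrite IntD//; [rewrite IntB// z1 z2 subrr addr0|exact: rintB].
apply: le_Int => //; first by apply: rintD => //; exact: rintB.
move=> x; have := row_pointwise P m0 x sH su sf se; rewrite /= => ->.
have KE : K x = - r x - g x.
  rewrite /K rE; have -> : lap xpredT H u x = g x + lap (predC P) H u x.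
    by rewrite gE /lap (bigID P).
  by move: (g x) (lap (predC P) H u x) (f x) => c1 c2 c3; ring.
have qEx : 2 * \sum_(a | P a) partial eta a x * partial u a x = q x by rewrite qE.
rewrite /L /Rr -gE qEx -/(K x) KE -mulrDr ler_wpM2l ?expR_ge0//.
set S1 := \sum_(a | P a) partial u a x * partial f a x.
have S2 : \sum_(a | P a) \sum_(b | ~~ P b)
      (- (eta x ^+ 2 * (partial (partial H b) a x * (partial u a x * partial u b x)))
       - 2 * (eta x * partial eta b x * partial u a x * partial (partial u b) a x)
       - eta x ^+ 2 * partial (partial u b) a x ^+ 2) <=
    - (eta x ^+ 2 * \sum_(a | P a) \sum_(b | ~~ P b) partial (partial H b) a x * (partial u a x * partial u b x))
    + \sum_(a | P a) \sum_(b | ~~ P b) partial eta b x ^+ 2 * partial u a x ^+ 2.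
  rewrite mulr_sumr -sumrN -big_split/=; apply: ler_sum => a Pa.
  rewrite mulr_sumr -sumrN -big_split/=; apply: ler_sum => b Pb.
  exact: cross_le.
exact: collect_le.
Qed.

End row.

(** * The mollified solution *)

Section Lfun2.
Context d (T : measurableType d) (R : realType) (mu : {measure set T -> \bar R}).

Lemma Lfun2P (f : T -> R) :
  f \in Lfun mu 2%:E <-> measurable_fun setT f /\ rint mu (fun x => f x ^+ 2).
Proof.
split=> [fL|[mf fi]].
  split; last exact: Lfun2_integrable_sqr.
  by move: fL; rewrite inE => /andP[]; rewrite inE.
rewrite inE; apply/andP; split; first by rewrite inE.
rewrite inE /= /finite_norm unlock /=; apply: poweR_lty.
rewrite (_ : (\int[mu]_x _)%E = (\int[mu]_x (f x ^+ 2)%:E)%E).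
  by case/integrableP: fi => _; under eq_integral do rewrite /= ger0_norm ?sqr_ge0 //.
by apply: eq_integral => x _ /=; rewrite powR_mulrn // real_normK ?num_real.
Qed.

End Lfun2.

Lemma smooth_measurable {R : realType} {n : nat} (f : 'rV[R]_n -> R) : smooth f -> measurable_fun setT f.
Proof. by move=> sf; apply: continuous_measurable_rV; exact: smooth_continuous. Qed.

Lemma sqr_sum_le {R : realType} (I : finType) (p : I -> R) :
  (\sum_i p i) ^+ 2 <= #|I|%:R * \sum_i p i ^+ 2.
Proof.
rewrite expr2 big_distrlr /=.
apply: (@le_trans _ _ (\sum_i \sum_j (2^-1 * p i ^+ 2 + 2^-1 * p j ^+ 2))).
  by apply: ler_sum => i _; apply: ler_sum => j _; have := sqr_ge0 (p i - p j); lra.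
rewrite (eq_bigr (fun i => #|I|%:R * (2^-1 * p i ^+ 2) + \sum_j 2^-1 * p j ^+ 2)); last first.
  by move=> i _; rewrite big_split /= sumr_const mulr_natl.
rewrite big_split /= sumr_const -!mulr_sumr -[X in _ + X]mulr_natl.
by rewrite [leLHS](_ : _ = #|I|%:R * \sum_i p i ^+ 2) //; field.
Qed.

(** Gathers the commutators of [residualE] under one constant: [p] comes from the source and [q i]
    from the drift in coordinate i. Only the factor [e] has to be kept sharp. *)
Lemma sqr_sub_sum_le {R : realType} (I : finType) (p L e : R) (q r K : I -> R) :
  0 <= e -> 0 <= L -> (forall i, 0 <= K i) -> (forall i, 0 <= r i) ->
  p ^+ 2 <= (L * e) ^+ 2 -> (forall i, q i ^+ 2 <= (K i * e) ^+ 2 * r i) ->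
  (p - \sum_i q i) ^+ 2 <= (2 * (#|I|%:R + 1) * (L + \sum_i K i) * e) ^+ 2 * (1 + \sum_i r i).
Proof.
move=> e0 L0 K0 r0 pL qK; set N : R := #|I|%:R; set S := \sum_i K i.
have N0 : 0 <= N by [].
have S0 : 0 <= S by exact: sumr_ge0.
have r1 : 0 <= \sum_i r i by exact: sumr_ge0.
have q2 : \sum_i q i ^+ 2 <= ((L + S) * e) ^+ 2 * \sum_i r i.
  rewrite mulr_sumr; apply: ler_sum => i _; apply: le_trans (qK i) _.
  rewrite ler_wpM2r // ler_sqr ?nnegrE ?mulr_ge0 ?addr_ge0 // ler_wpM2r //.
  by rewrite /S (bigD1 i) //= addrCA lerDl addr_ge0 // sumr_ge0.
have p2 : p ^+ 2 <= ((L + S) * e) ^+ 2.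
  by apply: le_trans pL _; rewrite ler_sqr ?nnegrE ?mulr_ge0 ?addr_ge0 // ler_wpM2r // lerDl.
have := @sqr_sum_le R I q; rewrite -/N; move: (\sum_i q i) => Q Q2.
apply: (@le_trans _ _ (2 * p ^+ 2 + 2 * Q ^+ 2)).
  by have := sqr_ge0 (p + Q); nra.
apply: (@le_trans _ _ (2 * (N + 1) * (((L + S) * e) ^+ 2 * (1 + \sum_i r i)))).
  move: q2 p2 Q2 r1; move: (\sum_i q i ^+ 2) (\sum_i r i) (((L + S) * e) ^+ 2) => q' r' V q2 p2 Q2 r1.
  have := ler_wpM2l N0 q2; have V0 : 0 <= V by apply: le_trans p2; exact: sqr_ge0.
  have := mulr_ge0 V0 r1; have := mulr_ge0 N0 V0; lra.
rewrite -[2 * (N + 1) * (L + S) * e]mulrA [in leRHS]exprMn -[leRHS]mulrA.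
apply: ler_wpM2r; first by rewrite mulr_ge0 ?sqr_ge0 // addr_ge0.
by rewrite expr2 ler_peMl //; lra.
Qed.

Section mollifier_sequence.
Context {R : realType} {n : nat}.
Implicit Types (F G psi : 'rV[R]_n -> R).
Local Notation lam := (@lebesgue_rV R n).
Variable K : nat -> 'rV[R]_n -> R.
Hypothesis KK : forall j, mollifier (K j) j.+1%:R^-1.

Lemma near_small (L d : R) : 0 <= L -> 0 < d -> \forall j \near \oo, L * j.+1%:R^-1 <= d.
Proof.
move=> L0 d0; have d1 : 0 < d / (L + 1) by rewrite divr_gt0 // ltr_wpDl.
near=> j; have : j.+1%:R^-1 <= d / (L + 1).
  by apply: ltW; near: j; exact: near_infty_natSinv_lt (PosNum d1).
rewrite ler_pdivlMr ?ltr_wpDl// mulrC; apply: le_trans.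
by rewrite ler_wpM2r ?invr_ge0 ?ler0n// lerDl.
Unshelve. all: by end_near. Qed.

Lemma near_convol G psi M d : locint G -> smooth psi -> supp_in psi M -> 0 < d ->
  \forall j \near \oo, `|\int[lam]_x (convol G (K j) x * psi x) - \int[lam]_x (G x * psi x)| <= d.
Proof.
move=> lG sp pM d0; have [C C0 pC] := partial_bounded sp pM.
pose L := n%:R * C; have L0 : 0 <= L by rewrite mulr_ge0.
have lip x h : `|psi (x + h) - psi x| <= L * `|h|.
  have := @lipschitz_rV _ _ psi C x h (smooth_differentiable sp) pC.
  by rewrite [`|h| * C]mulrC mulrA.
set B := \int[lam]_x (`|G x| * \1_(cball (`|M| + 1)) x).
have B0 : 0 <= B by apply: Int_ge0 => x; rewrite mulr_ge0.
near=> j.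
have e1 : j.+1%:R^-1 <= 1 :> R by rewrite invf_le1 ?ler1n // ltr0Sn.
have e0 : 0 <= j.+1%:R^-1 :> R by rewrite invr_ge0.
have [_] := convol_weak (KK j) lG sp pM e1 e0 L0 lip.
move=> /le_trans; apply; rewrite mulrAC.
by near: j; apply: near_small => //; exact: mulr_ge0.
Unshelve. all: by end_near. Qed.

(** Jensen reduces to the mollification of F^2, which converges weakly. Hence a one-sided bound; the
    matching lower bound comes later from the equation. *)
Lemma near_convol_sqr F psi M d : measurable_fun setT F -> locint (fun x => F x ^+ 2) ->
  smooth psi -> (forall x, 0 <= psi x) -> supp_in psi M -> 0 < d ->
  \forall j \near \oo, \int[lam]_x (convol F (K j) x ^+ 2 * psi x) <= \int[lam]_x (F x ^+ 2 * psi x) + d.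
Proof.
move=> mF lF sp p0 pM d0; near=> j.
have [sk ke _ _] := KK j; have lF1 := locintW mF lF.
have : `|\int[lam]_x (convol (fun x => F x ^+ 2) (K j) x * psi x) - \int[lam]_x (F x ^+ 2 * psi x)| <= d.
  by near: j; exact: near_convol pM _.
move=> /ler_normlW; rewrite lerBlDl; apply: le_trans; apply: le_Int.
- apply: (@rint_smooth_cs _ _ _ M); last exact: supp_inMl.
  by apply: smoothM => //; apply: smoothX; exact: convol_smooth lF1 sk ke.
- apply: (@rint_smooth_cs _ _ _ M); last exact: supp_inMl.
  by apply: smoothM => //; exact: convol_smooth lF sk ke.
- by move=> x; rewrite ler_wpM2r //; exact: (convol_jensen (KK j)).
Unshelve. all: by end_near. Qed.

End mollifier_sequence.

(** * Gibbs measures, the weak equation and its mollification *)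

Section gibbs_measure.
Context {R : realType} {n : nat}.
Implicit Types (f g F : 'rV[R]_n -> R).
Local Notation lam := (@lebesgue_rV R n).
Variables (H : 'rV[R]_n -> R) (mu : probability 'rV[R]_n R) (c : R).
Hypotheses (sH : smooth H) (c0 : 0 < c).
Hypothesis muE : forall A, measurable A ->
  mu A = (\int[lam]_(x in A) (c * expR (- H x))%:E)%E.
Let w x := c * expR (- H x).

Let sw : smooth w.
Proof. by rewrite /w; smth. Qed.

Let mw : measurable_fun setT w.
Proof. by apply: continuous_measurable_rV; exact: smooth_continuous. Qed.

Let w0 x : 0 <= w x.
Proof. by rewrite /w mulr_ge0 ?expR_ge0 // ltW. Qed.

Lemma gibbs_rint f : measurable_fun setT f -> rint mu f <-> rint lam (fun x => f x * (c * expR (- H x))).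
Proof. by move=> mf; exact: (rint_density mw w0 muE mf). Qed.

Lemma gibbs_Int f : measurable_fun setT f ->
  \int[mu]_x f x = \int[lam]_x (f x * (c * expR (- H x))).
Proof. by move=> mf; exact: (Int_density mw w0 muE mf). Qed.

Lemma gibbs_rint_cs f M : continuous f -> supp_in f M -> rint mu f.
Proof.
move=> cf fM; apply/gibbs_rint; first exact: continuous_measurable_rV.
apply: (@integrable_cs _ _ _ M); last exact: supp_inMr.
by move=> x; apply: (@continuousM _ _ f w); [exact: cf|exact: (smooth_continuous sw)].
Qed.

(** The density is bounded away from 0 on balls: dividing by it amounts to multiplying by the
    continuous function c^-1 e^H. *)
Lemma gibbs_locint F : rint mu F -> locint F.
Proof.
move=> Fi; have mF := rint_measurable Fi.
move/gibbs_rint : (Fi) => /(_ mF) Fw.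
have cv : continuous (fun x => c^-1 * expR (H x)).
  by apply: smooth_continuous; smth.
have := locintMl cv; move=> /(_ (fun x => F x * w x)) [].
  split; first exact: measurable_funM.
  by move=> M; apply: (integrableS measurableT) => //; exact: measurable_cball.
move=> _ FM; split => // M.
apply: eq_integrable (FM M); first exact: measurable_cball.
move=> x _ /=; congr EFin; rewrite /w mulrCA mulrA.
rewrite [RHS](_ : _ = F x * (c * c^-1) * (expR (H x) * expR (- H x))); first by ring.
by rewrite -expRD subrr expR0 mulfV ?gt_eqF// !mulr1.
Qed.

(** The classical gradient is a weak gradient because the derivative of [zeta x * psi x] integrates
    to 0. *)
Lemma sobolev1_test zeta M : smooth zeta -> supp_in zeta M -> sobolev1 mu zeta (gradient zeta).
Proof.
move=> sz zM; split.
- apply: (proj2 (Lfun2P _ _)); split; first exact: smooth_measurable.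
  apply: (@gibbs_rint_cs _ M); last exact: supp_inMl.
  by apply: smooth_continuous; exact: smoothX.
- move=> a; rewrite (_ : (fun _ => _) = partial zeta a); last by apply/funext => x; rewrite mxE.
  apply: (proj2 (Lfun2P _ _)); split; first by apply: smooth_measurable; exact: smooth_partial.
  apply: (@gibbs_rint_cs _ M); last by apply: supp_inMl; exact: supp_in_partial.
  by apply: smooth_continuous; apply: smoothX; exact: smooth_partial.
- move=> psi /test_functionP [sp _] a.
  have := @integral_partial R n (fun x => zeta x * psi x) M a (smoothM sz sp) (supp_inMr psi zM).
  have ipE x : partial (fun y => zeta y * psi y) a x = partial zeta a x * psi x + zeta x * partial psi a x.
    rewrite partialM; [|exact: smooth_differentiable|exact: smooth_differentiable].
    by rewrite addrC [X in X + _]mulrC.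
  rewrite (eq_Int _ ipE).
  rewrite IntD.
  - move=> /eqP; rewrite addrC addr_eq0 => /eqP ->; congr (- _).
    by apply: eq_Int => x; rewrite mxE.
  - by apply: (@rint_smooth_cs _ _ _ M); [apply: smoothM => //; exact: smooth_partial
      |apply: supp_inMr; exact: supp_in_partial].
  - by apply: (@rint_smooth_cs _ _ _ M); [apply: smoothM => //; exact: smooth_partial
      |apply: supp_inMr].
Qed.

Section weak_solution.
Variables (f phi : 'rV[R]_n -> R) (dphi : 'rV[R]_n -> 'rV[R]_n).
Hypotheses (sf : smooth f) (phi_H1 : sobolev1 mu phi dphi) (phi_sol : weak_poisson mu f dphi).
Let m := \int[mu]_x f x.

Lemma sobolev1_measurable : measurable_fun setT phi /\ forall a, measurable_fun setT (fun x => dphi x ord0 a).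
Proof. by case: phi_H1 => /Lfun2P [mp _] dL _; split => // a; case/Lfun2P: (dL a). Qed.

Lemma sobolev1_rint : rint mu (fun x => phi x ^+ 2) /\ forall a, rint mu (fun x => dphi x ord0 a ^+ 2).
Proof. by case: phi_H1 => /Lfun2P [_ ip] dL _; split => // a; case/Lfun2P: (dL a). Qed.

Lemma sobolev1_locint2 : locint (fun x => phi x ^+ 2) /\ forall a, locint (fun x => dphi x ord0 a ^+ 2).
Proof. by case: sobolev1_rint => ip id; split => [|a]; exact: gibbs_locint. Qed.

Lemma sobolev1_locint : locint phi /\ forall a, locint (fun x => dphi x ord0 a).
Proof.
case: sobolev1_measurable => mp md; case: sobolev1_locint2 => lp ld.
by split => [|a]; exact: locintW.
Qed.

Lemma weak_poisson_test zeta M : smooth zeta -> supp_in zeta M ->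
  \sum_a \int[lam]_x (partial zeta a x * (dphi x ord0 a * w x)) = \int[lam]_x (zeta x * ((f x - m) * w x)).
Proof.
move=> sz zM; have [_ md] := sobolev1_measurable; have [_ ld] := sobolev1_locint.
have := phi_sol (sobolev1_test sz zM); rewrite -/m.
have mz a : measurable_fun setT (partial zeta a) by apply: smooth_measurable; exact: smooth_partial.
rewrite gibbs_Int; last first.
  by apply: measurable_sum => a; apply: measurable_funM => //; rewrite (_ : (fun _ => _) = partial zeta a) //;
    apply/funext => x; rewrite mxE.
rewrite gibbs_Int; last first.
  apply: measurable_funM; first exact: smooth_measurable.
  by apply: smooth_measurable; apply: smoothB => //; exact: smooth_cst.
move=> eq1; rewrite -Int_sum; last first.
  move=> a _; have [C _ wC] := @cont_supp_bounded _ _ (fun x => partial zeta a x * w x) M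
    (smooth_continuous (smoothM (smooth_partial a sz) sw)) (supp_inMr w (supp_in_partial a zM)).
  apply: (@eq_rint _ _ _ _ (fun x => dphi x ord0 a * (partial zeta a x * w x))) => [x|]; first by ring.
  apply: (@integrable_locintM _ _ _ _ M C) => //.
    by apply: smooth_measurable; apply: smoothM => //; exact: smooth_partial.
  by apply: supp_inMr; exact: supp_in_partial.
transitivity (\int[lam]_x (dotv (gradient zeta x) (dphi x) * (c * expR (- H x)))).
  by apply: eq_Int => x; rewrite /dotv mulr_suml; apply: eq_bigr => a _; rewrite mxE mulrA.
rewrite eq1; apply: eq_Int => x; exact/esym/mulrA.
Qed.

Definition residual (u : 'rV[R]_n -> R) x := - lap xpredT H u x - (f x - m).

Section mollified.
Variables (k : 'rV[R]_n -> R) (e : R).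
Hypothesis kk : mollifier k e.

Lemma mollified_smooth : smooth (convol phi k).
Proof. by case: sobolev1_locint => lp _; case: kk => sk ke _ _; exact: convol_smooth lp sk ke. Qed.

(** The translated kernel is a test function for the weak gradient; the sign from integration by
    parts cancels that of [convol_partial]. *)
Lemma mollified_partial a x : partial (convol phi k) a x = convol (fun y => dphi y ord0 a) k x.
Proof.
case: sobolev1_locint => lp ld; case: kk => sk ke _ _.
have [mp md] := sobolev1_measurable.
have [_ ->] := convol_partial x lp sk ke.
have mk : measurable_fun setT k by exact: smooth_measurable.
have mdk : measurable_fun setT (partial k a) by apply: smooth_measurable; exact: smooth_partial.
rewrite !convolE //.
case: phi_H1 => _ _ wg.
have := wg (fun y => k (y - x)) _ a; rewrite (eq_Int _ (g := fun y => phi y * partial k a (y - x))); last first.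
  by move=> y; rewrite partial_shift.
move=> ->; first by rewrite opprK.
apply/test_functionP; split; first exact: smooth_shift.
by exists (e + `|x|); exact: supp_in_shift.
Qed.

Let dH a : locint (fun y => partial H a y * dphi y ord0 a).
Proof.
by case: sobolev1_locint => _ ld; apply: locintMl => //; apply: smooth_continuous; exact: smooth_partial.
Qed.

(* The weak equation is tested with y |-> e^(H y) k (y - x), which removes the weight. *)
Lemma mollified_equation x :
  \sum_a partial (partial (convol phi k) a) a x =
  \sum_a convol (fun y => partial H a y * dphi y ord0 a) k x - convol (fun y => f y - m) k x.
Proof.
case: sobolev1_locint => lp ld; case: (kk) => sk ke _ _.
have [mp md] := sobolev1_measurable.
have sks : smooth (fun y => k (y - x)) by exact: smooth_shift.
have mk : measurable_fun setT k by exact: smooth_measurable.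
have d2 a : partial (partial (convol phi k) a) a x = - convol (fun y => dphi y ord0 a) (partial k a) x.
  rewrite (_ : partial (convol phi k) a = convol (fun y => dphi y ord0 a) k).
    by have [_ ->] := convol_partial x (ld a) sk ke.
  by apply/funext => y; exact: mollified_partial.
under eq_bigr do rewrite d2.
have se : smooth (fun y => expR (H y) * k (y - x)) by smth.
have := @weak_poisson_test _ (e + `|x|) se (supp_inMl _ (supp_in_shift ke)).
have E1 y a : partial (fun y => expR (H y) * k (y - x)) a y * (dphi y ord0 a * w y) =
   c * (partial H a y * dphi y ord0 a * k (y - x) + dphi y ord0 a * partial k a (y - x)).
  rewrite partialM; [|by apply: smooth_differentiable; smth|exact: smooth_differentiable].
  rewrite partial_shift partial_expR; last exact: smooth_differentiable.
  have : expR (H y) * expR (- H y) = 1 by rewrite -expRD subrr expR0.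
  rewrite /w; move: (partial k a _) (partial H a y) (dphi _ _ _) (k _) (expR _) (expR _) => p q r s t u tu.
  rewrite (_ : _ * _ = c * (t * u) * (q * r * s + r * p)); last by ring.
  by rewrite [t * u]mulrC tu mulr1.
have E2 y : expR (H y) * k (y - x) * ((f y - m) * w y) = c * ((f y - m) * k (y - x)).
  have : expR (H y) * expR (- H y) = 1 by rewrite -expRD subrr expR0.
  rewrite /w; move: (f y - m) (k _) (expR _) (expR _) => p q r s rs.
  rewrite (_ : s * q * (p * (c * r)) = c * (s * r) * (p * q)); last by ring.
  by rewrite rs mulr1.
have lf : locint (fun y => f y - m).
  by apply: continuous_locint; apply: smooth_continuous; apply: smoothB => //; exact: smooth_cst.
have [mdk cdk] : (forall a, measurable_fun setT (partial k a)) /\ (forall a, continuous (partial k a)).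
  by split=> a; [apply: smooth_measurable|apply: smooth_continuous]; exact: smooth_partial.
have ck : continuous k by exact: smooth_continuous.
rewrite (eq_Int _ E2) IntZ; last exact: convol_rint ck ke.
have E3 a : \int[lam]_y (partial (fun y => expR (H y) * k (y - x)) a y * (dphi y ord0 a * w y)) =
  c * (convol (fun y => partial H a y * dphi y ord0 a) k x + convol (fun y => dphi y ord0 a) (partial k a) x).
  have r1 := convol_rint x (dH a) ck ke.
  have r2 := convol_rint x (ld a) (cdk a) (supp_in_partial a ke).
  rewrite (eq_Int _ (E1^~ a)) IntZ; last exact: rintD.
  by rewrite (IntD r1 r2) (convolE x (dH a).1 mk) (convolE x (md a) (mdk a)).
rewrite (eq_bigr _ (fun a _ => E3 a)).
rewrite -mulr_sumr -(convolE x lf.1 mk) => /(mulfI (lt0r_neq0 c0)) <-.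
by rewrite big_split /= opprD addrA subrr sub0r sumrN.
Qed.

(** Every term is now a commutator of mollification with a multiplication: by [f - m] acting on the
    constant 1, and by [partial H a] acting on the a-th component of [dphi]. The factors 1 are
    inserted to give the source this shape. *)
Lemma residualE x : residual (convol phi k) x =
  (convol (fun y => (f y - m) * 1) k x - (f x - m) * convol (fun=> 1) k x) -
  \sum_a (convol (fun y => partial H a y * dphi y ord0 a) k x -
    partial H a x * convol (fun y => dphi y ord0 a) k x).
Proof.
rewrite /residual /lap big_split /= mollified_equation (convol_cst kk) mulr1.
rewrite (_ : (fun y => (f y - m) * 1) = (fun y => f y - m)); last by apply/funext => y; rewrite mulr1.
have E a : - (partial H a x * partial (convol phi k) a x) =
    - (partial H a x * convol (fun y => dphi y ord0 a) k x) by rewrite mollified_partial.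
rewrite (eq_bigr _ (fun a _ => E a)) sumrN.
rewrite sumrB; move: (\sum_a _) (\sum_a _) (convol _ _ _) => p q r; ring.
Qed.

End mollified.

(** Friedrichs' estimate for each commutator. [L] depends on the ball through the local Lipschitz
    constants of [f - m] and of the derivatives of [H], but neither on the kernel nor on its
    scale. *)
Lemma residual_bound M : exists2 L : R, 0 <= L &
  forall k e, mollifier k e -> 0 <= e -> e <= 1 -> forall x, `|x| <= M ->
  residual (convol phi k) x ^+ 2 <=
    (L * e) ^+ 2 * (1 + \sum_a convol (fun y => dphi y ord0 a ^+ 2) k x).
Proof.
have [_ md] := sobolev1_measurable; have [_ ld2] := sobolev1_locint2.
have sfm : smooth (fun x => f x - m) by apply: smoothB => //; exact: smooth_cst.
have [Lf Lf0 fL] := local_lipschitz M sfm.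
have /choice[LH LHP] a : exists L : R, 0 <= L /\ forall x h, `|x| <= M -> `|h| <= 1 ->
    `|partial H a (x + h) - partial H a x| <= L * `|h|.
  by have [L L0 HL] := local_lipschitz M (smooth_partial a sH); exists L.
have LH0 : 0 <= \sum_a LH a by apply: sumr_ge0 => a _; case: (LHP a).
exists (2 * (#|'I_n|%:R + 1) * (Lf + \sum_a LH a)).
  by rewrite mulr_ge0 ?addr_ge0 // mulr_ge0 ?addr_ge0.
move=> k e kk e0 e1 x xM; rewrite (residualE kk).
have l1 : locint (fun y : 'rV[R]_n => 1 ^+ 2 : R).
  by apply: continuous_locint; apply: smooth_continuous; exact: smooth_cst.
have m1 : measurable_fun setT ((fun=> 1) : 'rV[R]_n -> R) by apply: smooth_measurable; exact: smooth_cst.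
apply: sqr_sub_sum_le => //.
- by move=> a; case: (LHP a).
- by move=> a; apply: le_trans (convol_jensen kk x (md a) (ld2 a)); exact: sqr_ge0.
- have := convol_commutator (F := fun=> 1) kk sfm m1 l1 e1 xM Lf0 (fL x ^~ xM).
  by rewrite (convol_cst kk (1 ^+ 2)) expr1n mulr1.
- move=> a; exact: (convol_commutator (F := fun y => dphi y ord0 a) kk (smooth_partial a sH) (md a) (ld2 a) e1 xM
  (LHP a).1 ((LHP a).2 x ^~ xM)).
Qed.

Section mollified_sequence.
Variable K : nat -> 'rV[R]_n -> R.
Hypothesis KK : forall j, mollifier (K j) j.+1%:R^-1.
Variables (psi : 'rV[R]_n -> R) (M d : R).
Hypotheses (sp : smooth psi) (p0 : forall x, 0 <= psi x) (pM : supp_in psi M) (d0 : 0 < d).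
Let u j := convol phi (K j).

Let spw : smooth (fun x => psi x * w x).
Proof. exact: smoothM. Qed.

Let pw0 x : 0 <= psi x * w x.
Proof. exact: mulr_ge0. Qed.

Let pwM : supp_in (fun x => psi x * w x) M.
Proof. exact: supp_inMr. Qed.

Let near_sqr F : measurable_fun setT F -> locint (fun x => F x ^+ 2) ->
  \forall j \near \oo, \int[mu]_x (convol F (K j) x ^+ 2 * psi x) <= \int[mu]_x (F x ^+ 2 * psi x) + d.
Proof.
move=> mF lF; have lF1 := locintW mF lF; near=> j.
have [sk ke _ _] := KK j.
rewrite gibbs_Int; last first.
  by apply: smooth_measurable; apply: smoothM => //; apply: smoothX; exact: convol_smooth lF1 sk ke.
rewrite gibbs_Int; last by apply: measurable_funM; [exact: lF.1|exact: smooth_measurable].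
rewrite (eq_Int _ (fun x => esym (mulrA _ _ _))) [in leRHS](eq_Int _ (fun x => esym (mulrA _ _ _))).
by near: j; exact: (near_convol_sqr KK mF lF spw pw0 pwM d0).
Unshelve. all: by end_near. Qed.

Lemma near_mollified_sqr :
  \forall j \near \oo, \int[mu]_x (u j x ^+ 2 * psi x) <= \int[mu]_x (phi x ^+ 2 * psi x) + d.
Proof. by apply: near_sqr; [exact: sobolev1_measurable.1|exact: sobolev1_locint2.1]. Qed.

Lemma near_mollified_partial a :
  \forall j \near \oo, \int[mu]_x (partial (u j) a x ^+ 2 * psi x) <= \int[mu]_x (dphi x ord0 a ^+ 2 * psi x) + d.
Proof.
have := @near_sqr (fun x => dphi x ord0 a) (sobolev1_measurable.2 a) (sobolev1_locint2.2 a).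
apply: filterS => j; congr (_ <= _); apply: eq_Int => x.
by rewrite (mollified_partial (KK j)).
Qed.

Lemma near_mollified_residual :
  \forall j \near \oo, \int[mu]_x (residual (u j) x ^+ 2 * psi x) <= d.
Proof.
have [L L0 rL] := residual_bound M.
have [_ ld] := sobolev1_locint2.
(* A bound for the mollified energies that does not depend on j: each summand 1 is the tolerance
   granted by [near_convol]. *)
pose B := \int[lam]_x (psi x * w x) + \sum_a (\int[lam]_x (dphi x ord0 a ^+ 2 * (psi x * w x)) + 1).
have B0 : 0 <= B.
  apply: addr_ge0; first by apply: Int_ge0 => x.
  apply: sumr_ge0 => a _; apply: addr_ge0 => //; apply: Int_ge0 => x.
  by rewrite mulr_ge0 ?sqr_ge0.
near=> j.
have [sk ke _ _] := KK j.
have e1 : j.+1%:R^-1 <= 1 :> R by rewrite invf_le1 ?ler1n // ltr0Sn.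
have e0 : 0 <= j.+1%:R^-1 :> R by rewrite invr_ge0.
have su : smooth (u j) by exact: mollified_smooth (KK j).
have sr : smooth (residual (u j)).
  by rewrite /residual; apply: smoothB; [apply: smoothN; exact: smooth_lap|apply: smoothB => //; exact: smooth_cst].
have sc a : smooth (convol (fun y => dphi y ord0 a ^+ 2) (K j)) by exact: convol_smooth (ld a) sk ke.
have ri a : rint lam (fun x => convol (fun y => dphi y ord0 a ^+ 2) (K j) x * (psi x * w x)).
  by apply: (@rint_smooth_cs _ _ _ M); [exact: smoothM|exact: supp_inMl].
have ri0 : rint lam (fun x => psi x * w x) by exact: rint_smooth_cs spw pwM.
have h a : \int[lam]_x (convol (fun y => dphi y ord0 a ^+ 2) (K j) x * (psi x * w x)) <=
    \int[lam]_x (dphi x ord0 a ^+ 2 * (psi x * w x)) + 1.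
  rewrite -lerBlDl; apply: ler_normlW; move: a; near: j.
  by apply: filter_forall => a; apply: (near_convol KK (ld a) spw pwM ltr01).
rewrite gibbs_Int; last by apply: smooth_measurable; apply: smoothM => //; exact: smoothX.
apply: (@le_trans _ _ ((L * j.+1%:R^-1) ^+ 2 * B)).
  apply: (@le_trans _ _ (\int[lam]_x ((L * j.+1%:R^-1) ^+ 2 * (psi x * w x +
     \sum_a convol (fun y => dphi y ord0 a ^+ 2) (K j) x * (psi x * w x))))); last first.
    rewrite IntZ; last by apply: rintD => //; exact: rint_sum.
    rewrite IntD //; last exact: rint_sum.
    rewrite Int_sum // ler_wpM2l ?sqr_ge0 // lerD2l.
    by apply: ler_sum => a _; exact: h.
  apply: le_Int.
  - apply: (@rint_smooth_cs _ _ _ M); first by apply: smoothM => //; apply: smoothM => //; exact: smoothX.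
    by apply: supp_inMr; exact: supp_inMl.
  - by apply: rintZ; apply: rintD => //; exact: rint_sum.
  - move=> x; have [xM|Mx] := leP `|x| M; last first.
      by rewrite pM // mulr0 !mul0r add0r big1 ?mulr0 // => a _; rewrite mulr0.
    rewrite -mulr_suml -[leLHS]mulrA -/(w x).
    have := rL _ _ (KK j) e0 e1 x xM; rewrite -/(u j); have := pw0 x.
    move: (psi x * w x) (\sum_a _) ((L * _) ^+ 2) (residual _ _ ^+ 2) => P S V r P0 rS.
    by have := ler_wpM2r P0 rS; lra.
apply: (@le_trans _ _ (L ^+ 2 * B * j.+1%:R^-1)).
  rewrite exprMn mulrAC ler_wpM2l ?mulr_ge0 ?sqr_ge0 //.
  by rewrite expr2 ler_piMl.
by near: j; apply: near_small => //; rewrite mulr_ge0 ?sqr_ge0.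
Unshelve. all: by end_near. Qed.

Lemma near_mollified_source :
  \forall j \near \oo, `|\int[mu]_x (u j x * (psi x * (f x - m))) - \int[mu]_x (phi x * (psi x * (f x - m)))| <= d.
Proof.
have sfm : smooth (fun x => f x - m) by apply: smoothB => //; exact: smooth_cst.
have [lp _] := sobolev1_locint.
have s1 : smooth (fun x => psi x * (f x - m) * w x) by apply: smoothM => //; exact: smoothM.
have M1 : supp_in (fun x => psi x * (f x - m) * w x) M by apply: supp_inMr; exact: supp_inMr.
near=> j.
have su : smooth (u j) by exact: mollified_smooth (KK j).
rewrite gibbs_Int; last by apply: smooth_measurable; apply: smoothM => //; exact: smoothM.
rewrite gibbs_Int; last by apply: measurable_funM; [exact: lp.1|apply: smooth_measurable; exact: smoothM].
rewrite (eq_Int _ (fun x => esym (mulrA _ _ _))) [X in _ - X](eq_Int _ (fun x => esym (mulrA _ _ _))).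
by near: j; exact: (near_convol KK lp s1 M1 d0).
Unshelve. all: by end_near. Qed.

End mollified_sequence.
End weak_solution.
End gibbs_measure.

(** * Convergence of the energies *)

Section approximation.
Context {R : realType} {n : nat}.
Local Notation lam := (@lebesgue_rV R n).

(** Dominated convergence. Applied to the source term phi (f - m), it fixes the radius up to which
    the cutoff has to be 1. *)
Lemma near_tail (mu : {measure set 'rV[R]_n -> \bar R}) G d : rint mu G -> (0 : R) < d ->
  \forall j \near \oo, \int[mu]_x (`|G x| * (1 - \1_(cball j%:R) x)) <= d.
Proof.
move=> Gi d0; have mG := rint_measurable Gi.
have mf j : measurable_fun setT (fun x => `|G x| * (1 - \1_(cball j%:R) x) : R).
  apply: measurable_funM; first exact: measurableT_comp.
  apply: measurable_funB; first exact: measurable_cst.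
  by apply: measurable_indic; exact: measurable_cball.
have ind01 j (x : 'rV[R]_n) : 0 <= (1 - \1_(cball j%:R) x : R) <= 1.
  by rewrite indicE; case: (x \in _) => /=; lra.
have le j x : `| `|G x| * (1 - \1_(cball j%:R) x)| <= `|G x|.
  by have /andP[a b] := ind01 j x; rewrite normrM normr_id (ger0_norm a) ler_piMr.
have ri j : rint mu (fun x => `|G x| * (1 - \1_(cball j%:R) x)).
  by apply: le_rint (le j) (rint_norm Gi).
have cv x : (fun j => (`|G x| * (1 - \1_(cball j%:R) x))%:E) @ \oo --> (0%E : \bar R).
  apply: cvg_near_cst; near=> j; rewrite indicE mem_set ?subrr ?mulr0 //=.
  by near: j; exact: nbhs_infty_ger.
have [_ _] := @dominated_convergence _ _ R mu setT measurableT
  (fun j x => (`|G x| * (1 - \1_(cball j%:R) x))%:E) (fun=> 0%E) (fun x => `|G x|%:E)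
  (fun j => (measurable_EFinP _ _).2 (mf j)) (measurable_cst _)
  (aeW _ (fun x _ => cv x)) (rint_norm Gi) (aeW _ (fun x j _ => le j x)).
pose I j := \int[mu]_x (`|G x| * (1 - \1_(cball j%:R) x)).
rewrite integral0 (_ : [sequence _]_j = fun j => (I j)%:E); last first.
  by apply/funext => j; exact: IntE.
move=> /fine_cvg h; have /cvgrPdist_le /(_ d d0) := h.
apply: filterS => j /=; rewrite sub0r normrN; exact: le_trans (ler_norm _).
Unshelve. all: by end_near. Qed.
(** In the applications [v] is a derivative of a cutoff, [s] its small size and [t] the value of a
    wider cutoff, so that the error is [s] times quantities that stay bounded. *)
Let mixed_le (q u v s t : R) : 0 <= s -> `|v| <= s * t ->
  u * v * q <= 2^-1 * (s * (u ^+ 2 * t ^+ 2 + q ^+ 2)).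
Proof.
move=> s0 vst; apply: le_trans (ler_norm _) _; rewrite !normrM.
apply: (@le_trans _ _ (`|u| * (s * t) * `|q|)); first by rewrite ler_wpM2r // ler_wpM2l.
have := mulr_ge0 s0 (sqr_ge0 (`|u| * t - `|q|)).
rewrite sqrrB exprMn !real_normK ?num_real //; move: (`|u|) (`|q|) => a b; lra.
Qed.

Let cross_term_le (p q u v s t : R) : 0 <= s -> `|v| <= s * t ->
  (p + u * v) * q <= 2^-1 * (p ^+ 2 + q ^+ 2 + s * (u ^+ 2 * t ^+ 2 + q ^+ 2)).
Proof. by move=> s0 /(mixed_le q u s0); have := sqr_ge0 (p - q); lra. Qed.

Let product_sqr_le (p u v s t : R) : 0 <= s -> s <= 1 -> `|v| <= s * t ->
  (p + u * v) ^+ 2 <= (1 + s) * p ^+ 2 + 2 * s * (u ^+ 2 * t ^+ 2).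
Proof.
move=> s0 s1 vst; have := mixed_le p u s0 vst.
have t0 : 0 <= s * t by apply: le_trans vst.
have : u ^+ 2 * v ^+ 2 <= s * (u ^+ 2 * t ^+ 2).
  apply: (@le_trans _ _ (u ^+ 2 * (s * t) ^+ 2)).
    by rewrite ler_wpM2l ?sqr_ge0 // -[v ^+ 2]real_normK ?num_real // ler_sqr ?nnegrE.
  rewrite exprMn mulrCA; apply: ler_wpM2r; first by apply: mulr_ge0; exact: sqr_ge0.
  by rewrite expr2 ler_piMl.
by rewrite sqrrD exprMn; lra.
Qed.

(* Each of the cutoffs eta, zeta, theta is 1 on a neighbourhood of the support of the
   previous one. *)
Lemma cutoff_chain (s : R) j0 : 0 < s -> exists eta zeta theta : 'rV[R]_n -> R, exists r M : R,
  [/\ (j0%:R <= r), 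
   [/\ smooth eta, smooth zeta & smooth theta],
   [/\ supp_in eta M, supp_in zeta M & supp_in theta M],
   [/\ forall x, 0 <= eta x <= 1, forall x, 0 <= zeta x <= 1 & forall x, 0 <= theta x <= 1] &
   [/\ forall x, `|x| <= r -> eta x = 1,
     forall a x, `|partial eta a x| <= s * zeta x,
     forall a x, `|partial eta a x| <= s * theta x,
     forall a x, `|partial zeta a x| <= s * theta x &
     forall u, smooth u -> forall a x, eta x * partial (fun y => zeta y * u y) a x = eta x * partial u a x]].
Proof.
move=> s0; have [C C0 cut] := @cutoff_exists R n.
(* Large enough to exceed [j0] and to make every gradient bound [C / t] with [r <= t] at most
   [s]. *)
pose r := 1 + j0%:R + C / s.
have Cs0 : 0 <= C / s by rewrite divr_ge0 // ltW.
have r1 : 1 <= r by rewrite /r -addrA lerDl addr_ge0.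
have r0 : 0 < r by exact: lt_le_trans r1.
have Cr t : r <= t -> C / t <= s.
  move=> rt; rewrite ler_pdivrMr; last exact: lt_le_trans rt.
  rewrite -ler_pdivrMl // mulrC; apply: le_trans rt; rewrite /r; have : 0 <= j0%:R :> R by []; lra.
have [eta [se eM e01 e1 de]] := cut r r0.
have [zeta [sz zM z01 z1 dz]] := cut (4 * r) ltac:(lra).
(* [eta], [zeta] and [theta] vanish beyond [3 * r], [12 * r] and [48 * r]; as [3 < 4] and [12 < 16],
   each one is 1 around the support of the previous one. *)
have [theta [st tM t01 t1 dt]] := cut (16 * r) ltac:(lra).
have de0 a x : 3 * r < `|x| -> partial eta a x = 0 by exact: supp_in_partial.
have dz0 a x : 12 * r < `|x| -> partial zeta a x = 0.
  by move=> h; apply: (supp_in_partial a zM); rewrite mulrA -natrM.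
exists eta, zeta, theta, r, (48 * r); split => //.
- by rewrite /r; lra.
- by split; [apply: supp_inW eM|apply: supp_inW zM|apply: supp_inW tM]; lra.
split => //.
- move=> a x; have [h|h] := leP `|x| (3 * r).
    by rewrite z1 ?mulr1; [apply: le_trans (de a x) _; apply: Cr|lra].
  by rewrite de0 // normr0 mulr_ge0 ?(ltW s0) //; case/andP: (z01 x).
- move=> a x; have [h|h] := leP `|x| (3 * r).
    by rewrite t1 ?mulr1; [apply: le_trans (de a x) _; apply: Cr|lra].
  by rewrite de0 // normr0 mulr_ge0 ?(ltW s0) //; case/andP: (t01 x).
- move=> a x; have [h|h] := leP `|x| (12 * r).
    by rewrite t1 ?mulr1; [apply: le_trans (dz a x) _; apply: Cr; lra|lra].
  by rewrite dz0 // normr0 mulr_ge0 ?(ltW s0) //; case/andP: (t01 x).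
- move=> u su a x.
  (* [eta * (1 - zeta)] is identically 0; differentiating it shows that [eta] times a derivative of
     [zeta] vanishes. *)
  have ez y : eta y * (1 - zeta y) = 0.
    have [h|h] := leP `|y| (3 * r); first by rewrite z1 ?subrr ?mulr0 //; lra.
    by rewrite eM // mul0r.
  have : partial (fun y => eta y * (1 - zeta y)) a x = 0.
    by rewrite (_ : (fun _ => _) = fun=> 0) ?partial_cst //; exact/funext.
  rewrite partialM; [|exact: smooth_differentiable|by apply: smooth_differentiable; apply: smoothB => //; exact: smooth_cst].
  have -> : partial (fun y => 1 - zeta y) a x = - partial zeta a x.
    have dc : differentiable ((fun=> 1) : 'rV[R]_n -> R) x by apply: smooth_differentiable; exact: smooth_cst.
    have dn : differentiable (fun y => - zeta y) x by apply: smooth_differentiable; exact: smoothN.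
    by rewrite (partialD a dc dn) partial_cst add0r partialN //; exact: smooth_differentiable.
  have -> : (1 - zeta x) * partial eta a x = 0.
    have [h|h] := leP `|x| (3 * r); first by rewrite z1 ?subrr ?mul0r //; lra.
    by rewrite de0 // mulr0.
  rewrite addr0 mulrN => /eqP; rewrite oppr_eq0 => /eqP edz.
  rewrite partialM; [|exact: smooth_differentiable|exact: smooth_differentiable].
  rewrite mulrDr mulrCA [X in _ + X]mulrA [_ * u x]mulrC -mulrA edz mulr0 addr0.
  have := ez x; rewrite mulrBr mulr1 => /eqP; rewrite subr_eq0 => /eqP eez.
  by rewrite mulrA [zeta x * _]mulrC -eez.
Qed.

Variables (H : 'rV[R]_n -> R) (mu : probability 'rV[R]_n R) (c : R).
Hypotheses (sH : smooth H) (c0 : 0 < c).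
Hypothesis muE : forall A, measurable A ->
  mu A = (\int[lam]_(x in A) (c * expR (- H x))%:E)%E.
Variables (f phi : 'rV[R]_n -> R) (dphi : 'rV[R]_n -> 'rV[R]_n).
Hypotheses (sf : smooth f) (phi_H1 : sobolev1 mu phi dphi) (phi_sol : weak_poisson mu f dphi).
Let m := \int[mu]_x f x.
Let A a := \int[mu]_x dphi x ord0 a ^+ 2.

Let rint_cs g M : smooth g -> supp_in g M -> rint mu g.
Proof. by move=> sg; exact: (gibbs_rint_cs sH c0 muE (smooth_continuous sg)). Qed.

Lemma energy_identity : \sum_a A a = \int[mu]_x (phi x * (f x - m)).
Proof.
have [_ di] := sobolev1_rint phi_H1.
rewrite -(phi_sol phi_H1) -Int_sum; last by move=> a _; exact: di.
by apply: eq_Int => x; rewrite /dotv; apply: eq_bigr => a _; rewrite expr2.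
Qed.

Section cutoffs.
Variables (u eta theta : 'rV[R]_n -> R) (s M : R).
Hypotheses (su : smooth u) (se : smooth eta) (st : smooth theta).
Hypotheses (eM : supp_in eta M) (tM : supp_in theta M).
Hypotheses (s0 : 0 <= s) (s1 : s <= 1).
Hypothesis det : forall a x, `|partial eta a x| <= s * theta x.

Let pE a x : partial (fun y => eta y * u y) a x = partial u a x * eta x + u x * partial eta a x.
Proof.
by rewrite partialM; [rewrite mulrC|exact: smooth_differentiable|exact: smooth_differentiable].
Qed.

Let ut : rint mu (fun x => u x ^+ 2 * theta x ^+ 2).
Proof. by apply: (@rint_cs _ M); [smth|do 2 apply: supp_inMl]. Qed.

Let ue a : rint mu (fun x => partial u a x ^+ 2 * eta x ^+ 2).
Proof. by apply: (@rint_cs _ M); [smth|do 2 apply: supp_inMl]. Qed.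

(* The weak equation tested with [eta * u]. *)
Lemma energy_lower : 2 * \int[mu]_x (u x * (eta x * (f x - m))) <=
  \sum_a \int[mu]_x (partial u a x ^+ 2 * eta x ^+ 2) + \sum_a A a +
  s * (n%:R * \int[mu]_x (u x ^+ 2 * theta x ^+ 2) + \sum_a A a).
Proof.
have [_ di] := sobolev1_rint phi_H1; have [_ md] := sobolev1_measurable phi_H1.
have seu : smooth (fun x => eta x * u x) by exact: smoothM.
have euM : supp_in (fun x => eta x * u x) M by exact: supp_inMr.
have := phi_sol (sobolev1_test sH c0 muE seu euM); rewrite -/m => eq1.
have pi a : rint mu (fun x => partial (fun y => eta y * u y) a x * dphi x ord0 a).
  apply: (Int_CS _ (di a) _ (md a)).1; last by apply: smooth_measurable; exact: smooth_partial.
  by apply: (@rint_cs _ M); [apply: smoothX; exact: smooth_partial|apply: supp_inMl; exact: supp_in_partial].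
have -> : \int[mu]_x (u x * (eta x * (f x - m))) =
    \sum_a \int[mu]_x (partial (fun y => eta y * u y) a x * dphi x ord0 a).
  rewrite -Int_sum; last by move=> a _; exact: pi.
  transitivity (\int[mu]_x (eta x * u x * (f x - m))).
    by apply: eq_Int => x; rewrite mulrCA mulrA.
  by rewrite -eq1; apply: eq_Int => x; rewrite /dotv; apply: eq_bigr => a _; rewrite mxE.
rewrite mulr_sumr (_ : n%:R * _ = \sum_(a < n) \int[mu]_x (u x ^+ 2 * theta x ^+ 2)); last first.
  by rewrite sumr_const card_ord mulr_natl.
rewrite -big_split /= -big_split /= mulr_sumr -big_split /=; apply: ler_sum => a _.
have ai : rint mu (fun x => u x ^+ 2 * theta x ^+ 2 + dphi x ord0 a ^+ 2) by exact: rintD.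
have bi : rint mu (fun x => partial u a x ^+ 2 * eta x ^+ 2 + dphi x ord0 a ^+ 2) by exact: rintD.
rewrite /A -!IntD // -IntZ // -IntD //; last exact: rintZ.
rewrite -ler_pdivlMl // -IntZ; last by apply: rintD => //; exact: rintZ.
apply: le_Int => //; first by apply: rintZ; apply: rintD => //; exact: rintZ.
by move=> x; rewrite pE -exprMn; exact: cross_term_le (det a x).
Qed.

(** Used with [zeta] in the role of [eta]: it bounds the energy of the function [zeta * u] to which
    the fibre Poincare inequality is applied. *)
Lemma energy_upper a : \int[mu]_x (partial (fun y => eta y * u y) a x ^+ 2) <=
  (1 + s) * \int[mu]_x (partial u a x ^+ 2 * eta x ^+ 2) +
  2 * s * \int[mu]_x (u x ^+ 2 * theta x ^+ 2).
Proof.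
rewrite -!IntZ // -IntD; [|exact: rintZ|exact: rintZ].
apply: le_Int.
- apply: (@rint_cs _ M); first by apply: smoothX; apply: smooth_partial; exact: smoothM.
  by apply: supp_inMl; apply: supp_in_partial; exact: supp_inMr.
- by apply: rintD; exact: rintZ.
- by move=> x; rewrite pE -exprMn; exact: product_sqr_le (det a x).
Qed.

End cutoffs.

Hypothesis f_L2 : f \in Lfun mu 2%:E.

Lemma rint_source : rint mu (fun x => phi x * (f x - m)).
Proof.
have [ip _] := sobolev1_rint phi_H1; have [mp _] := sobolev1_measurable phi_H1.
case/Lfun2P: f_L2 => mf if2.
apply: (Int_CS ip _ mp _).1; last by apply: measurable_funB => //; exact: measurable_cst.
have i1 : rint mu (fun=> 1) by exact: finite_measure_integrable_cst.
apply: (@le_rint _ _ _ _ _ (fun x => 2 * f x ^+ 2 + 2 * m ^+ 2 * 1)).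
- by apply: measurable_funX; apply: measurable_funB => //; exact: measurable_cst.
- by move=> x; rewrite ger0_norm ?sqr_ge0 //; have := sqr_ge0 (f x + m); lra.
- by apply: rintD; exact: rintZ.
Qed.

(** One choice of cutoffs and of mollification scale meets all the tolerances. The upper bounds hold
    for each coordinate, the lower bound for the total energy alone, since it comes from the
    equation. *)
Lemma mollified_approximation (d : R) : 0 < d -> exists u eta zeta : 'rV[R]_n -> R, exists M : R,
  [/\ [/\ smooth u, smooth eta, smooth zeta, supp_in eta M & supp_in zeta M],
   (forall x, 0 <= eta x <= 1) /\
     (forall a x, eta x * partial (fun y => zeta y * u y) a x = eta x * partial u a x),
   [/\ forall a, \int[mu]_x (partial u a x ^+ 2 * eta x ^+ 2) <= A a + d,
     forall a, \int[mu]_x (partial (fun y => zeta y * u y) a x ^+ 2) <= A a + d &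
     \sum_a A a - d <= \sum_a \int[mu]_x (partial u a x ^+ 2 * eta x ^+ 2)],
   \int[mu]_x (residual H mu f u x ^+ 2 * eta x ^+ 2) <= d &
   forall a b, \int[mu]_x (partial eta b x ^+ 2 * partial u a x ^+ 2) <= d].
Proof.
move=> d0; pose B := \int[mu]_x phi x ^+ 2.
have [ip ia] := sobolev1_rint phi_H1; have [mp _] := sobolev1_measurable phi_H1.
have B0 : 0 <= B by apply: Int_ge0 => x; exact: sqr_ge0.
have A0 a : 0 <= A a by apply: Int_ge0 => x; exact: sqr_ge0.
have SA0 : 0 <= \sum_a A a by exact: sumr_ge0.
have leA a : A a <= \sum_b A b by rewrite (bigD1 a) //= lerDl sumr_ge0.
(* [T] dominates the weighted integral of u^2 and every [A a + s]. All errors below are multiples of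
   [s * T]: n of them from the cutoff term summed over coordinates and at most 6 others, whence
   [N]. *)
pose T := B + \sum_a A a + 1; have T1 : 1 <= T by rewrite /T; lra.
have T0 : 0 < T by exact: lt_le_trans T1.
pose N : R := n%:R + 6; have N0 : 0 < N by rewrite /N ltr_wpDl.
have N6 : 6 <= N by rewrite /N lerDr.
pose s := Num.min 1 (d / (N * T)).
have s0 : 0 < s by rewrite lt_min ltr01 /= divr_gt0 // mulr_gt0.
have s1 : s <= 1 by rewrite ge_min lexx.
have sd : N * (s * T) <= d.
  have : s <= d / (N * T) by rewrite ge_min lexx orbT.
  by rewrite ler_pdivlMr ?mulr_gt0 // mulrCA mulrA mulrAC.
have sT0 : 0 <= s * T by rewrite mulr_ge0 // ltW.
have sTs : s <= s * T by rewrite ler_peMr // ltW.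
have sT6 : 6 * (s * T) <= d by apply: le_trans sd; rewrite ler_wpM2r.
(* Outside the ball of radius [j0] the source term has mass at most [s]; [eta] is taken equal to 1
   on that ball. *)
have [j0 tail] := filter_ex (near_tail rint_source s0).
have [eta [zeta [theta [r [M [rj [se sz st] [eM zM tM] [e01 z01 t01] [er de det dzt eu]]]]]]] :=
  cutoff_chain j0 s0.
have /choice[K KK] : forall j, exists k : 'rV[R]_n -> R, mollifier k j.+1%:R^-1.
  by move=> j; apply: mollifier_exists; rewrite invr_gt0.
have se2 : smooth (fun x => eta x ^+ 2) by exact: smoothX.
have sz2 : smooth (fun x => zeta x ^+ 2) by exact: smoothX.
have st2 : smooth (fun x => theta x ^+ 2) by exact: smoothX.
have e20 x : 0 <= eta x ^+ 2 by exact: sqr_ge0.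
have z20 x : 0 <= zeta x ^+ 2 by exact: sqr_ge0.
have t20 x : 0 <= theta x ^+ 2 by exact: sqr_ge0.
have e2M : supp_in (fun x => eta x ^+ 2) M by exact: supp_inMl.
have z2M : supp_in (fun x => zeta x ^+ 2) M by exact: supp_inMl.
have t2M : supp_in (fun x => theta x ^+ 2) M by exact: supp_inMl.
have e0 x : 0 <= eta x by case/andP: (e01 x).
have n1 := near_mollified_partial sH c0 muE phi_H1 KK se2 e20 e2M s0.
have n2 := near_mollified_partial sH c0 muE phi_H1 KK sz2 z20 z2M s0.
have n3 := near_mollified_sqr sH c0 muE phi_H1 KK st2 t20 t2M s0.
have n4 := near_mollified_residual sH c0 muE sf phi_H1 phi_sol KK se2 e20 e2M s0.
have n5 := near_mollified_source sH c0 muE sf phi_H1 KK se eM s0.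
have [j [[E1 E2] [E3 [E4 E5]]]] := filter_ex (filterI
  (filterI (filter_forall _ n1) (filter_forall _ n2)) (filterI n3 (filterI n4 n5))).
set u := convol phi (K j) in E1 E2 E3 E4 E5.
have su : smooth u by exact: (mollified_smooth sH c0 muE phi_H1 (KK j)).
have sq01 (g : 'rV[R]_n -> R) x : 0 <= g x <= 1 -> g x ^+ 2 <= 1.
  by case/andP=> g0 g1; rewrite expr_le1.
have weight F (g : 'rV[R]_n -> R) : rint mu F -> (forall x, 0 <= F x) -> smooth g ->
    (forall x, 0 <= g x <= 1) -> \int[mu]_x (F x * g x ^+ 2) <= \int[mu]_x F x.
  move=> Fi F0 sg g01.
  have le x : F x * g x ^+ 2 <= F x by rewrite ler_piMr // sq01.
  apply: le_Int => //; apply: (le_rint _ _ Fi) => [|x].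
    apply: measurable_funM; first exact: (rint_measurable Fi).
    by apply: smooth_measurable; exact: smoothX.
  by rewrite ger0_norm // mulr_ge0 // sqr_ge0.
have F1 a : \int[mu]_x (partial u a x ^+ 2 * eta x ^+ 2) <= A a + s.
  apply: le_trans (E1 a) _; rewrite lerD2r.
  by apply: weight => // x; exact: sqr_ge0.
have F2 a : \int[mu]_x (partial u a x ^+ 2 * zeta x ^+ 2) <= A a + s.
  apply: le_trans (E2 a) _; rewrite lerD2r.
  by apply: weight => // x; exact: sqr_ge0.
have F3 : \int[mu]_x (u x ^+ 2 * theta x ^+ 2) <= T.
  apply: le_trans E3 _; rewrite /T lerD // (@le_trans _ _ B) ?lerDl //.
  by apply: weight => // x; exact: sqr_ge0.
have AsT a : A a + s <= T by rewrite /T; have := leA a; lra.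
have sAs a : s * (A a + s) <= s * T by rewrite ler_wpM2l // ltW.
have s0' : 0 <= s by exact: ltW.
have sF3 : s * \int[mu]_x (u x ^+ 2 * theta x ^+ 2) <= s * T by rewrite ler_wpM2l.
exists u, eta, zeta, M; split=> //.
- by split => //; exact: eu.
- split=> [a|a|].
  + by have := F1 a; lra.
  + have := energy_upper su sz st zM tM s0' s1 dzt a.
    have := F2 a; have := ler_wpM2l s0' (F2 a); have := sAs a; lra.
  (* By [E5], [tl] and [energy_identity] the left side is nearly twice the total of the [A a]. The
     right side contains that total once, so the energy of [u] must supply the rest. *)
  + have := energy_lower su se st eM tM s0' det.
    move: E5; rewrite -/m ler_distl => /andP[E5 _].
    have tl : \int[mu]_x (phi x * (f x - m)) - s <= \int[mu]_x (phi x * (eta x * (f x - m))).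
      have mph : measurable_fun setT (fun x => phi x * (eta x * (f x - m))).
        apply: measurable_funM => //; apply: smooth_measurable; apply: smoothM => //.
        by apply: smoothB => //; exact: smooth_cst.
      have rs := rint_source.
      have rph : rint mu (fun x => phi x * (eta x * (f x - m))).
        apply: (le_rint mph _ (rint_norm rs)) => x.
        rewrite mulrCA normrM ger0_norm // ler_piMl //; by case/andP: (e01 x).
      rewrite lerBlDr -lerBlDl; apply: le_trans tail; rewrite -IntB //.
      apply: le_Int.
      + exact: rintB.
      + apply: (le_rint _ _ (rint_norm rs)) => [|x].
          apply: measurable_funM; first by apply: measurableT_comp => //; exact: (rint_measurable rs).
          apply: measurable_funB; first exact: measurable_cst.
          by apply: measurable_indic; exact: measurable_cball.
        by rewrite normrM normr_id indicE; case: (x \in _); rewrite /= ?subrr ?subr0 ?normr0 ?normr1 ?mulr0 ?mulr1.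
      + move=> x; rewrite indicE; have [xj|xj] := leP `|x| j0%:R.
          rewrite er ?mul1r ?subrr; first by rewrite mulr_ge0 // subr_ge0; case: (_ \in _).
          exact: le_trans rj.
        rewrite memNset /= ?subr0 ?mulr1; last by rewrite /cball /= => h; move: xj; rewrite ltNge h.
        rewrite (_ : _ - _ = (1 - eta x) * (phi x * (f x - m))); last by ring.
        apply: le_trans (ler_norm _) _; rewrite normrM ler_piMl //.
        by rewrite ger0_norm ?subr_ge0 ?gerBl //; case/andP: (e01 x).
    rewrite -energy_identity in tl.
    have SAT : s * \sum_a A a <= s * T by rewrite ler_wpM2l // /T; lra.
    have nT : n%:R * (s * \int[mu]_x (u x ^+ 2 * theta x ^+ 2)) <= n%:R * (s * T) by rewrite ler_wpM2l.
    move: sd; rewrite /N mulrDl; lra.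
- by apply: le_trans E4 _; lra.
(* The gradient of [eta] is compared with [zeta], whose weighted energies are bounded by [F2]. *)
- move=> a b; apply: (@le_trans _ _ (s * T)); last by lra.
  apply: le_trans (sAs a).
  apply: (@le_trans _ _ (s * \int[mu]_x (partial u a x ^+ 2 * zeta x ^+ 2))); last by rewrite ler_wpM2l.
  rewrite -IntZ; last by apply: (@rint_cs _ M); [apply: smoothM => //; apply: smoothX; exact: smooth_partial|exact: supp_inMl].
  apply: le_Int.
  + apply: (@rint_cs _ M); first by apply: smoothM; apply: smoothX; exact: smooth_partial.
    by apply: supp_inMr; apply: supp_inMl; exact: supp_in_partial.
  + apply: rintZ; apply: (@rint_cs _ M); last exact: supp_inMl.
    by apply: smoothM => //; apply: smoothX; exact: smooth_partial.
  + move=> x; rewrite [leLHS]mulrC [leRHS]mulrCA ler_wpM2l ?sqr_ge0 //.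
    apply: (@le_trans _ _ ((s * zeta x) ^+ 2)).
      rewrite -[leLHS]real_normK ?num_real // ler_sqr ?nnegrE //.
      by rewrite mulr_ge0 //; case/andP: (z01 x).
    rewrite exprMn ler_wpM2r ?sqr_ge0 // expr2 ler_piMl //.
Qed.

End approximation.

(** * The Poincare inequality on fibres, integrated *)

Section fibre_gibbs.
Context {R : realType} {m : nat}.
Local Notation lamm := (@lebesgue_rV R m).

Lemma Int_expR_gt0 (K : 'rV[R]_m -> R) : smooth K -> rint lamm (fun y => expR (- K y)) ->
  0 < \int[lamm]_y expR (- K y).
Proof.
move=> sK Ki; have sq : smooth (@cube_bump R m 1) by exact: cube_bump_smooth.
have qM := @cube_bump_supp R m 1 ler01.
have seq : smooth (fun y => cube_bump 1 y * expR (K y)) by smth.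
have [C C0 qC] := cont_supp_bounded (smooth_continuous seq) (supp_inMr _ qM).
have : \int[lamm]_y cube_bump 1 y <= C * \int[lamm]_y expR (- K y).
  rewrite -IntZ //; apply: le_Int.
  - exact: rint_smooth_cs sq qM.
  - exact: rintZ.
  - move=> y; rewrite expRN ler_pdivlMr ?expR_gt0 //.
    by apply: le_trans (qC y); exact: ler_norm.
move/(lt_le_trans (@cube_bump_int_gt0 R m 1 ltr01)) => CI.
rewrite lt_neqAle Int_ge0 ?andbT; last by move=> y; exact: expR_ge0.
by apply/eqP => I0; move: CI; rewrite -I0 mulr0 ltxx.
Qed.

(** The Poincare hypothesis speaks of any measure that is a conditional one; to use it on a fibre
    such a measure must be produced, which is possible where the weight is integrable. *)
Lemma gibbs_exists (K : 'rV[R]_m -> R) : smooth K -> rint lamm (fun y => expR (- K y)) ->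
  exists nu : probability 'rV[R]_m R, gibbs K nu.
Proof.
move=> sK Ki; have Z0 := Int_expR_gt0 sK Ki; set Z := \int[lamm]_y _ in Z0.
have sw : smooth (fun y => Z^-1 * expR (- K y)) by smth.
have w0 y : 0 <= Z^-1 * expR (- K y) by rewrite mulr_ge0 ?expR_ge0 // invr_ge0 ltW.
have [|nu nuE] := @probability_with_density _ _ _ lamm _ (smooth_measurable sw) w0.
  rewrite IntE; last exact: rintZ.
  by rewrite IntZ // -/Z mulVf // gt_eqF.
by exists nu, Z.
Qed.

End fibre_gibbs.

Section fibre_poincare.
Context {R : realType} {n m : nat}.
Local Notation lam := (@lebesgue_rV R n).
Local Notation lamm := (@lebesgue_rV R m).
Variables (e : 'I_m -> 'I_n) (P : pred 'I_n).
Hypothesis injective_e : injective e.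
Hypothesis sumE : forall F : 'I_n -> R, \sum_(a | P a) F a = \sum_j F (e j).

(** The inclusion of the block whose coordinates are listed by [e]; its transpose is the projection
    onto the block. *)
Definition coord_mx : 'M[R]_(m, n) := \matrix_(j, a) (a == e j)%:R.

Lemma mul_coord_mx (y : 'rV[R]_m) j : (y *m coord_mx) ord0 (e j) = y ord0 j.
Proof.
rewrite mxE (bigD1 j) //= mxE eqxx mulr1 big1 ?addr0 // => i ij.
by rewrite mxE eq_sym (inj_eq injective_e) (negbTE ij) mulr0.
Qed.

Lemma mul_coord_mxT (z : 'rV[R]_n) j : (z *m coord_mx^T) ord0 j = z ord0 (e j).
Proof.
rewrite mxE (bigD1 (e j)) //= !mxE eqxx mulr1 big1 ?addr0 // => i ij.
by rewrite !mxE (negbTE ij) mulr0.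
Qed.

Lemma coord_mxK : coord_mx *m coord_mx^T = 1%:M.
Proof.
apply/row_matrixP => i; rewrite row_mul; apply/rowP => j.
rewrite mul_coord_mxT !mxE eq_sym; congr (_ %:R); by rewrite (inj_eq injective_e) eq_sym.
Qed.

Lemma norm_mul_coord_mxT (z : 'rV[R]_n) : `|z *m coord_mx^T| <= `|z|.
Proof. by apply/norm_rV_le => // j; rewrite mul_coord_mxT; exact: coord_le_norm. Qed.

Lemma partial_coord_mx (g : 'rV[R]_n -> R) x j y : smooth g ->
  partial (fun y => g (x + y *m coord_mx)) j y = partial g (e j) (x + y *m coord_mx).
Proof.
move=> sg; rewrite partial_affine; last exact: smooth_differentiable.
rewrite (bigD1 (e j)) //= mxE eqxx mul1r big1 ?addr0 // => a ae.
by rewrite mxE (negbTE ae) mul0r.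
Qed.

Lemma lap_coord_mx H u x y : smooth H -> smooth u ->
  lap xpredT (fun y => H (x + y *m coord_mx)) (fun y => u (x + y *m coord_mx)) y =
  lap P H u (x + y *m coord_mx).
Proof.
move=> sH su; rewrite /lap sumE; apply: eq_bigr => j _.
rewrite (_ : partial (fun y => u (x + y *m coord_mx)) j = fun y => partial u (e j) (x + y *m coord_mx)); last first.
  by apply/funext => z; exact: partial_coord_mx.
by rewrite (partial_coord_mx x j y (smooth_partial (e j) su)) (partial_coord_mx x j y sH).
Qed.

(** With [F] the difference of the integrands, [fibre_Int_ge0] leaves only the fibres on which e^-H
    is integrable. They carry a conditional measure, and [poincare_cutoff] applies to the
    restrictions. *)
Lemma integrated_poincare (H u h eta : 'rV[R]_n -> R) M M' (rho : R) :
  smooth H -> smooth u -> smooth h -> smooth eta -> supp_in eta M -> supp_in h M' ->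
  (forall x, 0 <= eta x <= 1) ->
  (forall a x, eta x * partial h a x = eta x * partial u a x) ->
  0 < rho -> rint lam (fun x => expR (- H x)) ->
  (forall x (nu : probability 'rV[R]_m R), x *m coord_mx^T = 0 ->
    gibbs (fun y => H (x + y *m coord_mx)) nu -> poincare rho nu) ->
  2 * (\int[lam]_x (expR (- H x) * (eta x ^+ 2 * \sum_(a | P a) partial u a x ^+ 2))) <=
  \int[lam]_x (expR (- H x) * \sum_(a | P a) partial h a x ^+ 2) +
  rho^-1 * \int[lam]_x (expR (- H x) *
    (eta x * lap P H u x + 2 * \sum_(a | P a) partial eta a x * partial u a x) ^+ 2).
Proof.
move=> sH su sh se eM hM e01 ehu rho0 Hi Hp.
have sL := smooth_lap P sH su.
have sq1 : smooth (fun x => expR (- H x) * (eta x ^+ 2 * \sum_(a | P a) partial u a x ^+ 2)) by smth.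
have sq2 : smooth (fun x => expR (- H x) * \sum_(a | P a) partial h a x ^+ 2) by smth.
have sq3 : smooth (fun x => expR (- H x) *
  (eta x * lap P H u x + 2 * \sum_(a | P a) partial eta a x * partial u a x) ^+ 2) by smth.
move: sq1 sq2 sq3; set T1 := (fun x => _ * (eta x ^+ 2 * _)); set T2 := (fun x => _ * \sum_(a | P a) _).
set T3 := (fun x => _ * _ ^+ 2) => sT1 sT2 sT3.
have T1M : supp_in T1 M by apply: supp_inMl; apply: supp_inMr; exact: supp_inMl.
have T2M : supp_in T2 M'.
  by move=> x xM; rewrite /T2 big1 ?mulr0 // => a _; rewrite (supp_in_partial a hM) // expr0n.
have T3M : supp_in T3 M.
  move=> x xM; rewrite /T3 (eM x xM) mul0r add0r big1 ?mulr0 ?expr0n ?mulr0 // => a _.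
  by rewrite (supp_in_partial a eM) // mul0r.
have [r1 r2 r3] : [/\ rint lam T1, rint lam T2 & rint lam T3].
  by split; [exact: rint_smooth_cs T1M|exact: rint_smooth_cs T2M|exact: rint_smooth_cs T3M].
pose F x := T2 x + rho^-1 * T3 x - 2 * T1 x.
have FE : \int[lam]_x F x = \int[lam]_x T2 x + rho^-1 * \int[lam]_x T3 x - 2 * \int[lam]_x T1 x.
  rewrite IntB; [|by apply: rintD => //; exact: rintZ|exact: rintZ].
  by rewrite IntD ?IntZ //; exact: rintZ.
rewrite -subr_ge0 -FE.
have sF : smooth F by apply: smoothB; [apply: smoothD => //|]; apply: smoothM => //; exact: smooth_cst.
have FM : supp_in F (Num.max M M').
  move=> x; rewrite gt_max => /andP[xM xM'].
  by rewrite /F T1M // T2M // T3M // !mulr0 addr0 subrr.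
have sV : smooth (fun x => expR (- H x)) by smth.
apply: (fibre_Int_ge0 coord_mxK norm_mul_coord_mxT (smooth_measurable sV) _ Hi (smooth_continuous sF) FM).
  by move=> x; exact: expR_ge0.
(* The hypothesis [Hp] concerns base points whose component in the block is 0. The fibre through [x]
   is parametrised from such a point, at the cost of a translation by [y0]. *)
move=> x Vx; pose y0 := x *m coord_mx^T; pose x0 := x - y0 *m coord_mx.
have x0P : x0 *m coord_mx^T = 0 by rewrite /x0 mulmxBl -mulmxA coord_mxK mulmx1 subrr.
have xE y : x + y *m coord_mx = x0 + (y + y0) *m coord_mx by rewrite mulmxDl /x0 addrACA addNr addr0.
pose L y := x0 + y *m coord_mx.
have sc g : smooth g -> smooth (fun y => g (L y)) by exact: smooth_affine.
have supc g M0 : supp_in g M0 -> supp_in (fun y => g (L y)) M0.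
  move=> gM y yM; apply: gM; apply: lt_le_trans yM _.
  apply: le_trans (norm_mul_coord_mxT (L y)).
  by rewrite /L mulmxDl -mulmxA coord_mxK mulmx1 x0P add0r.
have Kr : rint lamm (fun y => expR (- H (L y))).
  have := integrable_translation (- y0) Vx; apply: eq_rint => y.
  by rewrite xE addrNK.
have [nu gK] := gibbs_exists (sc H sH) Kr.
have := poincare_cutoff (sc H sH) (sc u su) (sc h sh) (sc eta se) (supc eta M eM) (supc h M' hM)
  (fun y => e01 (L y)) _ rho0 gK (Hp x0 nu x0P gK).
have pc g j y : smooth g -> partial (fun y => g (L y)) j y = partial g (e j) (L y).
  exact: partial_coord_mx.
have -> : \int[lamm]_y (expR (- H (L y)) * (eta (L y) ^+ 2 * \sum_a partial (fun y => u (L y)) a y ^+ 2)) =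
    \int[lamm]_y T1 (L y).
  by apply: eq_Int => y; rewrite /T1 sumE; do 2 congr (_ * _); apply: eq_bigr => j _; rewrite pc.
have -> : \int[lamm]_y (expR (- H (L y)) * \sum_a partial (fun y => h (L y)) a y ^+ 2) =
    \int[lamm]_y T2 (L y).
  by apply: eq_Int => y; rewrite /T2 sumE; congr (_ * _); apply: eq_bigr => j _; rewrite pc.
have -> : \int[lamm]_y (expR (- H (L y)) * (eta (L y) * lap xpredT (fun y => H (L y)) (fun y => u (L y)) y +
      2 * \sum_a partial (fun y => eta (L y)) a y * partial (fun y => u (L y)) a y) ^+ 2) =
    \int[lamm]_y T3 (L y).
  apply: eq_Int => y; rewrite /T3 sumE; congr (_ * _ ^+ 2); congr (_ * _ + _ * _).
    exact: lap_coord_mx.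
  by apply: eq_bigr => j _; rewrite !pc.
move=> ineq.
have -> : \int[lamm]_y F (x + y *m coord_mx) = \int[lamm]_y F (L y).
  rewrite -(Rintegral_translation y0 (smooth_measurable (sc F sF))).
  by apply: eq_Int => y; rewrite xE.
have [q1 q2 q3] : [/\ rint lamm (fun y => T1 (L y)), rint lamm (fun y => T2 (L y)) & rint lamm (fun y => T3 (L y))].
  split; [exact: rint_smooth_cs (sc _ sT1) (supc _ _ T1M)|exact: rint_smooth_cs (sc _ sT2) (supc _ _ T2M)
    |exact: rint_smooth_cs (sc _ sT3) (supc _ _ T3M)].
rewrite IntB; [|by apply: rintD => //; exact: rintZ|exact: rintZ].
rewrite IntD ?IntZ //; last exact: rintZ.
rewrite subr_ge0; apply: ineq => a y.
by rewrite !pc.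
Qed.

End fibre_poincare.

Lemma sum_le_ord {R : realType} n (Q : pred 'I_n) (x : 'I_n -> R) D : (forall b, x b <= D) -> 0 <= D ->
  \sum_(b | Q b) x b <= n%:R * D.
Proof.
move=> xD D0; apply: (@le_trans _ _ (\sum_(b | Q b) D)); first by apply: ler_sum => b _.
rewrite sumr_const -[D *+ _]mulr_natl ler_wpM2r // ler_nat -[leqRHS]card_ord; exact: max_card.
Qed.

(** * The estimate for one block *)

Section block.
Context {R : realType} {n N : nat}.
Local Notation lam := (@lebesgue_rV R n).
Variable blk : 'I_n -> 'I_N.
Variables (H : 'rV[R]_n -> R) (mu : probability 'rV[R]_n R) (c : R).
Hypotheses (sH : smooth H) (c0 : 0 < c).
Hypothesis muE : forall A, measurable A ->
  mu A = (\int[lam]_(x in A) (c * expR (- H x))%:E)%E.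
Variable f : 'rV[R]_n -> R.
Hypothesis sf : smooth f.
Let m := \int[mu]_x f x.
Variable (A : 'I_n -> R).
Variables (rho : 'I_N -> R) (kappa : 'I_N -> 'I_N -> R).
Hypothesis rho_gt0 : forall i, 0 < rho i.
Hypothesis kappa_ge0 : forall i j, i != j -> 0 <= kappa i j.
Hypothesis hessian_le : forall i j x (v : 'I_n -> R), i != j ->
  `|\sum_(a | blk a == i) \sum_(b | blk b == j) partial (partial H b) a x * (v a * v b)| <=
  kappa i j * (Num.sqrt (\sum_(a | blk a == i) v a ^+ 2) * Num.sqrt (\sum_(b | blk b == j) v b ^+ 2)).

Let rint_cs g M : smooth g -> supp_in g M -> rint mu g.
Proof. by move=> sg; exact: (gibbs_rint_cs sH c0 muE (smooth_continuous sg)). Qed.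

Let Int_mu g M : smooth g -> supp_in g M -> \int[mu]_x g x = c * \int[lam]_x (expR (- H x) * g x).
Proof.
move=> sg gM; rewrite (gibbs_Int sH c0 muE); last exact: smooth_measurable.
rewrite -IntZ; first by apply: eq_Int => x; rewrite mulrC mulrA.
by apply: (@rint_smooth_cs _ _ _ M); [smth|exact: supp_inMl].
Qed.

Variables (u eta h : 'rV[R]_n -> R) (M d : R).
Hypotheses (su : smooth u) (se : smooth eta) (sh : smooth h).
Hypotheses (eM : supp_in eta M) (hM : supp_in h M).
Hypothesis d0 : 0 <= d.

Let E a := \int[mu]_x (partial u a x ^+ 2 * eta x ^+ 2).
Hypothesis E_le : forall a, E a <= A a + d.
Hypothesis E_ge : \sum_a A a - d <= \sum_a E a.
Hypothesis h_le : forall a, \int[mu]_x (partial h a x ^+ 2) <= A a + d.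
Hypothesis r_le : \int[mu]_x (residual H mu f u x ^+ 2 * eta x ^+ 2) <= d.
Hypothesis eu_le : forall a b, \int[mu]_x (partial eta b x ^+ 2 * partial u a x ^+ 2) <= d.

Let sr : smooth (residual H mu f u).
Proof.
rewrite /residual; apply: smoothB; first by apply: smoothN; exact: smooth_lap.
by apply: smoothB => //; exact: smooth_cst.
Qed.

Let E0 a : 0 <= E a.
Proof. by apply: Int_ge0 => x; rewrite mulr_ge0 ?sqr_ge0. Qed.

(** From the lower bound on the total energy, subtract the upper bounds on the coordinates outside
    the block: at most n errors [d], besides the one in [E_ge]. *)
Lemma block_energy_ge i : \sum_(a | blk a == i) A a - (n%:R + 1) * d <= \sum_(a | blk a == i) E a.
Proof.
move: E_ge; rewrite (bigID (fun a => blk a == i)) /= [in leRHS](bigID (fun a => blk a == i)) /=.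
have : \sum_(a | blk a != i) E a <= \sum_(a | blk a != i) A a + n%:R * d.
  rewrite -lerBlDl -sumrB; apply: sum_le_ord => // a; rewrite lerBlDl; exact: E_le.
lra.
Qed.

Lemma block_h_le i : \sum_(a | blk a == i) \int[mu]_x (partial h a x ^+ 2) <=
  \sum_(a | blk a == i) A a + n%:R * d.
Proof.
rewrite -lerBlDl -sumrB; apply: sum_le_ord => // a; rewrite lerBlDl; exact: h_le.
Qed.

Let V k x := \sum_(a | blk a == k) partial u a x ^+ 2.

Let V0 k x : 0 <= V k x.
Proof. by apply: sumr_ge0 => a _; exact: sqr_ge0. Qed.

Let G k x := eta x * Num.sqrt (V k x).

Let mG k : measurable_fun setT (G k).
Proof.
apply: measurable_funM; first exact: smooth_measurable.
have ms : measurable_fun setT (@Num.sqrt R).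
  by apply: continuous_measurable_fun; exact: sqrt_continuous.
have mV : measurable_fun setT (V k) by apply: smooth_measurable; rewrite /V; smth.
exact: (measurableT_comp ms mV).
Qed.

Let G2 k x : G k x ^+ 2 = \sum_(a | blk a == k) partial u a x ^+ 2 * eta x ^+ 2.
Proof. by rewrite exprMn sqr_sqrtr // mulrC /V mulr_suml. Qed.

Let Ei a : rint mu (fun x => partial u a x ^+ 2 * eta x ^+ 2).
Proof. by apply: (@rint_cs _ M); [smth|do 2 apply: supp_inMl]. Qed.

Let G2i k : rint mu (fun x => G k x ^+ 2).
Proof.
apply: (eq_rint (fun x => esym (G2 k x))).
by apply: rint_sum => a _; exact: Ei.
Qed.

Let G2E k : \int[mu]_x G k x ^+ 2 = \sum_(a | blk a == k) E a.
Proof. by rewrite (eq_Int _ (G2 k)) Int_sum // => a _; exact: Ei. Qed.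

Let GG_le i j : \int[mu]_x (G i x * G j x) <=
  Num.sqrt (\sum_(a | blk a == i) E a) * Num.sqrt (\sum_(b | blk b == j) E b).
Proof.
have [_] := Int_CS (G2i i) (G2i j) (mG i) (mG j); rewrite !G2E => CS.
rewrite -sqrtrM; last exact: sumr_ge0.
by apply: le_trans (ler_norm _) _; rewrite -sqrtr_sqr ler_wsqrtr.
Qed.

Let hessian_cs i x : - (eta x ^+ 2 * \sum_(a | blk a == i) \sum_(b | blk b != i)
      partial (partial H b) a x * (partial u a x * partial u b x)) <=
  \sum_(j | j != i) kappa i j * (G i x * G j x).
Proof.
have -> : \sum_(a | blk a == i) \sum_(b | blk b != i)
      partial (partial H b) a x * (partial u a x * partial u b x) =
    \sum_(j | j != i) \sum_(a | blk a == i) \sum_(b | blk b == j)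
      partial (partial H b) a x * (partial u a x * partial u b x).
  rewrite [RHS]exchange_big /=; apply: eq_bigr => a _.
  rewrite (partition_big blk (fun j => j != i)) //=; apply: eq_bigr => j ji.
  by apply: eq_bigl => b; case: (eqVneq (blk b) j) => [->|_]; rewrite ?ji ?andbF.
rewrite mulr_sumr -sumrN; apply: ler_sum => j ji.
have ij : i != j by rewrite eq_sym.
apply: le_trans (ler_norm _) _; rewrite normrN normrM ger0_norm ?sqr_ge0 //.
rewrite (_ : kappa i j * _ = eta x ^+ 2 * (kappa i j * (Num.sqrt (V i x) * Num.sqrt (V j x)))); last by rewrite /G; ring.
by rewrite ler_wpM2l ?sqr_ge0 //; exact: hessian_le.
Qed.

(** The coordinates outside block i are grouped by block. The operator norms bound the forms
    pointwise, and Cauchy-Schwarz in L^2(mu) separates the gradients of the two blocks. *)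
Lemma block_hessian_le i :
  \int[mu]_x (- (eta x ^+ 2 * \sum_(a | blk a == i) \sum_(b | blk b != i)
      partial (partial H b) a x * (partial u a x * partial u b x))) <=
  \sum_(j | j != i) kappa i j *
    (Num.sqrt (\sum_(a | blk a == i) E a) * Num.sqrt (\sum_(b | blk b == j) E b)).
Proof.
have GGi j : rint mu (fun x => kappa i j * (G i x * G j x)).
  by apply: rintZ; exact: (Int_CS (G2i i) (G2i j) (mG i) (mG j)).1.
apply: (@le_trans _ _ (\int[mu]_x \sum_(j | j != i) kappa i j * (G i x * G j x))).
  apply: le_Int (hessian_cs i); last by apply: rint_sum => j _.
  by apply: (@rint_cs _ M); [smth|move=> x xM; rewrite eM // expr0n mul0r oppr0].
rewrite Int_sum //; apply: ler_sum => j ji; rewrite IntZ.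
  by rewrite ler_wpM2l ?kappa_ge0 // eq_sym.
exact: (Int_CS (G2i i) (G2i j) (mG i) (mG j)).1.
Qed.

Let cross_rint a b : rint mu (fun x => partial eta b x ^+ 2 * partial u a x ^+ 2).
Proof. by apply: (@rint_cs _ M); [smth|apply: supp_inMr; apply: supp_inMl; exact: supp_in_partial]. Qed.

Lemma block_cross_le i : \int[mu]_x ((2 * \sum_(a | blk a == i) partial eta a x * partial u a x) ^+ 2) <=
  4 * n%:R ^+ 2 * d.
Proof.
apply: (@le_trans _ _ (\int[mu]_x (4 * n%:R * \sum_a partial eta a x ^+ 2 * partial u a x ^+ 2))).
  apply: le_Int.
  - apply: (@rint_cs _ M); first smth.
    move=> x xM; rewrite big1 ?mulr0 ?expr0n // => a _.
    by rewrite (supp_in_partial a eM) // mul0r.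
  - by apply: rintZ; apply: rint_sum => a _; exact: cross_rint.
  - move=> x; rewrite exprMn -mulrA (_ : 2 ^+ 2 = 4) ?ler_wpM2l //; last by rewrite expr2 -natrM.
    rewrite big_mkcond /=; apply: le_trans (sqr_sum_le _) _; rewrite card_ord ler_wpM2l //.
    apply: ler_sum => a _; case: ifP => _; first by rewrite exprMn.
    by rewrite expr0n /= mulr_ge0 ?sqr_ge0.
rewrite IntZ; last by apply: rint_sum => a _; exact: cross_rint.
rewrite Int_sum; last by move=> a _; exact: cross_rint.
have : \sum_a \int[mu]_x (partial eta a x ^+ 2 * partial u a x ^+ 2) <= n%:R * d.
  by apply: sum_le_ord => // a; exact: eu_le.
by move=> h1; rewrite expr2 -!mulrA; do 2 apply: ler_wpM2l => //.
Qed.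

Variable i : 'I_N.
Hypothesis poincare_i :
  2 * (\int[lam]_x (expR (- H x) * (eta x ^+ 2 * \sum_(a | blk a == i) partial u a x ^+ 2))) <=
  \int[lam]_x (expR (- H x) * \sum_(a | blk a == i) partial h a x ^+ 2) +
  (rho i)^-1 * \int[lam]_x (expR (- H x) *
    (eta x * lap (fun a => blk a == i) H u x + 2 * \sum_(a | blk a == i) partial eta a x * partial u a x) ^+ 2).

Let P a := blk a == i.
Let g := lap P H u.
Let q x := 2 * \sum_(a | P a) partial eta a x * partial u a x.
Let r := residual H mu f u.

Let sg : smooth g.
Proof. exact: smooth_lap. Qed.

Let sq : smooth q.
Proof. by rewrite /q; smth. Qed.

Let qM : supp_in q M.
Proof. by move=> x xM; rewrite /q big1 ?mulr0 // => a _; rewrite (supp_in_partial a eM) // mul0r. Qed.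

(** Twice [block_energy_ge] minus [block_h_le] leaves one copy of the limiting energy, with the
    error 2 (n + 1) + n = 3 n + 2. *)
Lemma block_poincare_mu : rho i * (\sum_(a | P a) A a - (3 * n%:R + 2) * d) <=
  \int[mu]_x (eta x * g x + q x) ^+ 2.
Proof.
have S1 : smooth (fun x => eta x ^+ 2 * \sum_(a | blk a == i) partial u a x ^+ 2) by smth.
have M1 : supp_in (fun x => eta x ^+ 2 * \sum_(a | blk a == i) partial u a x ^+ 2) M.
  by apply: supp_inMr; exact: supp_inMl.
have S2 : smooth (fun x => \sum_(a | blk a == i) partial h a x ^+ 2) by smth.
have M2 : supp_in (fun x => \sum_(a | blk a == i) partial h a x ^+ 2) M.
  by move=> x xM; rewrite big1 // => a _; rewrite (supp_in_partial a hM) // expr0n.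
have S3 : smooth (fun x => (eta x * g x + q x) ^+ 2) by smth.
have M3 : supp_in (fun x => (eta x * g x + q x) ^+ 2) M.
  by move=> x xM; rewrite eM // qM // mul0r addr0 expr0n.
have hs : \int[mu]_x (\sum_(a | blk a == i) partial h a x ^+ 2) =
    \sum_(a | blk a == i) \int[mu]_x (partial h a x ^+ 2).
  rewrite Int_sum // => a _; apply: (@rint_cs _ M); first smth.
  by apply: supp_inMl; exact: supp_in_partial.
have us : \int[mu]_x (eta x ^+ 2 * \sum_(a | blk a == i) partial u a x ^+ 2) = \sum_(a | blk a == i) E a.
  rewrite -Int_sum; last by move=> a _; exact: Ei.
  by apply: eq_Int => x; rewrite mulrC mulr_suml.
move: (ler_wpM2l (ltW c0) poincare_i).
rewrite mulrDr mulrCA -(Int_mu S1 M1) -(Int_mu S2 M2) [c * (_ * _)]mulrCA -(Int_mu S3 M3) us hs.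
have := block_energy_ge i; have := block_h_le i; rewrite -/P => h1 h2 h3.
rewrite -ler_pdivlMl //; lra.
Qed.

(** The left side of [row_inequality] factors as shown, which prepares the comparison with the
    square in [block_poincare_mu]. The term [n%:R ^+ 2 * d] counts the pairs of coordinates in
    [eu_le]. *)
Lemma block_bochner : \int[mu]_x ((eta x * g x + q x) * (eta x * g x + eta x * r x)) <=
  \int[mu]_x (eta x ^+ 2 * \sum_(a | P a) partial u a x * partial f a x) +
  \sum_(j | j != i) kappa i j *
    (Num.sqrt (\sum_(a | blk a == i) E a) * Num.sqrt (\sum_(b | blk b == j) E b)) + n%:R ^+ 2 * d.
Proof.
have := @row_inequality R n P H u f eta m M g r q sH su sf se eM erefl erefl erefl.
move/(ler_wpM2l (ltW c0)).
have SL : smooth (fun x => (eta x * g x) ^+ 2 + eta x * g x * (eta x * r x + q x) + eta x * r x * q x) by smth.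
have ML : supp_in (fun x => (eta x * g x) ^+ 2 + eta x * g x * (eta x * r x + q x) + eta x * r x * q x) M.
  by move=> x xM; rewrite eM // !mul0r expr0n !addr0.
pose X x := eta x ^+ 2 * \sum_(a | P a) partial u a x * partial f a x.
pose Y x := - (eta x ^+ 2 * \sum_(a | P a) \sum_(b | ~~ P b)
      partial (partial H b) a x * (partial u a x * partial u b x)).
pose Z x := \sum_(a | P a) \sum_(b | ~~ P b) partial eta b x ^+ 2 * partial u a x ^+ 2.
have [SX SY SZ] : [/\ smooth X, smooth Y & smooth Z] by split; rewrite /X /Y /Z; smth.
have XM : supp_in X M by apply: supp_inMr; exact: supp_inMl.
have YM : supp_in Y M by move=> x xM; rewrite /Y eM // expr0n mul0r oppr0.
have ZM : supp_in Z M.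
  move=> x xM; rewrite /Z big1 // => a _; rewrite big1 // => b _.
  by rewrite (supp_in_partial b eM) // expr0n mul0r.
have [rX rY rZ] : [/\ rint mu X, rint mu Y & rint mu Z].
  by split; [exact: rint_cs XM|exact: rint_cs YM|exact: rint_cs ZM].
have SR : smooth (fun x => X x + Y x + Z x) by smth.
have MR : supp_in (fun x => X x + Y x + Z x) M by move=> x xM; rewrite XM // YM // ZM // !addr0.
have RE : \int[mu]_x (X x + Y x + Z x) = \int[mu]_x X x + \int[mu]_x Y x + \int[mu]_x Z x.
  by rewrite IntD ?IntD //; exact: rintD.
rewrite -(Int_mu SL ML) -(Int_mu SR MR) RE => row.
have Zle : \int[mu]_x Z x <= n%:R ^+ 2 * d.
  have rZa a : rint mu (fun x => \sum_(b | ~~ P b) partial eta b x ^+ 2 * partial u a x ^+ 2).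
    by apply: rint_sum => b _; exact: cross_rint.
  rewrite Int_sum // expr2 -mulrA; apply: sum_le_ord; last exact: mulr_ge0.
  move=> a; rewrite Int_sum; last by move=> b _; exact: cross_rint.
  by apply: sum_le_ord => // b; exact: eu_le.
have Yle := block_hessian_le i.
apply: (@le_trans _ _ (\int[mu]_x X x + \int[mu]_x Y x + \int[mu]_x Z x)).
  by apply: le_trans row; rewrite le_eqVlt; apply/orP; left; apply/eqP; apply: eq_Int => x; ring.
by rewrite lerD // lerD2l.
Qed.

(* With p = eta g + q, the integrand in [block_bochner] is p (p - q + eta r), so that
   \int p^2 is controlled by the errors q and eta r alone. *)
Lemma block_combined t (b : R) : 0 < t -> t < 1 -> 0 <= b ->
  \int[mu]_x (eta x ^+ 2 * \sum_(a | P a) partial u a x * partial f a x) <=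
    Num.sqrt (\sum_(a | P a) E a) * b ->
  (1 - t) * (rho i * (\sum_(a | P a) A a - (3 * n%:R + 2) * d)) <=
  Num.sqrt (\sum_(a | P a) E a) * b +
  \sum_(j | j != i) kappa i j *
    (Num.sqrt (\sum_(a | blk a == i) E a) * Num.sqrt (\sum_(b | blk b == j) E b)) + n%:R ^+ 2 * d +
  t^-1 * (1 + 2 * n%:R ^+ 2) * d.
Proof.
move=> t0 t1 b0 fb; have W := block_bochner.
pose p x := eta x * g x + q x.
have r2 : smooth (fun x => (eta x * r x - q x) ^+ 2) by smth.
have i1 : rint mu (fun x => p x ^+ 2).
  by apply: (@rint_cs _ M); [rewrite /p; smth|move=> x xM; rewrite /p eM // qM // mul0r addr0 expr0n].
have i2 : rint mu (fun x => r x ^+ 2 * eta x ^+ 2).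
  by apply: (@rint_cs _ M); [smth|do 2 apply: supp_inMl].
have i3 : rint mu (fun x => q x ^+ 2) by apply: (@rint_cs _ M); [smth|exact: supp_inMl].
have i4 : rint mu (fun x => p x * (eta x * g x + eta x * r x)).
  by apply: (@rint_cs _ M); [rewrite /p; smth|move=> x xM; rewrite eM // !mul0r addr0 mulr0].
have i5 : rint mu (fun x => 2^-1 * t^-1 * (r x ^+ 2 * eta x ^+ 2 + q x ^+ 2)) by apply: rintZ; exact: rintD.
(* Young's inequality spends [t * p x ^+ 2] on the product of p with eta r - q, followed by (eta r -
   q)^2 <= 2 ((eta r)^2 + q^2). *)
have young x : (1 - t) * p x ^+ 2 <= p x * (eta x * g x + eta x * r x) +
    2^-1 * t^-1 * (r x ^+ 2 * eta x ^+ 2 + q x ^+ 2).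
  rewrite (_ : eta x * g x + eta x * r x = p x - q x + eta x * r x); last by rewrite /p; ring.
  move: (p x) (q x) (r x) (eta x) => p' q' r' e'.
  have h1 : 0 <= t^-1 * (2 * t * p' + (r' * e' - q')) ^+ 2 by rewrite mulr_ge0 ?invr_ge0 ?sqr_ge0 // ltW.
  have h2 : 0 <= t^-1 * (r' * e' + q') ^+ 2 by rewrite mulr_ge0 ?invr_ge0 ?sqr_ge0 // ltW.
  have tt : t^-1 * t = 1 by rewrite mulVf // gt_eqF.
  have e1 : t^-1 * (2 * t * p' + (r' * e' - q')) ^+ 2 =
    (t^-1 * t) * (4 * t * p' ^+ 2 + 4 * p' * (r' * e' - q')) + t^-1 * (r' * e' - q') ^+ 2 by ring.
  rewrite e1 tt in h1.
  lra.
have Iy := le_Int (rintZ (1 - t) i1) (rintD i4 i5) young.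
rewrite IntZ // IntD // IntZ ?IntD // in Iy; last exact: rintD.
have := ler_wpM2l (_ : 0 <= 1 - t) block_poincare_mu.
rewrite subr_ge0 => /(_ (ltW t1)) pm.
apply: le_trans pm _; apply: le_trans Iy _.
have h3 : 2^-1 * t^-1 * (\int[mu]_x (r x ^+ 2 * eta x ^+ 2) + \int[mu]_x q x ^+ 2) <=
    t^-1 * (1 + 2 * n%:R ^+ 2) * d.
  have := r_le; rewrite -/r => h4; have := block_cross_le i; rewrite -/P => h5.
  rewrite (_ : _ * (_ + _) * d = 2^-1 * t^-1 * (2 * d + 4 * n%:R ^+ 2 * d)); last by field; rewrite gt_eqF.
  rewrite ler_wpM2l ?mulr_ge0 ?invr_ge0 ?(ltW t0) // lerD //.
  apply: le_trans h4 _.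
  by rewrite mulr_natl mulr2n lerDl.
by apply: lerD h3; apply: le_trans W _; rewrite !lerD2r.
Qed.

End block.

Lemma sum_CS {R : realType} (I : finType) (P : pred I) (x y : I -> R) :
  (\sum_(i | P i) x i * y i) ^+ 2 <= (\sum_(i | P i) x i ^+ 2) * (\sum_(i | P i) y i ^+ 2).
Proof.
rewrite expr2 !big_distrlr /=.
have -> : \sum_(i | P i) \sum_(j | P j) x i ^+ 2 * y j ^+ 2 =
    \sum_(i | P i) \sum_(j | P j) (2^-1 * (x i ^+ 2 * y j ^+ 2) + 2^-1 * (x j ^+ 2 * y i ^+ 2)).
  transitivity (\sum_(i | P i) \sum_(j | P j) 2^-1 * (x i ^+ 2 * y j ^+ 2) +
      \sum_(i | P i) \sum_(j | P j) 2^-1 * (x j ^+ 2 * y i ^+ 2)); last first.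
    by rewrite -big_split; apply: eq_bigr => i _; rewrite -big_split.
  rewrite [X in _ + X]exchange_big -big_split; apply: eq_bigr => i _.
  by rewrite -big_split; apply: eq_bigr => j _ /=; field.
apply: ler_sum => i _; apply: ler_sum => j _.
have := sqr_ge0 (x i * y j - x j * y i); lra.
Qed.

Lemma sum_CS_sqrt {R : realType} (I : finType) (P : pred I) (x y : I -> R) :
  `|\sum_(i | P i) x i * y i| <= Num.sqrt (\sum_(i | P i) x i ^+ 2) * Num.sqrt (\sum_(i | P i) y i ^+ 2).
Proof.
rewrite -sqrtrM; last by apply: sumr_ge0 => i _; exact: sqr_ge0.
by rewrite -sqrtr_sqr ler_wsqrtr // sum_CS.
Qed.

Lemma le_linear_limit {R : realType} (x y C : R) : 0 <= C ->
  (forall t, 0 < t -> t < 1 -> x <= y + C * t) -> x <= y.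
Proof.
move=> C0 h; apply/ler_addgt0Pr => e e0.
pose t := Num.min 2^-1 (e / (C + 1)).
have C1 : 0 < C + 1 by rewrite ltr_wpDl.
have t0 : 0 < t by rewrite lt_min invr_gt0 ltr0n divr_gt0.
have t1 : t < 1 by rewrite gt_min invf_lt1 ?ltr1n ?ltr0n.
apply: le_trans (h t t0 t1) _; rewrite lerD2l.
have : t <= e / (C + 1) by rewrite ge_min lexx orbT.
rewrite ler_pdivlMr // => te; apply: le_trans te.
by rewrite mulrC ler_wpM2l ?(ltW t0) // lerDl.
Qed.

(** * Removing the cutoff and the mollification *)

Section limit.
Context {R : realType} {n N : nat}.
Local Notation lam := (@lebesgue_rV R n).
Variable blk : 'I_n -> 'I_N.
Variables (H : 'rV[R]_n -> R) (mu : probability 'rV[R]_n R).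
Hypotheses (sH : smooth H) (muH : gibbs H mu).
Variables (f phi : 'rV[R]_n -> R) (dphi : 'rV[R]_n -> 'rV[R]_n).
Hypotheses (sf : smooth f) (f_L2 : f \in Lfun mu 2%:E).
Hypotheses (phi_H1 : sobolev1 mu phi dphi) (phi_sol : weak_poisson mu f dphi).
Variables (rho : 'I_N -> R) (kappa : 'I_N -> 'I_N -> R).
Hypothesis rho_gt0 : forall i, 0 < rho i.
Hypothesis kappa_ge0 : forall i j, i != j -> 0 <= kappa i j.
Hypothesis hessian_le : forall i j x (v : 'I_n -> R), i != j ->
  `|\sum_(a | blk a == i) \sum_(b | blk b == j) partial (partial H b) a x * (v a * v b)| <=
  kappa i j * (Num.sqrt (\sum_(a | blk a == i) v a ^+ 2) * Num.sqrt (\sum_(b | blk b == j) v b ^+ 2)).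
Hypothesis poincare_blk : forall i (u h eta : 'rV[R]_n -> R) M M',
  smooth u -> smooth h -> smooth eta -> supp_in eta M -> supp_in h M' ->
  (forall x, 0 <= eta x <= 1) ->
  (forall a x, eta x * partial h a x = eta x * partial u a x) ->
  2 * (\int[lam]_x (expR (- H x) * (eta x ^+ 2 * \sum_(a | blk a == i) partial u a x ^+ 2))) <=
  \int[lam]_x (expR (- H x) * \sum_(a | blk a == i) partial h a x ^+ 2) +
  (rho i)^-1 * \int[lam]_x (expR (- H x) *
    (eta x * lap (fun a => blk a == i) H u x + 2 * \sum_(a | blk a == i) partial eta a x * partial u a x) ^+ 2).

Let A (a : 'I_n) := \int[mu]_x dphi x ord0 a ^+ 2.
Let al i := Num.sqrt (\sum_(a | blk a == i) A a).

Variable i : 'I_N.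
Hypothesis fi : rint mu (fun x => \sum_(a | blk a == i) partial f a x ^+ 2).
Let b := Num.sqrt (\int[mu]_x (\sum_(a | blk a == i) partial f a x ^+ 2)).

Let A0 a : 0 <= A a.
Proof. by apply: Int_ge0 => x; exact: sqr_ge0. Qed.

Let al2 j : al j ^+ 2 = \sum_(a | blk a == j) A a.
Proof. by rewrite sqr_sqrtr // sumr_ge0. Qed.

Let al0 j : 0 <= al j.
Proof. exact: sqrtr_ge0. Qed.

Let b0 : 0 <= b.
Proof. exact: sqrtr_ge0. Qed.

(** The tolerance of the approximation is [t ^+ 2], where [t] is also the parameter of
    [block_combined]: the loss [t^-1 * d] then becomes of order [t]. *)
Let quadratic_t (t : R) : 0 < t -> t < 1 ->
  (1 - t) * (rho i * (al i ^+ 2 - (3 * n%:R + 2) * t ^+ 2)) <=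
  (al i + n%:R * t) * b + \sum_(j | j != i) kappa i j * ((al i + n%:R * t) * (al j + n%:R * t)) +
  n%:R ^+ 2 * t ^+ 2 + (1 + 2 * n%:R ^+ 2) * t.
Proof.
move=> t0 t1; have [c [c0 _ _ muE]] := gibbs_density sH muH.
have t20 : 0 < t ^+ 2 by rewrite exprn_gt0.
have [u [eta [zeta [M [[su se sz eM zM] [e01 ehu] [E_le h_le E_ge] r_le eu_le]]]]] :=
  mollified_approximation sH c0 muE sf phi_H1 phi_sol f_L2 t20.
pose E a := \int[mu]_x (partial u a x ^+ 2 * eta x ^+ 2).
have E0 a : 0 <= E a by apply: Int_ge0 => x; rewrite mulr_ge0 ?sqr_ge0.
(* A square root of al^2 + n t^2 is at most al + n t, as n <= n^2. *)
have sE j : Num.sqrt (\sum_(a | blk a == j) E a) <= al j + n%:R * t.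
  have nt : 0 <= n%:R * t by rewrite mulr_ge0 // ltW.
  rewrite -[leRHS](@ger0_norm R) ?addr_ge0 // -sqrtr_sqr ler_wsqrtr //.
  apply: (@le_trans _ _ (al j ^+ 2 + n%:R * t ^+ 2)).
    rewrite al2 -lerBlDl -sumrB; apply: sum_le_ord; last exact: ltW.
    by move=> a; rewrite lerBlDl; exact: E_le.
  rewrite sqrrD -addrA lerD2l exprMn.
  have : n%:R * t ^+ 2 <= n%:R ^+ 2 * t ^+ 2 :> R.
    by rewrite ler_wpM2r ?sqr_ge0 // -natrX ler_nat; case: (n) => // k; rewrite leq_pmulr.
  by have := mulr_ge0 (al0 j) nt; rewrite mulr2n; lra.
have sh : smooth (fun y => zeta y * u y) by exact: smoothM.
have hM : supp_in (fun y => zeta y * u y) M by exact: supp_inMr.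
have sE0 j : 0 <= Num.sqrt (\sum_(a | blk a == j) E a) by exact: sqrtr_ge0.
have fb : \int[mu]_x (eta x ^+ 2 * \sum_(a | blk a == i) partial u a x * partial f a x) <=
    Num.sqrt (\sum_(a | blk a == i) E a) * b.
  pose V x := \sum_(a | blk a == i) partial u a x ^+ 2.
  pose W x := \sum_(a | blk a == i) partial f a x ^+ 2.
  have V0 x : 0 <= V x by apply: sumr_ge0 => a _; exact: sqr_ge0.
  have W0 x : 0 <= W x by apply: sumr_ge0 => a _; exact: sqr_ge0.
  have ms : measurable_fun setT (@Num.sqrt R).
    by apply: continuous_measurable_fun; exact: sqrt_continuous.
  have msqrt g : smooth g -> measurable_fun setT (fun x => Num.sqrt (g x) : R).
    by move=> sg; exact: (measurableT_comp ms (smooth_measurable sg)).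
  have mV : measurable_fun setT (fun x => eta x * Num.sqrt (V x)).
    apply: measurable_funM; first exact: smooth_measurable.
    by apply: msqrt; rewrite /V; smth.
  have mW : measurable_fun setT (fun x => Num.sqrt (W x)) by apply: msqrt; rewrite /W; smth.
  have Ei a : rint mu (fun x => partial u a x ^+ 2 * eta x ^+ 2).
    apply: (gibbs_rint_cs sH c0 muE (M := M)); last by do 2 apply: supp_inMl.
    by apply: smooth_continuous; smth.
  have V2 x : (eta x * Num.sqrt (V x)) ^+ 2 = \sum_(a | blk a == i) partial u a x ^+ 2 * eta x ^+ 2.
    by rewrite exprMn sqr_sqrtr // mulrC /V mulr_suml.
  have W2 x : Num.sqrt (W x) ^+ 2 = W x by rewrite sqr_sqrtr.
  have iV : rint mu (fun x => (eta x * Num.sqrt (V x)) ^+ 2).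
    by apply: (eq_rint (fun x => esym (V2 x))); apply: rint_sum => a _; exact: Ei.
  have iW : rint mu (fun x => Num.sqrt (W x) ^+ 2) by exact: (eq_rint (fun x => esym (W2 x)) fi).
  have [iVW] := Int_CS iV iW mV mW.
  rewrite (eq_Int _ V2) (eq_Int _ W2) Int_sum; last by move=> a _; exact: Ei.
  move=> CS; apply: (@le_trans _ _ (\int[mu]_x (eta x * Num.sqrt (V x) * Num.sqrt (W x)))); last first.
    rewrite /b -sqrtrM; last exact: sumr_ge0.
    by apply: le_trans (ler_norm _) _; rewrite -sqrtr_sqr ler_wsqrtr.
  apply: le_Int => //.
    apply: (gibbs_rint_cs sH c0 muE (M := M)); last by apply: supp_inMr; exact: supp_inMl.
    by apply: smooth_continuous; smth.
  move=> x; have [e0 e1] := andP (e01 x).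
  apply: (@le_trans _ _ (eta x ^+ 2 * (Num.sqrt (V x) * Num.sqrt (W x)))).
    rewrite ler_wpM2l ?sqr_ge0 //; apply: le_trans (ler_norm _) _; exact: sum_CS_sqrt.
  rewrite -[leRHS]mulrA ler_wpM2r ?mulr_ge0 ?sqrtr_ge0 //.
  by rewrite expr2 ler_piMl.
have := @block_combined R n N blk H mu c sH c0 muE f sf A rho kappa rho_gt0 kappa_ge0 hessian_le u eta _ M _
  su se sh eM hM (ltW t20) E_le E_ge h_le r_le eu_le i
  (poincare_blk i su sh se eM hM e01 ehu) t b t0 t1 b0 fb.
rewrite -al2 (_ : t^-1 * _ * t ^+ 2 = (1 + 2 * n%:R ^+ 2) * t); last by field; rewrite gt_eqF.
move=> /le_trans; apply; rewrite !lerD2r; apply: lerD; first by rewrite ler_wpM2r // sE.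
apply: ler_sum => j ji; rewrite ler_wpM2l ?kappa_ge0 1?eq_sym //.
by apply: ler_pM => //; exact: sE.
Qed.

(** As t tends to 0, every main term of [quadratic_t] contains the factor [al i], which is cancelled
    when positive. If [al i] is 0 the right side is nonnegative anyway. *)
Lemma block_estimate : rho i * al i <= b + \sum_(j | j != i) kappa i j * al j.
Proof.
have S0 : 0 <= \sum_(j | j != i) kappa i j * al j.
  by apply: sumr_ge0 => j ji; rewrite mulr_ge0 // kappa_ge0 // eq_sym.
have [a0|a0] := ltP 0 (al i); last first.
  have -> : al i = 0 by apply/eqP; rewrite eq_le a0 al0.
  by rewrite mulr0 addr_ge0.
rewrite -(ler_pM2l a0) mulrDr mulrCA -expr2.
pose N1 : R := n%:R; have N10 : 0 <= N1 by [].
(* The sum of the coefficients of t and of t^2 in [quadratic_t], using t^2 <= t; the first summand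
   accounts for the factor [1 - t]. *)
pose C := rho i * al i ^+ 2 + rho i * (3 * N1 + 2) + N1 * b +
  \sum_(j | j != i) kappa i j * (N1 * al i + N1 * al j + N1 ^+ 2) + N1 ^+ 2 + (1 + 2 * N1 ^+ 2).
have r0 : 0 <= rho i by exact: ltW.
have S1 : 0 <= \sum_(j | j != i) kappa i j * (N1 * al i + N1 * al j + N1 ^+ 2).
  apply: sumr_ge0 => j ji; rewrite mulr_ge0 ?kappa_ge0 1?eq_sym //.
  by rewrite !addr_ge0 ?mulr_ge0.
apply: (@le_linear_limit _ _ _ C).
  by rewrite /C !addr_ge0 ?mulr_ge0 ?sqr_ge0 ?addr_ge0 ?mulr_ge0.
move=> t t0 t1; have := quadratic_t t0 t1; rewrite -/N1.
have t2t : t ^+ 2 <= t by rewrite expr2 ler_piMl // ltW.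
have sumle : \sum_(j | j != i) kappa i j * ((al i + N1 * t) * (al j + N1 * t)) <=
    al i * (\sum_(j | j != i) kappa i j * al j) +
    t * \sum_(j | j != i) kappa i j * (N1 * al i + N1 * al j + N1 ^+ 2).
  rewrite !mulr_sumr -big_split /=; apply: ler_sum => j ji.
  rewrite (mulrCA (al i)) (mulrCA t) -mulrDr ler_wpM2l ?kappa_ge0 1?eq_sym //.
  have := ler_wpM2l (sqr_ge0 N1) t2t; lra.
move: sumle S1; rewrite /C; move: (\sum_(j | _) _) (\sum_(j | _) _) (\sum_(j | _) _) => X Y Z XYZ Z0 main.
have h1 : t * (rho i * al i ^+ 2) + rho i * (3 * N1 + 2) * t >= 
   t * (rho i * al i ^+ 2) + (1 - t) * (rho i * (3 * N1 + 2) * t ^+ 2).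
  rewrite lerD2l.
  have k0 : 0 <= rho i * (3 * N1 + 2) by rewrite mulr_ge0 // addr_ge0 // mulr_ge0.
  have := ler_wpM2l k0 t2t; have := mulr_ge0 k0 (sqr_ge0 t); move: (rho i * _) => k kt kk.
  have := mulr_ge0 (ltW t0) kt; lra.
have h2 := ler_wpM2l (sqr_ge0 N1) t2t.
move: h1 h2 main XYZ; move: (rho i) (al i) b => r' a' b' h1 h2 main XYZ.
lra.
Qed.

End limit.

(** * Inverse-positivity and conclusion *)

Section M_matrix.
Context {R : realType} {N : nat}.
Variable A : 'M[R]_N.
Hypothesis pA : posdefmx A.

Lemma posdefmx_unit : A \in unitmx.
Proof.
rewrite -row_free_unit -kermx_eq0; apply/eqP/row_matrixP => i; rewrite row0.
apply/eqP/negP => /negP k0; have := pA.2 _ k0.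
by rewrite -row_mul mulmx_ker row0 mul0mx mxE ltxx.
Qed.

Hypothesis A_le0 : forall i j, i != j -> A i j <= 0.

(** For a row [v] of the inverse, let [w] be its negative part and [p] its positive part, so that w
    = p - v. The form of A at (p, w) is at most 0, because the supports are disjoint and the
    off-diagonal entries nonpositive; at (v, w) it is the i-th entry of [w], hence at least 0. So
    the form at (w, w) is at most 0 and w = 0. *)
Lemma posdefmx_inv_ge0 i j : 0 <= invmx A i j.
Proof.
pose v := row i (invmx A).
have vA : v *m A = row i 1%:M by rewrite -row_mul mulVmx // posdefmx_unit.
pose w : 'rV[R]_N := \row_k Num.max 0 (- v ord0 k).
have w0 k : 0 <= w ord0 k by rewrite mxE le_max lexx.
suff w00 : w = 0.
  have : w ord0 j = 0 by rewrite w00 mxE.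
  rewrite !mxE => /eqP; rewrite eq_le ge_max => /andP[/andP[_]].
  by rewrite oppr_le0.
apply/eqP/negP => /negP /(pA.2); apply/negP; rewrite -leNgt.
pose p : 'rV[R]_N := v + w.
have p0 k : 0 <= p ord0 k.
  by rewrite !mxE; have [h|h] := leP 0 (- invmx A i k); lra.
have pw k : p ord0 k * w ord0 k = 0.
  rewrite !mxE; have [h|h] := leP 0 (- invmx A i k); first by rewrite addrN mul0r.
  by rewrite mulr0.
have -> : w = p - v by rewrite /p addrC addKr.
rewrite {1}mulmxBl vA mulmxBl mxE [X in _ + X]mxE.
have -> : p - v = w by rewrite /p addrC addKr.
rewrite subr_le0; apply: (@le_trans _ _ 0).
  rewrite mxE; apply: sumr_le0 => k _; rewrite [w^T _ _]mxE [X in X * _]mxE mulr_suml.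
  apply: sumr_le0 => l _; have [->|lk] := eqVneq l k.
    by rewrite mulrAC pw mul0r.
  by rewrite mulr_le0_ge0 // mulr_ge0_le0 // A_le0.
rewrite mxE; apply: sumr_ge0 => k _; rewrite !mxE mulr_ge0 //.
by rewrite le_max lexx.
Qed.

End M_matrix.

Section blocks_euclidean.
Context {R : realType} {N : nat} {n : 'I_N -> nat}.
Local Notation X := 'rV[R]_(\sum_i n i).
Import tagnat.

Lemma sum_block (i : 'I_N) (F : 'I_(\sum_i n i) -> R) :
  \sum_(a | sig1 a == i) F a = \sum_(j < n i) F (Rank i j).
Proof.
rewrite (reindex (@rank N n)) /=; last exact/onW_bij/rank_bij.
transitivity (\sum_(k | k == i) \sum_(j < n k) F (Rank k j)); last by rewrite big_pred1_eq.
rewrite sig_big_dep /=.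
apply: eq_big => [[k j]|[k j] _] //=; by rewrite ?andbT /sig1 ?rankK.
Qed.

Lemma Rank_inj (i : 'I_N) : injective (@Rank N n i).
Proof. by move=> j k /eqP; rewrite -val_eqE eq_Rank eqxx => /eqP/val_inj. Qed.

Lemma enorm_sqr m (v : 'rV[R]_m) : enorm v ^+ 2 = \sum_k v ord0 k ^+ 2.
Proof.
rewrite sqr_sqrtr; first by apply: eq_bigr => k _; rewrite expr2.
by apply: sumr_ge0 => k _; rewrite -expr2 sqr_ge0.
Qed.

Lemma enorm_block (v : X) i : enorm (submxrow v i) ^+ 2 = \sum_(a | sig1 a == i) v ord0 a ^+ 2.
Proof. by rewrite enorm_sqr sum_block; apply: eq_bigr => k _; rewrite mxE. Qed.

Lemma set_blockE (x : X) i (y : 'rV[R]_(n i)) : x *m (coord_mx (@Rank N n i))^T = 0 ->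
  set_block x y = x + y *m coord_mx (@Rank N n i).
Proof.
move=> x0; apply/mxrowP => j; rewrite mxrowK.
have [ij|ij] := eqVneq i j.
  subst j; rewrite dfwith_in; apply/rowP => k; rewrite mxE mxE mul_coord_mx; last exact: Rank_inj.
  have := congr1 (fun z : 'rV_ _ => z ord0 k) x0; rewrite mul_coord_mxT mxE => ->.
  by rewrite add0r.
rewrite dfwith_out //; apply/rowP => k; rewrite [LHS]mxE [RHS]mxE [RHS]mxE [X in _ = _ + X]mxE [X in _ = _ + X]big1 ?addr0 // => l _.
rewrite !mxE -val_eqE eq_Rank eq_sym (negbTE ij) mulr0 //.
Qed.

Lemma enorm_eq0 m (v : 'rV[R]_m) : enorm v = 0 -> v = 0.
Proof.
move=> v0; have := enorm_sqr v; rewrite v0 expr0n /= => /esym/eqP.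
rewrite psumr_eq0; last by move=> k _; exact: sqr_ge0.
move=> /allP h; apply/rowP => k; rewrite mxE; apply/eqP; rewrite -sqrf_eq0.
by apply: h; rewrite mem_index_enum.
Qed.

(** By homogeneity, after normalising [u] and [v]; null vectors are treated apart since they cannot
    be normalised. *)
Lemma bilin_norm_le p q (B : 'M[R]_(p, q)) k u v : (bilin_norm B <= k%:E)%E ->
  `|(u *m B *m v^T) ord0 ord0| <= k * (enorm u * enorm v).
Proof.
move=> Bk.
have [u0|u0] := eqVneq (enorm u) 0; first by rewrite u0 mul0r mulr0 (enorm_eq0 u0) !mul0mx mxE normr0.
have [v0|v0] := eqVneq (enorm v) 0.
  by rewrite v0 !mulr0 (enorm_eq0 v0) trmx0 mulmx0 mxE normr0.
have en0 m (z : 'rV[R]_m) : enorm z != 0 -> 0 < enorm z.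
  by move=> h; rewrite lt_neqAle eq_sym h sqrtr_ge0.
have eZ m (z : 'rV[R]_m) : enorm z != 0 -> enorm ((enorm z)^-1 *: z) <= 1.
  move=> h; rewrite -(@ler_pXn2r _ 2) ?nnegrE ?sqrtr_ge0 // enorm_sqr expr1n.
  under eq_bigr do rewrite mxE exprMn.
  by rewrite -mulr_sumr -enorm_sqr -exprMn mulVf // expr1n.
have : (`|((enorm u)^-1 *: u *m B *m ((enorm v)^-1 *: v)^T) ord0 ord0|%:E <= k%:E)%E.
  apply: le_trans Bk; apply: ereal_sup_ubound.
  exists ((enorm u)^-1 *: u); first exact: eZ.
  by exists ((enorm v)^-1 *: v) => //; exact: eZ.
rewrite lee_fin linearZ /= -!scalemxAl -scalemxAr scalerA mxE normrM.
rewrite ger0_norm; last by rewrite mulr_ge0 // invr_ge0 sqrtr_ge0.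
by rewrite -invfM mulrC ler_pdivrMr // mulr_gt0 // en0.
Qed.

Lemma bilin_norm_ge0 p q (B : 'M[R]_(p, q)) : (0 <= bilin_norm B)%E.
Proof.
apply: ereal_sup_ubound; have e0 m : enorm (0 : 'rV[R]_m) <= 1.
  by rewrite /enorm /dotv big1 ?sqrtr0 // => k _; rewrite mxE mul0r.
by exists 0; [exact: e0|exists 0; [exact: e0|rewrite !mul0mx mxE normr0]].
Qed.

Lemma hessian_block_le (H : X -> R) (kappa : 'I_N -> 'I_N -> R) i j x (v : 'I_(\sum_i n i) -> R) :
  (bilin_norm (submxblock (hessian H x) i j) <= (kappa i j)%:E)%E ->
  `|\sum_(a | sig1 a == i) \sum_(b | sig1 b == j) partial (partial H b) a x * (v a * v b)| <=
  kappa i j * (Num.sqrt (\sum_(a | sig1 a == i) v a ^+ 2) * Num.sqrt (\sum_(b | sig1 b == j) v b ^+ 2)).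
Proof.
pose vi := submxrow (\row_a v a : X) i; pose vj := submxrow (\row_a v a : X) j.
move=> /(bilin_norm_le vi vj).
have e k : enorm (submxrow (\row_a v a : X) k) = Num.sqrt (\sum_(a | sig1 a == k) v a ^+ 2).
  rewrite -[LHS]ger0_norm ?sqrtr_ge0 // -sqrtr_sqr enorm_block; congr Num.sqrt.
  by apply: eq_bigr => a _; rewrite mxE.
rewrite !e; congr (`|_| <= _); rewrite mxE sum_block exchange_big /= sum_block.
apply: eq_bigr => l _; rewrite !mxE mulr_suml; apply: eq_bigr => k _.
by rewrite !mxE; ring.
Qed.

End blocks_euclidean.

Theorem theorem2p7 (R : realType) (N : nat) (n : 'I_N -> nat)
  (H : 'rV[R]_(\sum_i n i) -> R) (mu : probability 'rV[R]_(\sum_i n i) R)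
  (rho : 'I_N -> R) (kappa : 'I_N -> 'I_N -> R)
  (f phi : 'rV[R]_(\sum_i n i) -> R)
  (dphi : 'rV[R]_(\sum_i n i) -> 'rV[R]_(\sum_i n i))
  (H_smooth : smooth H) (H_convex : convex_at_infinity H)
  (mu_gibbs : gibbs H mu)
  (rho_gt0 : forall i, 0 < rho i)
  (mu_poincare : forall i x (nu : probability 'rV[R]_(n i) R),
    conditional H x nu -> poincare (rho i) nu)
  (kappaC : forall i j, i != j -> kappa i j = kappa j i)
  (H_kappa : forall i j x, i != j ->
    (bilin_norm (submxblock (hessian H x) i j) <= (kappa i j)%:E)%E)
  (A_posdef : posdefmx (coupling_mx rho kappa))
  (f_smooth : smooth f) (f_L2 : f \in Lfun mu 2%:E)
  (phi_H1 : sobolev1 mu phi dphi)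
  (phi_sol : weak_poisson mu f dphi) :
  forall i : 'I_N,
    (sqrte (\int[mu]_x (enorm (submxrow (dphi x) i) ^+ 2)%:E) <=
     \sum_(j < N) (invmx (coupling_mx rho kappa) i j)%:E *
       sqrte (\int[mu]_x (enorm (submxrow (gradient f x) j) ^+ 2)%:E))%E.
Proof.
have [c [c0 Hi _ muE]] := gibbs_density H_smooth mu_gibbs.
have kappa0 i j : i != j -> 0 <= kappa i j.
  by move=> ij; rewrite -lee_fin; apply: le_trans (H_kappa i j 0 ij); exact: bilin_norm_ge0.
have hess i j x v (ij : i != j) := hessian_block_le v (H_kappa i j x ij).
have pc i x nu : x *m (coord_mx (@tagnat.Rank N n i))^T = 0 ->
    gibbs (fun y => H (x + y *m coord_mx (@tagnat.Rank N n i))) nu -> poincare (rho i) nu.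
  move=> x0 g; apply: (mu_poincare i x); rewrite /conditional.
  rewrite (_ : (fun y => H (set_block x y)) = fun y => H (x + y *m coord_mx (@tagnat.Rank N n i))) //.
  by apply/funext => y; rewrite set_blockE.
have poinc i (u h eta : 'rV[R]_(\sum_i n i) -> R) M M' (su : smooth u) (sh : smooth h) (se : smooth eta)
    (eM : supp_in eta M) (hM : supp_in h M') e01 ehu :=
  integrated_poincare (@Rank_inj N n i) (@sum_block R N n i) H_smooth su sh se eM hM e01 ehu (rho_gt0 i) Hi (pc i).
pose A := coupling_mx rho kappa; rewrite -/A in A_posdef *.
have [_ di] := sobolev1_rint phi_H1.
pose al j := Num.sqrt (\sum_(a | tagnat.sig1 a == j) \int[mu]_x dphi x ord0 a ^+ 2).
have alE j : sqrte (\int[mu]_x (enorm (submxrow (dphi x) j) ^+ 2)%:E)%E = (al j)%:E.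
  rewrite /al -Int_sum; last by move=> a _; exact: di.
  rewrite (_ : (\int[mu]_x _)%E = (\int[mu]_x (\sum_(a | tagnat.sig1 a == j) dphi x ord0 a ^+ 2)%:E)%E).
    by rewrite IntE //; apply: rint_sum => a _; exact: di.
  by apply: eq_integral => x _; rewrite enorm_block.
pose B j := sqrte (\int[mu]_x (enorm (submxrow (gradient f x) j) ^+ 2)%:E)%E.
have BE j : B j = sqrte (\int[mu]_x (\sum_(a | tagnat.sig1 a == j) partial f a x ^+ 2)%:E)%E.
  rewrite /B; congr sqrte; apply: eq_integral => x _; rewrite enorm_block; congr EFin.
  by apply: eq_bigr => a _; rewrite mxE.
have AalE j : \sum_k A j k * al k = rho j * al j - \sum_(k | k != j) kappa j k * al k.
  rewrite [LHS](bigD1 j) //= mxE eqxx -sumrN; congr (_ + _); apply: eq_bigr => k kj.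
  by rewrite mxE eq_sym (negbTE kj) mulNr.
(* If the j-th part of the gradient of [f] is not square integrable, [B j] is infinite and nothing
   is claimed; otherwise this is [block_estimate] rearranged. *)
have grad j : B j = +oo%E \/ ((\sum_k A j k * al k)%:E <= B j)%E.
  rewrite BE; have sF : smooth (fun x => \sum_(a | tagnat.sig1 a == j) partial f a x ^+ 2) by smth.
  have [fi|nfi] := pselect (rint mu (fun x => \sum_(a | tagnat.sig1 a == j) partial f a x ^+ 2)).
    right; rewrite IntE //= lee_fin.
    have := block_estimate H_smooth mu_gibbs f_smooth f_L2 phi_H1 phi_sol rho_gt0 kappa0 hess poinc fi.
    by rewrite -/(al j) AalE lerBlDr.
  left; suff -> : (\int[mu]_x (\sum_(a | tagnat.sig1 a == j) partial f a x ^+ 2)%:E = +oo)%E by [].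
  apply/eqP; rewrite -leye_eq leNgt; apply/negP => lt; apply: nfi; apply/integrableP; split.
    by apply/measurable_EFinP; exact: smooth_measurable.
  rewrite (eq_integral (fun x => (\sum_(a | tagnat.sig1 a == j) partial f a x ^+ 2)%:E)) // => x _ /=.
  by rewrite ger0_norm // sumr_ge0 // => a _; exact: sqr_ge0.
have A_le0 j k : j != k -> A j k <= 0.
  by move=> jk; rewrite mxE (negbTE jk) oppr_le0; exact: kappa0.
have w0 := posdefmx_inv_ge0 A_posdef A_le0.
have B0 j : (0 <= B j)%E by exact: sqrte_ge0.
move=> i; rewrite alE -/A -[X in (_ <= X)%E]/(\sum_(j < N) (invmx A i j)%:E * B j)%E.
have t0 j : (0 <= (invmx A i j)%:E * B j)%E by rewrite mule_ge0 // lee_fin.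
(* One infinite [B j] with a positive weight makes the right side infinite. In the remaining case
   only finite [B j] have a positive weight. *)
have [[j [wj Bj]]|fin] := pselect (exists j, 0 < invmx A i j /\ B j = +oo%E).
  rewrite (bigD1 j) //= Bj gt0_muley ?lte_fin // addye ?leey //.
  by rewrite gt_eqF // (lt_le_trans (ltNy0)) // sume_ge0.
(* Writing the energies as A^-1 (A al) lets the bounds on A al be inserted with the nonnegative
   weights of A^-1. *)
have alA : al i = \sum_j invmx A i j * \sum_k A j k * al k.
  pose v : 'cV[R]_N := \col_k al k.
  have : v i ord0 = (invmx A *m (A *m v)) i ord0 by rewrite mulKmx // posdefmx_unit.
  rewrite mxE => ->; rewrite mxE; apply: eq_bigr => j _; rewrite mxE; congr (_ * _).
  by apply: eq_bigr => k _; rewrite [v _ _]mxE.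
rewrite alA -sumEFin; apply: lee_sum => j _.
(* A null weight removes its term even when [B j] is infinite, by the convention 0 times infinity =
   0. *)
have [wj|wj] := ltP 0 (invmx A i j); last first.
  have -> : invmx A i j = 0 by apply/eqP; rewrite eq_le wj w0.
  by rewrite mul0r mul0e.
rewrite EFinM lee_wpmul2l ?lee_fin ?w0 //.
by case: (grad j) => // Bj; case: fin; exists j.
Qed.
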